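(* Let $0<b<1$ and let $A$ be a linear cocycle over $X$ with base $f$ such that $f$ has no attractors. Assume that $X$ is $b$-asymptotically dissipative for the cocycle $A$. Then $A$ has dominated splitting if and only if for each $\beta=(\beta_-,\beta_+)\in\Delta$ with $\beta_+>b$, the set $\mathrm{Crit}(\beta)$ is empty.
   Context: $X$ is a compact topological space, $TX$ is a locally trivial complex vector bundle of rank 2 over $X$ with fibres $T_z$, equipped with a continuous hermitian metric with norms $\|\cdot\|_z$. A linear cocycle $A:TX\to TX$ with base $f$ is a continuous bundle isomorphism covering a homeomorphism $f:X\to X$, so that $A_z:T_z\to T_{f(z)}$ is a complex linear isomorphism. For $n\in\mathbb{Z}$, $A^n_z:T_z\to T_{f^n(z)}$ is the $n$-th iterate ($A^0=\mathrm{Id}$). Determinants are computed with respect to orthonormal bases of the fibres. $\overline{\mathbb{C}}_z=\mathbb{P}^1(T_z)$ is the space of complex lines (directions) of $T_z$. For $\xi\in\overline{\mathbb{C}}_z$ and $n\in\mathbb{Z}$, put $$g(n,\xi)=\frac{|\det(A^n_z)|}{\|A^n_zv_\xi\|_{f^n(z)}^2},\qquad v_\xi\in T_z \text{ unit vector with } [v_\xi]=\xi .$$ Dominated splitting: there are an $A$-invariant splitting $TX=E\oplus F$ into complex one-dimensional subspaces and $l\ge1$ with $\|A^l_z|_{E_z}\|\cdot\|A^{-l}_{f^l(z)}|_{F_{f^l(z)}}\|<\frac12$ for all $z\in X$. $X$ is $b$-asymptotically dissipative for $A$ if there is $C>0$ with $|\det(A^n_z)|\le Cb^n$ for all $z\in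 X$, $n\ge0$. A point $z\in X$ is regular if $T_z=E_z\oplus F_z$ with $E_z,F_z$ complex one-dimensional and there are numbers $\lambda^-(z)\le\lambda^+(z)$ with $\lim_{n\to\pm\infty}\frac1n\log\|A^n_zu\|=\lambda^-(z)$ for $u\in E_z\setminus\{0\}$ and $\lim_{n\to\pm\infty}\frac1n\log\|A^n_zv\|=\lambda^+(z)$ for $v\in F_z\setminus\{0\}$. An $f$-invariant probability measure $\mu$ is partially hyperbolic if $\lambda^-(x)<0\le\lambda^+(x)$ for every regular point $x\in\mathrm{supp}(\mu)$. $f$ has no attractors if every $f$-invariant probability measure is partially hyperbolic. $\Delta=\{\beta=(\beta_-,\beta_+):0<\beta_+\le\beta_-<1\}$. $\mathrm{Crit}(\beta)$ is the set of $\beta$-critical points: those $x\in X$ for which there is $\xi_x\in\overline{\mathbb{C}}_x$ with $g(n,\xi_x)\ge\beta_+^{n}$ and $g(-n,\xi_x)\ge\beta_-^{-n}$ for every $n\ge0$.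
   Formalization: The compact space X is assumed Hausdorff (and nonempty); without Hausdorff the claim fails, e.g. X = Z with the cofinite topology, f the shift and A = diag(1/4,1/2), where no invariant probability exists, A is dominated and Crit(1/2,1/2) = X. *)

(* Defs.v *)
From HB Require Import structures.
From mathcomp Require Import all_boot all_order all_algebra.
From mathcomp Require Import sesquilinear.
From mathcomp Require Import complex.
From mathcomp Require Import all_classical all_reals all_analysis.

Set Implicit Arguments.
Unset Strict Implicit.
Unset Printing Implicit Defensive.

Import Order.TTheory GRing.Theory Num.Theory.
Import numFieldNormedType.Exports.

Local Open Scope classical_set_scope.
Local Open Scope ring_scope.

(* Naming the structure makes the algebraic and topological structures on the
   complex numbers those of an arbitrary [numClosedFieldType]. *)
Definition Cplx (R : realType) : numClosedFieldType := R[i].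

(* [pack] and [unpack] only identify the points of the total space with the
   pairs (base point, vector of its fibre).  The topology of [total] is
   unrelated to the disjoint-sum topology of the sigma type; it is fixed by
   [local_triviality]. *)
Record hermitian_bundle (R : realType) (X : topologicalType) := HermitianBundle {
  fibre : X -> vectType (Cplx R);
  total : topologicalType;
  pack : {z : X & fibre z} -> total;
  unpack : total -> {z : X & fibre z};
  packK : cancel pack unpack;
  unpackK : cancel unpack pack;
  proj_continuous : continuous (fun e => tag (unpack e));
  local_triviality : forall x : X, exists U : set X,
    exists phi : forall z, 'Hom(fibre z, 'rV[Cplx R]_2),
    exists psi : forall z, 'Hom('rV[Cplx R]_2, fibre z),
    [/\ open U /\ U x,
        forall z, U z -> cancel (phi z) (psi z) /\ cancel (psi z) (phi z),
        {within [set e | U (tag (unpack e))],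
           continuous (fun e => phi (tag (unpack e)) (tagged (unpack e)))} &
        {within U `*` [set: 'rV[Cplx R]_2],
           continuous (fun p => pack (Tagged fibre (psi p.1 p.2)))}];
  (* linear in the first argument, conjugate-linear in the second *)
  herm : forall z, {dot (fibre z) for Num.conj};
  (* continuity of the metric on the fibre product of [total] with itself:
     [G] is determined by [herm] there, and irrelevant elsewhere *)
  herm_continuous : exists G : total * total -> Cplx R,
    {within [set p | tag (unpack p.1) = tag (unpack p.2)], continuous G} /\
    forall z (u v : fibre z),
      G (pack (Tagged fibre u), pack (Tagged fibre v)) = herm z u v
}.

Section BundleTheory.
Variables (R : realType) (X : topologicalType) (TX : hermitian_bundle R X).
Local Notation T := (fibre TX).

Definition hnorm z (v : T z) : R := Num.sqrt (complex.Re (herm TX z v v)).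

Definition is_onb z (e : 2.-tuple (T z)) : bool :=
  basis_of {:T z} e && orthonormal (herm TX z) e.

Definition onb z : 2.-tuple (T z) := xget [tuple 0; 0] [set e | is_onb e].

Definition lin_matrix z w (e : 2.-tuple (T z)) (e' : 2.-tuple (T w))
    (L : 'Hom(T z, T w)) : 'M[Cplx R]_2 :=
  \matrix_(i, j) coord e' i (L (tnth e j)).

(* |det L|; it does not depend on the bases, see [absdetE] below. *)
Definition absdet z w (L : 'Hom(T z, T w)) : R :=
  complex.Re `|\det (lin_matrix (onb z) (onb w) L)|.

Definition restr_norm z w (L : 'Hom(T z, T w)) (E : {vspace T z}) : R :=
  sup [set hnorm (L v) | v in [set v | v \in E /\ hnorm v = 1]].

Definition line_splitting z (E F : {vspace T z}) : Prop :=
  [/\ \dim E = 1%N, \dim F = 1%N, (E :&: F = 0)%VS & (E + F = {:T z})%VS].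

Definition P1 z := {L : {vspace T z} | \dim L == 1%N}.

Definition unit_vec z (xi : P1 z) : T z :=
  xget 0 [set v | v \in val xi /\ hnorm v = 1].

Definition total_map (f : X -> X) (A : forall z, 'Hom(T z, T (f z)))
    (e : total TX) : total TX :=
  let: existT z v := unpack e in pack (Tagged T (A z v)).

Fixpoint iter_cocycle (f : X -> X) (A : forall z, 'Hom(T z, T (f z)))
    (n : nat) (z : X) : 'Hom(T z, T (iter n f z)) :=
  match n with
  | 0%N => \1%VF
  | m.+1 => (A (iter m f z) \o iter_cocycle A m z)%VF
  end.

End BundleTheory.

Record linear_cocycle (R : realType) (X : topologicalType)
    (TX : hermitian_bundle R X) := LinearCocycle {
  base : X -> X;
  base_inv : X -> X;
  baseK : cancel base base_inv;
  base_invK : cancel base_inv base;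
  base_continuous : continuous base;
  base_inv_continuous : continuous base_inv;
  cocycle_map : forall z, 'Hom(fibre TX z, fibre TX (base z));
  cocycle_inv : forall z, 'Hom(fibre TX z, fibre TX (base_inv z));
  cocycleK : cancel (total_map cocycle_map) (total_map cocycle_inv);
  cocycle_invK : cancel (total_map cocycle_inv) (total_map cocycle_map);
  cocycle_continuous : continuous (total_map cocycle_map);
  cocycle_inv_continuous : continuous (total_map cocycle_inv)
}.

Section CocycleTheory.
Variables (R : realType) (X : topologicalType) (TX : hermitian_bundle R X).
Variable A : linear_cocycle TX.
Local Notation T := (fibre TX).

Definition baseZ (n : int) (z : X) : X :=
  match n with
  | Posz m => iter m (base A) z
  | Negz m => iter m.+1 (base_inv A) z
  end.

Definition cocycleZ (n : int) (z : X) : 'Hom(T z, T (baseZ n z)) :=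
  match n return 'Hom(T z, T (baseZ n z)) with
  | Posz m => iter_cocycle (cocycle_map A) m z
  | Negz m => iter_cocycle (cocycle_inv A) m.+1 z
  end.

Definition gfun (n : int) (z : X) (xi : P1 TX z) : R :=
  absdet (cocycleZ n z) / hnorm (cocycleZ n z (unit_vec xi)) ^+ 2.

Definition dominated_splitting : Prop :=
  exists E F : forall z, {vspace T z},
  [/\ forall z, line_splitting (E z) (F z),
      forall z, (cocycle_map A z @: E z)%VS = E (base A z),
      forall z, (cocycle_map A z @: F z)%VS = F (base A z) &
      exists l : nat, (1 <= l)%N /\
        forall z, restr_norm (cocycleZ l z) (E z) *
          restr_norm (cocycleZ (- l%:Z) (baseZ l z)) (F (baseZ l z)) < 1 / 2].

Definition asymptotically_dissipative (b : R) : Prop :=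
  exists C : R, 0 < C /\
    forall (z : X) (n : nat), absdet (cocycleZ n z) <= C * b ^+ n.

Definition lyapunov_exponent (z : X) (v : T z) (lambda : R) : Prop :=
  ((n%:R)^-1 * ln (hnorm (cocycleZ n z v)) @[n --> \oo] --> lambda) /\
  ((- n%:R)^-1 * ln (hnorm (cocycleZ (- n%:Z) z v)) @[n --> \oo] --> lambda).

Definition regular_with (z : X) (lm lp : R) : Prop :=
  lm <= lp /\
  exists E F : {vspace T z},
  [/\ line_splitting E F,
      forall u, u \in E -> u != 0 -> lyapunov_exponent u lm &
      forall v, v \in F -> v != 0 -> lyapunov_exponent v lp].

Definition Crit (beta_m beta_p : R) : set X :=
  [set x | exists xi : P1 TX x, forall n : nat,
    beta_p ^+ n <= gfun n xi /\ beta_m ^- n <= gfun (- n%:Z) xi].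

End CocycleTheory.

Section BundleFacts.
Variables (R : realType) (X : topologicalType) (TX : hermitian_bundle R X).
Local Notation T := (fibre TX).

Lemma dim_fibre z : \dim {:T z} = 2%N.
Proof.
have [U [phi [psi [[_ Uz] UK _ _]]]] := local_triviality TX z.
have [phiK psiK] := UK z Uz.
have dimP (V W : vectType (Cplx R)) (f : 'Hom(V, W)) :
    injective f -> (\dim {:V} <= \dim {:W})%N.
  move=> /lker0P/eqP f0; rewrite -(limg_ker_dim f {:V}) f0 capv0 dimv0 add0n.
  exact/dimvS/subvf.
apply/eqP; rewrite eqn_leq.
have d2 : \dim {: 'rV[Cplx R]_2} = 2%N by rewrite dimvf.
by apply/andP; split; rewrite -d2;
  [exact: dimP (can_inj phiK)|exact: dimP (can_inj psiK)].
Qed.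

Lemma is_onbP z (e : 2.-tuple (T z)) :
  (forall i j, herm TX z (tnth e i) (tnth e j) = (i == j)%:R) -> is_onb e.
Proof.
move=> he.
have inj : injective (tnth e).
  move=> i j eij; have := he i j; rewrite -eij he eqxx.
  by case: eqVneq => // _ /eqP; rewrite oner_eq0.
have on : orthonormal (herm TX z) e.
  apply/orthonormalP; split; first exact/tuple_uniqP.
  move=> u v /tnthP[i ->] /tnthP[j ->].
  by rewrite he (inj_eq inj).
rewrite /is_onb on andbT basisEfree (orthonormal_free on) subvf.
by rewrite size_tuple dim_fibre.
Qed.

Lemma onb_herm z (e : 2.-tuple (T z)) : is_onb e ->
  forall i j, herm TX z (tnth e i) (tnth e j) = (i == j)%:R.
Proof.
move=> /andP[_ /orthonormalP[/tuple_uniqP inj he]] i j.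
by rewrite he ?mem_tnth// (inj_eq inj).
Qed.

Lemma exists_unit z (v : T z) : v != 0 ->
  exists a : (Cplx R), a != 0 /\ herm TX z (a *: v) (a *: v) = 1.
Proof.
move=> v0; have h0 := neq0_dnorm_gt0 (s := herm TX z) _ v0.
set h := herm TX z v v in h0.
exists (sqrtC h)^-1; split; first by rewrite invr_eq0 sqrtC_eq0 gt_eqF.
rewrite dnormZ normfV ger0_norm ?sqrtC_ge0 ?ltW// exprVn sqrtCK.
by rewrite -/h mulVf// gt_eqF.
Qed.

Lemma onbP z : is_onb (onb TX z).
Proof.
rewrite /onb; case: xgetP => [e -> //|] none; exfalso.
have bB := vbasisP {:T z}.
have : size (vbasis {:T z}) = 2%N by rewrite size_tuple dim_fibre.
move: (basis_free bB); case: (tval (vbasis _)) => [|u [|w []]]// + _.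
rewrite free_cons span_seq1 seq1_free => /andP[uw w0].
have [a [a0 a1]] := exists_unit w0.
pose u' := u - herm TX z u (a *: w) *: (a *: w).
have u'0 : u' != 0.
  apply: contra uw; rewrite subr_eq0 => /eqP ->.
  by rewrite !memvZ// memv_line.
have [c [c0 c1]] := exists_unit u'0.
have ort : herm TX z (c *: u') (a *: w) = 0.
  by rewrite linearZl_LR /u' linearBl linearZl_LR/= a1 mulr1 subrr mulr0.
apply: (none [tuple c *: u'; a *: w]); apply: is_onbP => i j.
have ort' : herm TX z (a *: w) (c *: u') = 0.
  by rewrite hermC /= ort rmorph0 mulr0.
case: i => [[|[|]]]//= ?; case: j => [[|[|]]]//= ?;
  by rewrite !(tnth_nth 0)/=.
Qed.

Lemma onb_coord z (e : 2.-tuple (T z)) i v :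
  is_onb e -> coord e i v = herm TX z v (tnth e i).
Proof.
move=> eP; have /andP[be _] := eP.
rewrite {2}(coord_basis be (memvf v)) linear_sumlz/=.
rewrite (bigD1 i)//= big1 ?addr0; last first.
  move=> j ji; rewrite linearZl_LR/= -(tnth_nth 0) onb_herm// (negPf ji).
  by rewrite mulr0.
by rewrite linearZl_LR/= -(tnth_nth 0) onb_herm// eqxx mulr1.
Qed.

Lemma lin_matrix_comp z w y (e : 2.-tuple (T z)) (e' : 2.-tuple (T w))
    (e'' : 2.-tuple (T y)) (L : 'Hom(T z, T w)) (K : 'Hom(T w, T y)) :
  is_onb e' ->
  lin_matrix e e'' (K \o L)%VF = lin_matrix e' e'' K *m lin_matrix e e' L.
Proof.
move=> /andP[be' _]; apply/matrixP => i j; rewrite !mxE comp_lfunE.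
rewrite {1}(coord_basis be' (memvf (L (tnth e j)))) !linear_sum.
by apply: eq_bigr => k _; rewrite !mxE !linearZ/= -(tnth_nth 0) mulrC.
Qed.

Lemma norm_det_onb z (e e' : 2.-tuple (T z)) : is_onb e -> is_onb e' ->
  `|\det (lin_matrix e e' \1%VF)| = 1.
Proof.
move=> eP e'P.
have M1 : lin_matrix e' e \1%VF *m lin_matrix e e' \1%VF = 1%:M.
  rewrite -lin_matrix_comp//; apply/matrixP => i j.
  by rewrite !mxE comp_lfunE !lfunE/= onb_coord// onb_herm// eq_sym.
have MC : lin_matrix e' e \1%VF = (map_mx Num.conj (lin_matrix e e' \1%VF))^T.
  apply/matrixP => i j; rewrite !mxE !lfunE/= !onb_coord//.
  by rewrite hermC /= expr0 mul1r.
have := congr1 determinant M1.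
rewrite det_mulmx MC det_tr det1 det_map_mx => d1.
apply/eqP; rewrite -(@pexpr_eq1 _ _ 2)//; apply/eqP.
by rewrite normCK mulrC.
Qed.

Lemma absdetE z w (L : 'Hom(T z, T w)) (e : 2.-tuple (T z))
    (e' : 2.-tuple (T w)) : is_onb e -> is_onb e' ->
  absdet L = complex.Re `|\det (lin_matrix e e' L)|.
Proof.
move=> eP e'P; rewrite /absdet -[in RHS](comp_lfun1l L).
rewrite (lin_matrix_comp _ _ _ _ (onbP w)) det_mulmx normrM norm_det_onb ?onbP//.
rewrite mul1r -[in RHS](comp_lfun1r L) (lin_matrix_comp _ _ _ _ (onbP z)).
by rewrite det_mulmx normrM norm_det_onb ?onbP// mulr1.
Qed.

Lemma hnormZ z (a : (Cplx R)) (v : T z) :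
  hnorm (a *: v) = complex.Re `|a| * hnorm v.
Proof.
rewrite /hnorm dnormZ.
have -> : `|a| = real_complex R (complex.Re `|a|).
  by case: a => x y; rewrite normc_def.
have -> : herm TX z v v = real_complex R (complex.Re (herm TX z v v)).
  have : 0 <= herm TX z v v by exact: dnorm_ge0.
  by case: (herm TX z v v) => x y; rewrite lecE/= => /andP[/eqP-> _].
have r0 : 0 <= complex.Re `|a|.
  by case: a => x y; rewrite normc_def/= sqrtr_ge0.
rewrite -[_ ^+ 2](rmorphXn (real_complex R)) -(rmorphM (real_complex R))/=.
by rewrite sqrtrM ?sqr_ge0// sqrtr_sqr ger0_norm.
Qed.

Lemma hnorm_eq1 z (v : T z) : herm TX z v v = 1 -> hnorm v = 1.
Proof. by rewrite /hnorm => ->/=; rewrite sqrtr1. Qed.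

Lemma unit_vecP z (xi : P1 TX z) :
  unit_vec xi \in val xi /\ hnorm (unit_vec xi) = 1.
Proof.
rewrite /unit_vec; case: xgetP => [v -> //|none]; exfalso.
have xi0 : val xi != 0%VS by rewrite -dimv_eq0 (eqP (valP xi)).
have v0 : vpick (val xi) != 0 by rewrite vpick0.
have [a [a0 a1]] := exists_unit v0.
by apply: (none (a *: vpick (val xi))); split; rewrite ?memvZ ?memv_pick// hnorm_eq1.
Qed.

End BundleFacts.

Lemma gfunE (R : realType) (X : topologicalType) (TX : hermitian_bundle R X)
    (A : linear_cocycle TX) n z (xi : P1 TX z) (v : fibre TX z) :
  v \in val xi -> hnorm v = 1 ->
  gfun A n xi = absdet (cocycleZ A n z) / hnorm (cocycleZ A n z v) ^+ 2.
Proof.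
move=> vxi v1; rewrite /gfun; have [uxi u1] := unit_vecP xi.
suff [c vE] : exists c, v = c *: unit_vec xi.
  have c1 : complex.Re `|c| = 1 by move: v1; rewrite vE hnormZ u1 mulr1.
  by rewrite vE linearZ hnormZ c1 mul1r.
suff /vlineP : v \in <[unit_vec xi]>%VS by [].
suff -> : <[unit_vec xi]>%VS = val xi by [].
apply/eqP; rewrite eqEdim -memvE uxi (eqP (valP xi)) dim_vline.
suff -> : unit_vec xi != 0 by [].
apply: contraPneq u1 => -> /eqP.
by rewrite /hnorm linear0l sqrtr0 eq_sym oner_eq0.
Qed.

Definition Delta (R : realType) (beta_m beta_p : R) : Prop :=
  [/\ 0 < beta_p, beta_p <= beta_m & beta_m < 1].

Section Measures.
Variables (R : realType) (X : ptopologicalType).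
Local Notation borel := (g_sigma_algebraType (@open X)).

Definition invariant_measure (f : X -> X) (mu : probability borel R) : Prop :=
  forall B : set borel, measurable B -> mu (f @^-1` B) = mu B.

Definition msupport (mu : probability borel R) : set X :=
  [set x | forall U : set X, open U -> U x -> (0 < mu U)%E].

Definition partially_hyperbolic (TX : hermitian_bundle R X)
    (A : linear_cocycle TX) (mu : probability borel R) : Prop :=
  forall x, msupport mu x ->
  forall lm lp, regular_with A x lm lp -> lm < 0 /\ 0 <= lp.

(* A property of the base, relative to the exponents of the cocycle [A]. *)
Definition no_attractors (TX : hermitian_bundle R X) (A : linear_cocycle TX)
    : Prop :=
  forall mu : probability borel R,
  invariant_measure (base A) mu -> partially_hyperbolic A mu.

End Measures.

(* Main.v *)
Require Import Defs.
From HB Require Import structures.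
From mathcomp Require Import all_boot all_order all_algebra.
From mathcomp Require Import complex.
From mathcomp Require Import finmap.
From mathcomp Require Import all_classical all_reals all_analysis.
From mathcomp Require Import measurable_realfun.
From mathcomp Require Import ring lra.

Set Implicit Arguments.
Unset Strict Implicit.
Unset Printing Implicit Defensive.
Import Order.TTheory GRing.Theory Num.Theory.
Import numFieldNormedType.Exports.
Local Open Scope classical_set_scope.
Local Open Scope ring_scope.

(** The proof takes place on the unit sphere bundle [sphere TX], a compact
    Hausdorff space on which [A] induces a homeomorphism [smap A].  For a unit
    vector [v] the numbers ln |A^n v|, ln |det A^n| and ln g(n, [v]) are Birkhoff
    sums of continuous functions; the last one is [lng A n].  The parallelogram
    [area] is multiplied by |det A^n| under A^n and is bounded by the product of
    the norms.  Hence two directions of one fibre along which g(n, .) grows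
    exponentially coincide ([collinear_of_lng]), and this uniqueness is what
    makes all the line fields below invariant.

    The hypothesis on invariant measures is exploited as follows
    ([fwd_regular_point], [bwd_regular_point]): if an orbit visits a closed set Q
    with positive lower frequency, then Q contains a unit vector over a regular
    point of the support of an invariant probability, so that there
    lambda^- < 0 <= lambda^+.  The frequencies of visit converge along an
    ultrafilter to a finitely additive invariant mean; Riesz' construction turns
    it into a regular invariant probability that does not decrease the mass of
    closed sets; Birkhoff's theorem in both time directions gives exponents at
    almost every unit vector v; and the exponent of one direction and that of the
    determinant determine those of the remaining directions, which is the rank
    two case of Oseledets' theorem ([oseledets]).

    Domination excludes critical points.  If E + F is dominated, g(n, F) decays
    exponentially ([dominated_lng]), so that g(-n, F) grows and a critical
    direction at x has to be F_x.  Then g(n, F_x) >= beta_+^n and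
    |det A^n| <= C b^n with b < beta_+ force |A^n|F_x| to decay exponentially.  By
    the lemma of Pliss there is a positive frequency of times from which A
    contracts F at a definite rate at all later times.  A regular vector with
    this property has both exponents negative: a contradiction.

    Absence of critical points yields domination.  Take beta_- = beta_+ = beta
    in (b, 1) and s = - ln beta.  By compactness a finite window N already detects
    that there are no critical points: a direction with g(-k, .) >= e^(s k) for
    k <= N has g(n, .) < e^(- s n) for some n <= N, and moving forward to that
    time lengthens the range of the backward estimate ([window_step]).  Iterating,
    the backward estimate holds, up to a constant, all along the forward orbit
    ([window_forward]).  The backward orbit of every point of X meets the
    directions of the window infinitely often ([window_recurrent]): otherwise
    there would be a regular point whose backward orbit avoids them, whereas at a
    regular point dissipation and 0 <= lambda^+ give
    lambda^+ - lambda^- >= - ln b > s, and a direction of exponent lambda^+ enters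
    the window.  A limit yields in each fibre a line F_x with
    g(-k, F_x) >= e^(s k - C).  Finally E_x is the direction of w - t v with v in
    F_x and t chosen so that A^n (w - t v) loses its component along A^n v
    ([contracted_direction]); the ratio of the two growths is then at most
    D g(n, F_x), which decays. *)

(** * Invariant means along an orbit *)

Lemma ultra_cvg_compact (W : Type) (V : topologicalType) (G : set_system W)
    (GU : UltraFilter G) (u : W -> V) (K : set V) :
  compact K -> (\forall w \near G, K (u w)) -> exists2 l, K l & u @ G --> l.
Proof.
move=> cK GK; have GP : ProperFilter G by exact: ultra_proper.
have [l [Kl cl]] := cK _ (fmap_proper_filter u GP) GK.
exists l => // B Bl; change (G (u @^-1` B)).
have [//|GnB] := in_ultra_setVsetC (u @^-1` B) GU.
by have [x [] /=] := cl (~` B) B GnB Bl.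
Qed.

Definition visit_freq (R : realType) (Y : Type) (f : Y -> Y) (p : Y)
    (Q : set Y) (n : nat) : R :=
  (\sum_(k < n) (iter k f p \in Q)%:R) / n%:R.

(** Finite additivity is all that survives of the frequencies of visit in a
    limit along an ultrafilter; in exchange every subset has a mass. *)
Record mean_on (R : realType) (Y : Type) (m : set Y -> R) : Prop := MeanOn {
  meanT : m setT = 1;
  mean_ge0 : forall B, 0 <= m B;
  meanU : forall B C, B `&` C = set0 -> m (B `|` C) = m B + m C }.

Section Mean.
Variables (R : realType) (Y : Type) (f : Y -> Y) (p : Y).

(** The limit of the frequencies along a free ultrafilter.  It is invariant
    because the visits of [p] to [B] and to its preimage during [n] steps differ
    by at most one. *)
Lemma exists_orbit_mean : exists m : set Y -> R,
  [/\ mean_on m, forall B, m (f @^-1` B) = m B &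
    forall Q c, (\forall n \near \oo, c <= visit_freq R f p Q n) -> c <= m Q].
Proof.
have [G [GU sG]] := ultraFilterLemma (eventually_filter : ProperFilter \oo).
have GP : ProperFilter G by exact: ultra_proper.
have nG0 : G [set n | (0 < n)%N] by apply: sG; exists 1%N.
have fge0 Q n : 0 <= visit_freq R f p Q n.
  by rewrite divr_ge0// sumr_ge0// => i _; case: (_ \in _).
have fle1 Q n : visit_freq R f p Q n <= 1.
  case: n => [|n]; first by rewrite /visit_freq big_ord0 mul0r.
  rewrite ler_pdivrMr ?ltr0n// mul1r.
  have -> : n.+1%:R = \sum_(k < n.+1) 1 :> R by rewrite sumr_const card_ord.
  by apply: ler_sum => i _; case: (_ \in _).
have cv Q : exists l : R, visit_freq R f p Q n @[n --> G] --> l.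
  have [|l _ h] := @ultra_cvg_compact _ R G GU (visit_freq R f p Q) _ (@segment_compact R 0 1).
    by apply: filterE => n; rewrite /= in_itv/= fge0 fle1.
  by exists l.
exists (fun Q => projT1 (cid (cv Q))).
have mP Q : visit_freq R f p Q n @[n --> G] --> projT1 (cid (cv Q)).
  by case: cid.
have mE Q l : visit_freq R f p Q n @[n --> G] --> l -> projT1 (cid (cv Q)) = l.
  by move=> h; apply: (cvg_unique _ (mP Q) h).
split.
- split.
  + apply: mE; apply: cvg_near_cst; apply: filterS nG0 => n/= n0.
    rewrite /visit_freq (eq_bigr (fun=> 1)) => [|i _]; last first.
      by rewrite in_setT.
    by rewrite sumr_const card_ord -mulr_natr mul1r divff// pnatr_eq0 -lt0n.
  + by move=> B; apply: cvgr_to_ge (mP B) _; exact: filterE.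
  + move=> B C BC0; apply: mE.
    have -> : visit_freq R f p (B `|` C) =
        (fun n => visit_freq R f p B n + visit_freq R f p C n).
      apply: funext => n; rewrite /visit_freq -mulrDl -big_split/=.
      congr (_ / _); apply: eq_bigr => i _; rewrite in_setU.
      have [|] := boolP (_ \in B); have [|] := boolP (_ \in C);
        rewrite ?addr0 ?add0r// => iC iB; exfalso.
      have : (B `&` C) (iter i f p) by split; apply: set_mem.
      by rewrite BC0.
    by apply: cvgD; exact: mP.
- move=> B; apply: mE.
  have h : (visit_freq R f p (f @^-1` B) n - visit_freq R f p B n) @[n --> \oo] --> (0 : R).
    apply/cvgr0Pnorm_le => e e0.
    near=> n.
    have n0 : 0 < n%:R :> R by rewrite ltr0n; near: n; exists 1%N.
    rewrite /visit_freq -mulrBl normrM normfV (ger0_norm (ltW n0)) ler_pdivrMr//.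
    have -> : \sum_(k < n) (iter k f p \in f @^-1` B)%:R =
       \sum_(k < n) (iter k.+1 f p \in B)%:R :> R.
      by apply: eq_bigr => i _; rewrite iterS; congr (_%:R); apply/idP/idP => /set_mem/mem_set.
    have -> : \sum_(k < n) (iter k.+1 f p \in B)%:R - \sum_(k < n) (iter k f p \in B)%:R
       = (iter n f p \in B)%:R - (p \in B)%:R :> R.
      rewrite -sumrB -(big_mkord xpredT (fun k => (iter k.+1 f p \in B)%:R - (iter k f p \in B)%:R)).
      by rewrite telescope_sumr.
    have /le_trans -> // : `|(iter n f p \in B)%:R - (p \in B)%:R| <= 1 :> R.
      by case: (_ \in _); case: (_ \in _); rewrite ?subrr ?subr0 ?sub0r ?normrN ?normr1 ?normr0.
    rewrite mulrC -ler_pdivrMr//.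
    by near: n; exact: (@nbhs_infty_ger R).
  have hG : (visit_freq R f p (f @^-1` B) n - visit_freq R f p B n) @[n --> G]
      --> (0 : R) by exact: cvg_trans (cvg_app _ sG) h.
  rewrite -[X in _ --> X]add0r; apply: cvg_trans (cvgD hG (mP B)).
  by apply: near_eq_cvg; apply: filterE => n/=; rewrite subrK.
- move=> Q c hc; apply: cvgr_to_ge (mP Q) _; exact: sG.
Unshelve. all: by end_near. Qed.
End Mean.

Lemma mean0 (R : realType) Y (m : set Y -> R) : mean_on m -> m set0 = 0.
Proof.
move=> mm; have := meanU mm (setI0 set0).
by rewrite setU0 => h; apply: (@addrI _ (m set0)); rewrite -h addr0.
Qed.

Lemma le_mean (R : realType) Y (m : set Y -> R) B C : mean_on m ->
  B `<=` C -> m B <= m C.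
Proof.
move=> mm BC; rewrite -(setDUK BC) meanU// ?lerDl ?mean_ge0//.
by apply/seteqP; split=> // x [] ? [].
Qed.

Lemma mean_le1 (R : realType) Y (m : set Y -> R) B : mean_on m -> m B <= 1.
Proof. by move=> mm; rewrite -(meanT mm) le_mean. Qed.

Lemma le_meanU (R : realType) Y (m : set Y -> R) B C : mean_on m ->
  m (B `|` C) <= m B + m C.
Proof.
move=> mm; have -> : B `|` C = B `|` (C `\` B).
    apply/seteqP; split=> x; last by move=> [|[]]; [left|right].
    by move=> [|Cx]; [left|have [Bx|nB] := pselect (B x); [left|right]].
rewrite meanU//; first by rewrite lerD2l le_mean.
by apply/seteqP; split=> // x [] ? [].
Qed.

(** * From an invariant mean to a regular Borel measure *)

Section RegularMeasure.
Variables (R : realType) (Y : ptopologicalType).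
Hypothesis cptY : compact [set: Y].
Hypothesis hausY : hausdorff_space Y.

(** By normality, the part of [K] outside [V] has a neighbourhood whose closure
    lies in [U]. *)
Lemma closed_split (K U V : set Y) : closed K -> open U -> open V ->
  K `<=` U `|` V -> exists K1 K2, [/\ closed K1, closed K2, K1 `<=` U,
   K2 `<=` V & K = K1 `|` K2].
Proof.
move=> cK oU oV KUV.
have cA : closed (K `\` V) by rewrite setDE; apply: closedI => //; exact: open_closedC.
have hN := compact_normal hausY cptY cA.
have [] : filter_from (set_nbhs (K `\` V)) closure U.
  apply: hN => x [Kx nVx].
  by apply: open_nbhs_nbhs; split=> //; have [] := KUV _ Kx.
move=> B /set_nbhsP[C [oC KC CB]] BU.
exists (K `&` closure B), (K `\` C); split.
- by apply: closedI => //; exact: closed_closure.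
- by rewrite setDE; apply: closedI => //; exact: open_closedC.
- by move=> x [_] /BU.
- by move=> x [Kx nCx]; apply: contrapT => nVx; apply: nCx; exact: KC.
- apply/seteqP; split=> x; last by move=> [] [].
  move=> Kx; have [Cx|nCx] := pselect (C x); last by right.
  by left; split=> //; apply: subset_closure; exact: CB.
Qed.

Variable m : set Y -> R.
Hypothesis mm : mean_on m.
Local Open Scope ereal_scope.

(** The two regularizations of Riesz' representation theorem: the mass of an
    open set is read off from its closed subsets, that of an arbitrary set from
    the open sets containing it. *)
Definition inner_mass (U : set Y) : \bar R :=
  ereal_sup [set (m K)%:E | K in [set K | closed K /\ K `<=` U]].

Definition outer_mass (B : set Y) : \bar R :=
  ereal_inf [set inner_mass U | U in [set U | open U /\ B `<=` U]].

Lemma inner_mass_ub K U : closed K -> K `<=` U -> (m K)%:E <= inner_mass U.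
Proof. by move=> cK KU; apply: ereal_sup_ubound; exists K. Qed.

Lemma inner_mass_lub U x : (forall K, closed K -> K `<=` U -> (m K)%:E <= x) ->
  inner_mass U <= x.
Proof. by move=> h; apply: ge_ereal_sup => _ [K [cK KU] <-]; exact: h. Qed.

Lemma inner_mass_ge0 U : 0 <= inner_mass U.
Proof.
have <- : (m set0)%:E = 0 by rewrite (mean0 mm).
by apply: inner_mass_ub; [exact: closed0|exact: sub0set].
Qed.

Lemma inner_mass_le1 U : inner_mass U <= 1.
Proof. by apply: inner_mass_lub => K _ _; rewrite lee_fin mean_le1. Qed.

Lemma inner_mass_fin U : inner_mass U \is a fin_num.
Proof.
rewrite ge0_fin_numE ?inner_mass_ge0//.
by apply: le_lt_trans (inner_mass_le1 U) _; rewrite ltry.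
Qed.

Lemma le_inner_mass : {homo inner_mass : U V / U `<=` V >-> U <= V}.
Proof.
move=> U V UV; apply: inner_mass_lub => K cK KU.
by apply: inner_mass_ub => //; exact: subset_trans UV.
Qed.

Lemma inner_massU U V : open U -> open V ->
  inner_mass (U `|` V) <= inner_mass U + inner_mass V.
Proof.
move=> oU oV; apply: inner_mass_lub => K cK KUV.
have [K1 [K2 [cK1 cK2 K1U K2V ->]]] := closed_split cK oU oV KUV.
apply: (@le_trans _ _ ((m K1)%:E + (m K2)%:E)).
  by rewrite -EFinD lee_fin le_meanU.
by apply: leeD; exact: inner_mass_ub.
Qed.

(** A closed subset of the union is compact and hence covered by finitely many
    of the open sets; this is how finite additivity becomes countable
    subadditivity. *)
Lemma inner_mass_bigcup (U : (set Y)^nat) : (forall n, open (U n)) ->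
  inner_mass (\bigcup_n U n) <= \sum_(n <oo) inner_mass (U n).
Proof.
move=> oU; apply: inner_mass_lub => K cK KU.
have cptK : compact K by exact: (subclosed_compact cK cptY (@subsetT _ K)).
move: (cptK); rewrite compact_cover => /(_ nat setT U) [] //.
move=> D _ KD.
have [N DN] : exists N, forall i, [set` D] i -> (i < N)%N.
  exists (\max_(i <- enum_fset D) i).+1 => i /= iD; rewrite ltnS.
  exact: leq_bigmax_seq.
have KN : K `<=` \bigcup_(i < N) U i.
  by move=> x /KD[i /= iD Uix]; exists i => //; exact: DN.
apply: (@le_trans _ _ (inner_mass (\bigcup_(i < N) U i))).
  exact: inner_mass_ub.
apply: (@le_trans _ _ (\sum_(0 <= i < N) inner_mass (U i))); last first.
  by apply: nneseries_lim_ge => n _ _; exact: inner_mass_ge0.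
rewrite bigcup_mkord big_mkord.
elim: N {DN KN} => [|N IH].
  rewrite !big_ord0; apply: inner_mass_lub => L _ L0.
  by rewrite (_ : L = set0) ?mean0//; apply/seteqP; split.
rewrite !big_ord_recr/=; apply: le_trans (inner_massU _ _) _ => //.
  by elim/big_ind : _ => [||i _]; [exact: open0|exact: openU|exact: oU].
by apply: leeD.
Qed.

Lemma outer_mass_lb B U : open U -> B `<=` U -> outer_mass B <= inner_mass U.
Proof. by move=> oU BU; apply: ereal_inf_lbound; exists U. Qed.

Lemma outer_mass_glb B x :
  (forall U, open U -> B `<=` U -> x <= inner_mass U) -> x <= outer_mass B.
Proof. by move=> h; apply: le_ereal_inf_tmp => _ [U [oU BU] <-]; exact: h. Qed.

Lemma outer_mass_open U : open U -> outer_mass U = inner_mass U.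
Proof.
move=> oU; apply/eqP; rewrite eq_le outer_mass_lb//=.
by apply: outer_mass_glb => V _; exact: le_inner_mass.
Qed.

Lemma outer_mass_ge0 B : 0 <= outer_mass B.
Proof. by apply: outer_mass_glb => U _ _; exact: inner_mass_ge0. Qed.

Lemma outer_mass_fin B : outer_mass B \is a fin_num.
Proof.
rewrite ge0_fin_numE ?outer_mass_ge0//.
apply: (@le_lt_trans _ _ 1); last by rewrite ltry.
by apply: le_trans (outer_mass_lb openT _) (inner_mass_le1 _).
Qed.

Lemma outer_mass0 : outer_mass set0 = 0.
Proof.
apply/eqP; rewrite eq_le outer_mass_ge0 andbT.
apply: le_trans (outer_mass_lb open0 _) _ => //.
apply: inner_mass_lub => K _ K0; rewrite (_ : K = set0) ?mean0//.
by apply/seteqP; split.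
Qed.

Lemma le_outer_mass : {homo outer_mass : B C / B `<=` C >-> B <= C}.
Proof.
move=> B C BC; apply: outer_mass_glb => U oU CU; apply: outer_mass_lb => //.
exact: subset_trans CU.
Qed.

Lemma outer_mass_adherent B (e : R) : (0 < e)%R ->
  exists U, [/\ open U, B `<=` U & inner_mass U <= outer_mass B + e%:E].
Proof.
move=> e0; have [_ [U [oU BU] <-] h] := lb_ereal_inf_adherent e0 (outer_mass_fin B).
by exists U; split=> //; exact: ltW.
Qed.

Lemma outer_mass_sigma_subadditive : sigma_subadditive outer_mass.
Proof.
move=> B; apply/lee_addgt0Pr => e e0.
apply: le_trans (epsilon_trick _ (fun n => outer_mass_ge0 (B n)) (ltW e0)).
have /choice[U hU] : forall n, exists U, [/\ open U, B n `<=` U &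
    inner_mass U <= outer_mass (B n) + (e / (2 ^ n.+1)%:R)%:E].
  move=> n; apply: outer_mass_adherent.
  by rewrite divr_gt0// ltr0n expn_gt0.
apply: (@le_trans _ _ (inner_mass (\bigcup_n U n))).
  apply: outer_mass_lb; first by apply: bigcup_open => i _; have [] := hU i.
  by apply: subset_bigcup => i _; have [] := hU i.
apply: le_trans (inner_mass_bigcup _) _; first by move=> n; have [] := hU n.
apply: lee_nneseries => [n _ _|n _]; first exact: inner_mass_ge0.
by have [] := hU n.
Qed.

HB.instance Definition _ := isOuterMeasure.Build R Y outer_mass
  outer_mass0 outer_mass_ge0 le_outer_mass outer_mass_sigma_subadditive.

Definition mean_outer : {outer_measure set Y -> \bar R} := outer_mass.

(** Inside an almost optimal open set U containing [B], exhaust U `&` V by a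
    closed K and U `\` K by a closed L.  These are disjoint, so that the mean of
    their union is at most the mass of U. *)
Lemma open_caratheodory V : open V -> outer_mass.-caratheodory V.
Proof.
move=> oV; apply: le_caratheodory_measurable => B.
suff : outer_mass (B `&` V) + outer_mass (B `&` ~` V) <= outer_mass B by [].
apply/lee_addgt0Pr => e e0.
have e3 : (0 < e / 3)%R by rewrite divr_gt0.
have [U [oU BU hU]] := outer_mass_adherent B e3.
have [_ [K [cK KU] <-] hK] := ub_ereal_sup_adherent e3 (inner_mass_fin (U `&` V)).
have [_ [L [cL LU] <-] hL] := ub_ereal_sup_adherent e3 (inner_mass_fin (U `\` K)).
have oUK : open (U `\` K) by rewrite setDE; apply: openI => //; exact: closed_openC.
have h1 : outer_mass (B `&` V) <= inner_mass (U `&` V).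
  by apply: outer_mass_lb; [exact: openI|exact: setSI].
have h2 : outer_mass (B `&` ~` V) <= inner_mass (U `\` K).
  by apply: outer_mass_lb => // x [/BU Ux nVx]; split=> // /KU[].
have h3 : (m K)%:E + (m L)%:E <= inner_mass U.
  rewrite -EFinD -meanU//.
    apply: inner_mass_ub; first exact: closedU.
    by move=> x [/KU[]|/LU[]].
  by apply/seteqP; split=> // x [Kx /LU[]].
have := outer_mass_fin B; have := outer_mass_fin (B `&` V).
have := outer_mass_fin (B `&` ~` V); have := inner_mass_fin U.
have := inner_mass_fin (U `&` V); have := inner_mass_fin (U `\` K).
move: hU hK hL h1 h2 h3; rewrite -!/(inner_mass _).
move: (outer_mass _) (outer_mass _) (outer_mass _) (inner_mass _) (inner_mass _) (inner_mass _).
move=> [a| |] [b| |] [c| |] [d| |] [f| |] [g| |]//=.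
rewrite -!EFinD !lte_fin !lee_fin => hU hK hL h1 h2 h3 _ _ _ _ _ _; lra.
Qed.

Lemma borel_caratheodory (B : set (g_sigma_algebraType (@open Y))) :
  measurable B -> outer_mass.-caratheodory B.
Proof.
have h : <<s @open Y >> `<=` @measurable _ (caratheodory_type outer_mass).
  apply: smallest_sub; last by move=> V; exact: open_caratheodory.
  split.
  - exact: measurable0.
  - by move=> C mC; rewrite setTD; exact: measurableC.
  - by move=> F mF; exact: bigcupT_measurable.
exact: h.
Qed.

Local Notation borelY := (g_sigma_algebraType (@open Y)).

Definition mean_measure (B : set borelY) : \bar R := outer_mass B.

Lemma mean_measure0 : mean_measure set0 = 0.
Proof. exact: outer_mass0. Qed.
Lemma mean_measure_ge0 B : 0 <= mean_measure B.
Proof. exact: outer_mass_ge0. Qed.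
Lemma mean_measure_semi_sigma_additive : semi_sigma_additive mean_measure.
Proof.
move=> F mF tF mUF; apply: caratheodory_measure_sigma_additive => //.
  by move=> i; exact: borel_caratheodory.
exact: borel_caratheodory.
Qed.

HB.instance Definition _ := isMeasure.Build _ _ _ mean_measure
  mean_measure0 mean_measure_ge0 mean_measure_semi_sigma_additive.

Lemma mean_measureT : mean_measure setT = 1.
Proof.
rewrite /mean_measure outer_mass_open; last exact: openT.
apply/eqP; rewrite eq_le inner_mass_le1/= -(meanT mm).
by apply: inner_mass_ub => //; exact: closedT.
Qed.

HB.instance Definition _ := Measure_isProbability.Build _ _ _ mean_measure mean_measureT.

Definition mean_probability : probability borelY R := mean_measure.

End RegularMeasure.

(** Closed sets can only gain mass in passing from [m] to the measure: this
    transports positive frequencies.  The second clause, valid by compactness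
    without any countability of the topology, is what makes the complement of the
    support a null set. *)
Lemma mean_regular_measure (R : realType) (Y : ptopologicalType) (m : set Y -> R) :
  compact [set: Y] -> hausdorff_space Y -> mean_on m ->
  exists mu : probability (g_sigma_algebraType (@open Y)) R,
  [/\ forall Q : set Y, closed Q -> ((m Q)%:E <= mu Q)%E,
      forall V : set Y, open V -> (forall y, V y -> exists W : set Y, [/\ open W, W y & mu W = 0]) ->
        mu V = 0 &
      forall (f f' : Y -> Y), cancel f f' -> cancel f' f -> continuous f ->
        continuous f' -> (forall B, m (f @^-1` B) = m B) ->
        forall B : set (g_sigma_algebraType (@open Y)), measurable B ->
        mu (f @^-1` B) = mu B].
Proof.
move=> cptY hausY mm.
exists (mean_probability cptY hausY mm).
split.
- move=> Q cQ; apply: outer_mass_glb => U oU QU.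
  exact: inner_mass_ub.
- move=> V oV h; apply/eqP; rewrite eq_le measure_ge0 andbT.
  rewrite [leLHS]outer_mass_open//; apply: inner_mass_lub => K cK KV.
  have cptK : compact K by exact: (subclosed_compact cK cptY (@subsetT _ K)).
  pose D := [set W : set Y | open W /\ outer_mass m W = 0%E].
  move: (cptK); rewrite compact_cover => /(_ _ D id) [].
  + by move=> W [].
  + by move=> x /KV /h[W [oW Wx W0]]; exists W.
  + move=> D' D'D KD'.
    apply: (@le_trans _ _ (outer_mass m K)).
      by apply: outer_mass_glb => U oU KU; exact: inner_mass_ub.
    apply: (@le_trans _ _ (outer_mass m (\bigcup_(W in [set` D']) W))).
      exact: le_outer_mass.
    rewrite bigcup_fset big_seq; elim/big_ind : _.
    * by rewrite (outer_mass0 mm).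
    * move=> A B A0 B0; have := @outer_measureU2 _ _ (mean_outer cptY hausY mm) A B.
      by move=> /le_trans; apply; rewrite -[0%E]adde0; exact: leeD.
    * by move=> W /D'D /set_mem[_ ->].
- move=> f f' fK f'K cf cf' mf B mB.
  have inn U : inner_mass m (f @^-1` U) = inner_mass m U.
    apply/eqP; rewrite eq_le; apply/andP; split; apply: inner_mass_lub => K cK KU.
      have -> : m K = m (f' @^-1` K).
        by rewrite -(mf (f' @^-1` K)); congr m; apply/seteqP; split=> x /=; rewrite fK.
      apply: inner_mass_ub; first by apply: closed_comp => // x _; exact: cf'.
      by move=> x /= /KU; rewrite /= f'K.
    rewrite -mf; apply: inner_mass_ub; first by apply: closed_comp => // x _; exact: cf.
    by move=> x /= /KU.
  apply/eqP; rewrite eq_le; apply/andP; split; apply: outer_mass_glb => U oU BU.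
    rewrite -inn; apply: outer_mass_lb; first by apply: open_comp => // x _; exact: cf.
    by move=> x /= /BU.
  have -> : inner_mass m U = inner_mass m (f' @^-1` U).
    by rewrite -(inn (f' @^-1` U)); congr inner_mass; apply/seteqP; split=> x /=; rewrite fK.
  apply: outer_mass_lb; first by apply: open_comp => // x _; exact: cf'.
  by move=> x Bx; apply: BU; rewrite /= f'K.
Qed.

(** * Birkhoff sums and the maximal ergodic inequality *)

Definition birkhoff_sum (R : realType) (Y : Type) (f : Y -> Y) (h : Y -> R)
    (n : nat) (y : Y) : R := \sum_(k < n) h (iter k f y).

Section BirkhoffSums.
Variables (R : realType) (Y : Type) (f : Y -> Y).
Implicit Types (h : Y -> R) (n : nat) (y : Y).

Lemma birkhoff_sum0 h y : birkhoff_sum f h 0 y = 0.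
Proof. by rewrite /birkhoff_sum big_ord0. Qed.

Lemma birkhoff_sumS h n y :
  birkhoff_sum f h n.+1 y = birkhoff_sum f h n y + h (iter n f y).
Proof. by rewrite /birkhoff_sum big_ord_recr. Qed.

Lemma birkhoff_sumSl h n y :
  birkhoff_sum f h n.+1 y = h y + birkhoff_sum f h n (f y).
Proof.
rewrite /birkhoff_sum big_ord_recl/=; congr (_ + _).
by apply: eq_bigr => i _; rewrite /= -iterSr.
Qed.

Lemma birkhoff_sum_add h n k y :
  birkhoff_sum f h (n + k) y = birkhoff_sum f h n y + birkhoff_sum f h k (iter n f y).
Proof.
elim: k => [|k IH]; first by rewrite addn0 birkhoff_sum0 addr0.
by rewrite addnS !birkhoff_sumS IH -addrA -iterD addnC.
Qed.

Lemma birkhoff_sumD h g n y : birkhoff_sum f (fun z => h z + g z) n y =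
  birkhoff_sum f h n y + birkhoff_sum f g n y.
Proof. by rewrite /birkhoff_sum big_split. Qed.

Lemma birkhoff_sumZ (c : R) h n y :
  birkhoff_sum f (fun z => c * h z) n y = c * birkhoff_sum f h n y.
Proof. by rewrite /birkhoff_sum mulr_sumr. Qed.

Lemma birkhoff_sumN h n y :
  birkhoff_sum f (fun z => - h z) n y = - birkhoff_sum f h n y.
Proof. by rewrite /birkhoff_sum sumrN. Qed.

Lemma birkhoff_sum_cst (c : R) n y : birkhoff_sum f (fun=> c) n y = c * n%:R.
Proof. by rewrite /birkhoff_sum sumr_const card_ord mulr_natr. Qed.

Lemma birkhoff_sum_norm h B n y : (forall z, `|h z| <= B) ->
  `|birkhoff_sum f h n y| <= B * n%:R.
Proof.
move=> hB; apply: le_trans (ler_norm_sum _ _ _) _.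
by rewrite -(birkhoff_sum_cst B n y); apply: ler_sum.
Qed.

End BirkhoffSums.

Section MaximalErgodic.
Variables (R : realType) (d : measure_display) (Y : measurableType d).
Variable mu : probability Y R.
Variable f : Y -> Y.
Hypothesis mf : measurable_fun setT f.
Hypothesis muf : forall B, measurable B -> mu (f @^-1` B) = mu B.
Variables (h : Y -> R) (B : R).
Hypothesis mh : measurable_fun setT h.
Hypothesis hB : forall y, `|h y| <= B.
Variable D : set Y.
Hypothesis mD : measurable D.
Hypothesis invD : f @^-1` D = D.
Hypothesis posD : forall y, D y -> exists n, 0 < birkhoff_sum f h n y.

(** The largest of the Birkhoff sums of length at most [n], the empty one
    included. *)
Fixpoint maxsum (n : nat) (y : Y) : R :=
  if n is n'.+1 then Num.max 0 (h y + maxsum n' (f y)) else 0.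

Let B0 : 0 <= B. Proof. exact: le_trans (normr_ge0 _) (hB point). Qed.

Let maxsum_ge0 n y : 0 <= maxsum n y.
Proof. by case: n => [|n]//=; rewrite le_max lexx. Qed.

Let maxsum_le n y : maxsum n y <= B * n%:R.
Proof.
elim: n y => [|n IH] y /=; first by rewrite mulr0.
rewrite ge_max mulr_ge0//= -natr1 mulrDr mulr1 addrC lerD//.
exact: le_trans (ler_norm _) (hB y).
Qed.

Let maxsum_mono n y : maxsum n y <= maxsum n.+1 y.
Proof.
elim: n y => [|n IH] y; first exact: maxsum_ge0.
by rewrite /= ge_max; apply/andP; split; rewrite le_max ?lexx// lerD2l IH orbT.
Qed.

Let maxsum_ge n y : birkhoff_sum f h n y <= maxsum n y.
Proof.
elim: n y => [|n IH] y; first by rewrite birkhoff_sum0.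
by rewrite birkhoff_sumSl /= le_max lerD2l IH orbT.
Qed.

Let maxsum_measurable n : measurable_fun setT (maxsum n).
Proof.
elim: n => [|n IH]; first exact: measurable_cst.
apply: measurable_maxr; first exact: measurable_cst.
apply: measurable_funD => //.
exact: measurableT_comp.
Qed.

Let intD (g : Y -> R) C : measurable_fun setT g -> (forall y, `|g y| <= C) ->
  mu.-integrable D (EFin \o g).
Proof.
move=> mg gC; apply: measurable_bounded_integrable => //.
- by apply: le_lt_trans (probability_le1 _ mD) _; rewrite ltry.
- exact: measurable_funS mg.
- exists C; split; first exact: num_real.
  by move=> x Cx y _ /=; apply: le_trans (gC y) (ltW Cx).
Qed.

Let maxsum_norm n y : `|maxsum n y| <= B * n%:R.
Proof. by rewrite ger0_norm ?maxsum_ge0// maxsum_le. Qed.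

Let Z n := [set y | maxsum n.+1 y <= 0].

Let mZ n : measurable (Z n).
Proof.
have := measurable_fun_ler (maxsum_measurable n.+1) (@measurable_cst _ _ _ _ setT (0 : R)).
move=> /(_ measurableT [set true]); rewrite setTI; apply => //.
Qed.

(** Garsia's inequality.  Where the maximum of the sums is positive it is
    attained by a nonempty sum, which starts with [h y]; elsewhere the term with
    [B] compensates. *)
Let pointwise n y : 0 <= h y - maxsum n y + maxsum n (f y) + B * \1_(Z n) y.
Proof.
rewrite indicE; have [yZ|yZ] := boolP (y \in Z n).
  have := set_mem yZ; rewrite /Z /= ge_max => /andP[_ hy].
  have : maxsum n y = 0.
    apply/eqP; rewrite eq_le maxsum_ge0 andbT.
    by apply: le_trans (maxsum_mono _ _) _; exact: (set_mem yZ).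
  move=> ->; rewrite subr0 mulr1 -addrA addrC.
  have := hB y; rewrite ler_norml => /andP[h1 _].
  have := maxsum_ge0 n (f y); lra.
have : 0 < maxsum n.+1 y.
  by rewrite ltNge; apply: contra yZ => ?; apply/mem_set.
rewrite /= lt_max ltxx/= mulr0 addr0 => hp.
have := maxsum_mono n y; rewrite /= (max_idPr (ltW hp)); lra.
Qed.

(** Integrate Garsia's inequality over [D]: the two integrals of [maxsum n]
    cancel by invariance, and the sets [Z n] shrink to a set disjoint from [D]. *)
Lemma maximal_ergodic : 0 <= \int[mu]_(y in D) h y.
Proof.
have inv n : \int[mu]_(y in D) maxsum n (f y) = \int[mu]_(y in D) maxsum n y.
  rewrite /Rintegral; congr fine.
  rewrite -[in LHS]invD.
  rewrite -(@ge0_integral_pushforward _ _ _ _ _ f _ mu D (EFin \o maxsum n))//.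
  - by apply: eq_measure_integral => A mA _; exact: muf.
  - by apply/measurable_EFinP; exact: measurable_funS (maxsum_measurable n).
  - by move=> y _ /=; rewrite lee_fin.
have ind n : mu.-integrable D (EFin \o (\1_(Z n) : Y -> R)).
  apply: (@intD _ 1) => // y.
  by rewrite indicE; case: (_ \in _); rewrite ?normr1 ?normr0.
have ineq n : 0 <= \int[mu]_(y in D) h y + B * fine (mu (Z n `&` D)).
  have : 0 <= \int[mu]_(y in D)
      ((h y - maxsum n y + maxsum n (f y)) + B * \1_(Z n) y).
    by apply: Rintegral_ge0 => y _.
  have i1 := intD mh hB.
  have i2 := intD (maxsum_measurable n) (maxsum_norm n).
  have i3 : mu.-integrable D (EFin \o (maxsum n \o f)).
    apply: (@intD _ (B * n%:R)); last by move=> y; exact: maxsum_norm.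
    exact: measurableT_comp (maxsum_measurable n) mf.
  have i12 : mu.-integrable D (EFin \o (fun y => h y - maxsum n y)).
    exact: (integrableB mD i1 i2).
  have i123 : mu.-integrable D (EFin \o (fun y => h y - maxsum n y + maxsum n (f y))).
    exact: (integrableD mD i12 i3).
  have i4 : mu.-integrable D (EFin \o (fun y => B * \1_(Z n) y)).
    exact: (integrableZl mD B (ind n)).
  rewrite (RintegralD mD i123 i4) (RintegralD mD i12 i3) (RintegralB mD i1 i2).
  rewrite (RintegralZl B mD (ind n)) inv subrK.
  by rewrite {2}/Rintegral integral_indic.
have lim0 : fine (mu (Z n `&` D)) @[n --> \oo] --> (0 : R).
  have Z0 : \bigcap_n (Z n `&` D) = set0.
    apply/seteqP; split=> // y hy; have [_ /posD[n]] := hy 0%N I.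
    apply/negP; rewrite -leNgt; have [+ _] := hy n I.
    by apply: le_trans; apply: le_trans (maxsum_ge _ _) (maxsum_mono _ _).
  have := @nonincreasing_cvg_mu _ _ _ mu (fun n => Z n `&` D).
  rewrite Z0 measure0 => /(_ _ _ measurable0 _) c.
  have : mu (Z n `&` D) @[n --> \oo] --> (0 : \bar R)%E.
    apply: c.
    - apply: (@le_lt_trans _ _ 1%E); last by rewrite ltry.
      by apply: probability_le1; exact: measurableI.
    - by move=> n; exact: measurableI.
    - apply/nonincreasing_seqP => n; apply/subsetPset => y [Zy Dy]; split=> //.
      exact: le_trans (maxsum_mono _ _) Zy.
  by move/fine_cvg.
have : \int[mu]_(y in D) h y + B * fine (mu (Z n `&` D)) @[n --> \oo] -->
    \int[mu]_(y in D) h y + B * 0.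
  by apply: cvgD; [exact: cvg_cst|apply: cvgM => //; exact: cvg_cst].
rewrite mulr0 addr0 => c; apply: (cvgr_to_ge c).
exact: nearW.
Qed.

End MaximalErgodic.

(** * The two-sided Birkhoff theorem *)

Section LinearGrowth.
Variable R : realType.
Implicit Types (s t : nat -> R) (x y l : R).

Lemma natr_unbounded (x : R) : exists n : nat, x < n%:R.
Proof. by exists (Num.truncn x).+1; exact: truncnS_gt. Qed.

Lemma linear_unbounded (c K : R) : 0 < c -> exists n, K < c * n%:R.
Proof.
move=> c0; have [n hn] := natr_unbounded (K / c); exists n.
by rewrite mulrC -ltr_pdivrMr.
Qed.

Lemma cvg_average s l :
  (forall x, l < x -> exists K, forall n, s n <= x * n%:R + K) ->
  (forall x, x < l -> exists K, forall n, x * n%:R - K <= s n) ->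
  (n%:R)^-1 * s n @[n --> \oo] --> l.
Proof.
move=> hi lo; apply/cvgrPdist_le => e e0.
have e2 : 0 < e / 2 by rewrite divr_gt0.
have [K1 hK1] := hi (l + e / 2) ltac:(by rewrite ltrDl).
have [K2 hK2] := lo (l - e / 2) ltac:(by rewrite ltrBlDl ltrDr).
near=> n.
have n0 : 0 < n%:R :> R by rewrite ltr0n; near: n; exists 1%N.
have h1 : `|K1| <= e / 2 * n%:R.
  by rewrite mulrC -ler_pdivrMr//; near: n; exact: (@nbhs_infty_ger R).
have h2 : `|K2| <= e / 2 * n%:R.
  by rewrite mulrC -ler_pdivrMr//; near: n; exact: (@nbhs_infty_ger R).
have -> : l - n%:R^-1 * s n = n%:R^-1 * (l * n%:R - s n).
  by rewrite mulrBr mulrCA mulVf ?mulr1// gt_eqF.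
rewrite normrM normfV (gtr0_norm n0) mulrC ler_pdivrMr//.
have := hK1 n; have := hK2 n.
have := ler_norm K1; have := ler_norm K2.
by move=> *; rewrite ler_norml; apply/andP; split; nra.
Unshelve. all: by end_near. Qed.

Let unb s := forall k : nat, exists n, k%:R < s n.

Let unbN s : ~ unb s -> exists K, forall n, s n <= K.
Proof.
move=> /existsNP[k hk]; exists k%:R => n.
by rewrite leNgt; apply/negP => kn; apply: hk; exists n.
Qed.

Let unb_linear s c K : 0 < c -> (forall n, c * n%:R - K <= s n) -> unb s.
Proof.
move=> c0 h k; have [n hn] := linear_unbounded (k%:R + K) c0.
exists n; apply: lt_le_trans (h n); lra.
Qed.

Let rat_between x y : x < y -> exists q : rat, x < ratr q < y.
Proof. by move=> /rat_in_itvoo[q]; rewrite in_itv/=; exists q. Qed.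

(** [s] and [t] stand for the Birkhoff sums of a map and of its inverse.  The
    hypotheses say that no upper slope of one of them exceeds a lower slope of the
    other; the common limit is the upper slope of [s]. *)
Lemma common_average s t (B : R) :
  (forall n, `|s n| <= B * n%:R) ->
  (forall a b : rat, a < b -> ~ ((forall k : nat, exists n, k%:R < s n - ratr b * n%:R) /\
     (forall k : nat, exists n, k%:R < ratr a * n%:R - t n))) ->
  (forall a b : rat, a < b -> ~ ((forall k : nat, exists n, k%:R < t n - ratr b * n%:R) /\
     (forall k : nat, exists n, k%:R < ratr a * n%:R - s n))) ->
  exists l : R, ((n%:R)^-1 * s n @[n --> \oo] --> l) /\
    ((n%:R)^-1 * t n @[n --> \oo] --> l).
Proof.
move=> sB st ts.
pose S := [set x : R | exists K, forall n, s n <= x * n%:R + K].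
have SB : S B.
  by exists 0 => n; rewrite addr0; apply: le_trans (ler_norm _) (sB n).
have Sge x : S x -> - B <= x.
  move=> [K hK]; rewrite leNgt; apply/negP => xB.
  have [n hn] := @linear_unbounded (- B - x) K ltac:(by rewrite subr_gt0).
  have := hK n; have := sB n; rewrite ler_norml => /andP[h1 _]; nra.
have hS : has_inf S by split; [exists B|exists (- B)].
pose l := inf S; exists l.
have hi x : l < x -> exists K, forall n, s n <= x * n%:R + K.
  move=> lx; have [y Sy yx] := inf_lt hS.1 lx.
  have [K hK] := Sy; exists K => n; apply: le_trans (hK n) _.
  by rewrite lerD2r ler_wpM2r// ltW.
have lot x : x < l -> exists K, forall n, x * n%:R - K <= t n.
  move=> xl; have [b /andP[xb bl]] := rat_between xl.
  have [a /andP[xa ab]] := rat_between xb; rewrite ltr_rat in ab.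
  have nS : ~ S (ratr b).
    move=> Sb; have := ge_inf hS.2 Sb; by rewrite leNgt bl.
  have ub : unb (fun n => s n - ratr b * n%:R).
    apply: contrapT => /unbN[K hK]; apply: nS; exists K => n.
    by have := hK n; lra.
  have /unbN[K hK] : ~ unb (fun n => ratr a * n%:R - t n).
    by move=> ua; exact: (st _ _ ab).
  exists K => n; have := hK n; have : x * n%:R <= ratr a * n%:R.
    by rewrite ler_wpM2r// ltW.
  lra.
have hit x : l < x -> exists K, forall n, t n <= x * n%:R + K.
  move=> lx; have [b /andP[lb bx]] := rat_between lx.
  have [a /andP[la ab]] := rat_between lb.
  have [c /andP[lc ca]] := rat_between la.
  have [K1 hK1] := hi _ lc; rewrite ltr_rat in ab.
  have ub : unb (fun n => ratr a * n%:R - s n).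
    apply: (@unb_linear _ (ratr a - ratr c) K1); first by rewrite subr_gt0.
    by move=> n; have := hK1 n; lra.
  have /unbN[K hK] : ~ unb (fun n => t n - ratr b * n%:R).
    by move=> ua; exact: (ts _ _ ab).
  exists K => n; have := hK n; have : ratr b * n%:R <= x * n%:R.
    by rewrite ler_wpM2r// ltW.
  lra.
have los x : x < l -> exists K, forall n, x * n%:R - K <= s n.
  move=> xl; have [c /andP[xc cl]] := rat_between xl.
  have [b /andP[xb bc]] := rat_between xc.
  have [a /andP[xa ab]] := rat_between xb.
  have [K1 hK1] := lot _ cl; rewrite ltr_rat in ab.
  have ub : unb (fun n => t n - ratr b * n%:R).
    apply: (@unb_linear _ (ratr c - ratr b) K1); first by rewrite subr_gt0.
    by move=> n; have := hK1 n; lra.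
  have /unbN[K hK] : ~ unb (fun n => ratr a * n%:R - s n).
    by move=> ua; exact: (ts _ _ ab).
  exists K => n; have := hK n; have : x * n%:R <= ratr a * n%:R.
    by rewrite ler_wpM2r// ltW.
  lra.
by split; apply: cvg_average.
Qed.

End LinearGrowth.

(** Unboundedness, rather than positivity, of the sums is a condition that is
    invariant under [f] and still implies that some sum is positive; both are
    needed in order to apply [maximal_ergodic]. *)
Definition unbounded_sums (R : realType) (Y : Type) (f : Y -> Y) (h : Y -> R) : set Y :=
  [set y | forall k : nat, exists n, k%:R < birkhoff_sum f h n y].

Lemma preimage_unbounded_sums (R : realType) (Y : Type) (f : Y -> Y) (h : Y -> R) (B : R) :
  (forall y, `|h y| <= B) -> f @^-1` unbounded_sums f h = unbounded_sums f h.
Proof.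
move=> hB; apply/seteqP; split=> y /= hy k.
  have [n hn] := hy (Num.truncn (k%:R + B)).+1.
  exists n.+1; rewrite birkhoff_sumSl.
  have := hB y; rewrite ler_norml => /andP[h1 _].
  have := truncnS_gt (k%:R + B); lra.
have [[|n] hn] := hy (Num.truncn (k%:R + B)).+1.
  by move: hn; rewrite birkhoff_sum0 ltrn0.
exists n; move: hn; rewrite birkhoff_sumSl => hn.
have := hB y; rewrite ler_norml => /andP[_ h1].
have := truncnS_gt (k%:R + B); lra.
Qed.

Section Birkhoff.
Variables (R : realType) (d : measure_display) (Y : measurableType d).
Variable mu : probability Y R.

Lemma birkhoff_sum_measurable (f : Y -> Y) (h : Y -> R) n :
  measurable_fun setT f -> measurable_fun setT h ->
  measurable_fun setT (birkhoff_sum f h n).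
Proof.
move=> mf mh; elim: n => [|n IH].
  by rewrite (_ : birkhoff_sum f h 0 = cst 0)//; apply: funext => y; rewrite birkhoff_sum0.
rewrite (_ : birkhoff_sum f h n.+1 = (fun y => h y + birkhoff_sum f h n (f y))).
  by apply: measurable_funD => //; exact: measurableT_comp.
by apply: funext => y; rewrite birkhoff_sumSl.
Qed.

Lemma unbounded_sums_measurable (f : Y -> Y) (h : Y -> R) :
  measurable_fun setT f -> measurable_fun setT h ->
  measurable (unbounded_sums f h).
Proof.
move=> mf mh.
have -> : unbounded_sums f h =
    \bigcap_k \bigcup_n (birkhoff_sum f h n @^-1` `]k%:R, +oo[%classic).
  apply/seteqP; split=> y hy k.
    by move=> _; have [n hn] := hy k; exists n => //=; rewrite in_itv/= hn.
  by have [n _ /=] := hy k I; rewrite in_itv/= andbT; exists n.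
apply: bigcap_measurable => // k _; apply: bigcup_measurable => n _.
rewrite -[X in measurable X]setTI.
exact: (birkhoff_sum_measurable n mf mh).
Qed.

(** On this set, invariant under both maps, the maximal inequality for [f] shows
    that [h - b] has nonnegative integral and the one for [f'] that [a - h] does;
    their sum is the negative constant [a - b]. *)
Lemma unbounded_sums_null (f f' : Y -> Y) (h : Y -> R) (B a b : R) :
  cancel f f' -> cancel f' f -> measurable_fun setT f -> measurable_fun setT f' ->
  (forall C, measurable C -> mu (f @^-1` C) = mu C) ->
  measurable_fun setT h -> (forall y, `|h y| <= B) -> a < b ->
  mu (unbounded_sums f (fun y => h y - b) `&` unbounded_sums f' (fun y => a - h y)) = 0%E.
Proof.
move=> fK f'K mf mf' muf mh hB ab.
set D := _ `&` _.
have muf' C : measurable C -> mu (f' @^-1` C) = mu C.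
  move=> mC; rewrite -[LHS]muf; last by rewrite -[X in measurable X]setTI; exact: mf'.
  by congr (mu _); apply/seteqP; split=> y /=; rewrite fK.
have mh1 : measurable_fun setT (fun y => h y - b).
  by apply: measurable_funB => //; exact: measurable_cst.
have mh2 : measurable_fun setT (fun y => a - h y).
  by apply: measurable_funB => //; exact: measurable_cst.
have hB1 y : `|h y - b| <= B + `|b|.
  by apply: le_trans (ler_normB _ _) _; rewrite lerD2r.
have hB2 y : `|a - h y| <= `|a| + B.
  by apply: le_trans (ler_normB _ _) _; rewrite lerD2l.
have inv1 := preimage_unbounded_sums f hB1.
have inv2 := preimage_unbounded_sums f' hB2.
have inv1' : f' @^-1` unbounded_sums f (fun y => h y - b) = unbounded_sums f (fun y => h y - b).
  by rewrite -[in LHS]inv1; apply/seteqP; split=> y /=; rewrite f'K.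
have inv2' : f @^-1` unbounded_sums f' (fun y => a - h y) = unbounded_sums f' (fun y => a - h y).
  by rewrite -[in LHS]inv2; apply/seteqP; split=> y /=; rewrite fK.
have mD : measurable D.
  by apply: measurableI; exact: unbounded_sums_measurable.
have i1 : 0 <= \int[mu]_(y in D) (h y - b).
  apply: (@maximal_ergodic _ _ _ _ f mf muf _ _ mh1 hB1 _ mD).
    by rewrite /D preimage_setI inv1 inv2'.
  by move=> y [/(_ 0%N)[n hn] _]; exists n.
have i2 : 0 <= \int[mu]_(y in D) (a - h y).
  apply: (@maximal_ergodic _ _ _ _ f' mf' muf' _ _ mh2 hB2 _ mD).
    by rewrite /D preimage_setI inv2 inv1'.
  by move=> y [_ /(_ 0%N)[n hn]]; exists n.
have intD (g : Y -> R) (C : R) : measurable_fun setT g -> (forall y, `|g y| <= C) ->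
    mu.-integrable D (EFin \o g).
  move=> mg gC; apply: measurable_bounded_integrable => //.
  - by apply: le_lt_trans (probability_le1 _ mD) _; rewrite ltry.
  - exact: measurable_funS mg.
  - exists C; split; first exact: num_real.
    by move=> x Cx y _ /=; apply: le_trans (gC y) (ltW Cx).
have : 0 <= \int[mu]_(y in D) ((h y - b) + (a - h y)).
  by rewrite (RintegralD mD (intD _ _ mh1 hB1) (intD _ _ mh2 hB2)) addr_ge0.
have -> : \int[mu]_(y in D) ((h y - b) + (a - h y)) = \int[mu]_(y in D) (a - b).
  by apply: eq_Rintegral => y _; ring.
rewrite (Rintegral_cst _ mD) => h0.
have f0 : fine (mu D) = 0.
  by apply/eqP; rewrite eq_le fine_ge0// andbT leNgt; apply/negP => ?; nra.
by rewrite -[LHS]fineK ?f0// fin_num_measure.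
Qed.

(** Comparing upper slopes in one time direction with lower slopes in the other
    gives at once the convergence of both averages and the equality of their
    limits. *)
Theorem birkhoff_two_sided (f f' : Y -> Y) (h : Y -> R) (B : R) :
  cancel f f' -> cancel f' f -> measurable_fun setT f -> measurable_fun setT f' ->
  (forall C, measurable C -> mu (f @^-1` C) = mu C) ->
  measurable_fun setT h -> (forall y, `|h y| <= B) ->
  exists N, [/\ measurable N, mu N = 0%E & forall y, ~ N y ->
    exists l : R, ((n%:R)^-1 * birkhoff_sum f h n y @[n --> \oo] --> l) /\
      ((n%:R)^-1 * birkhoff_sum f' h n y @[n --> \oo] --> l)].
Proof.
move=> fK f'K mf mf' muf mh hB.
have muf' C : measurable C -> mu (f' @^-1` C) = mu C.
  move=> mC; rewrite -[LHS]muf; last by rewrite -[X in measurable X]setTI; exact: mf'.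
  by congr (mu _); apply/seteqP; split=> y /=; rewrite fK.
pose E g g' (a b : R) := unbounded_sums g (fun y => h y - b) `&`
  unbounded_sums g' (fun y => a - h y).
pose F n : set Y := if (choice.unpickle n : option (rat * rat)) is Some (a, b) then
  if a < b then E f f' (ratr a) (ratr b) `|` E f' f (ratr a) (ratr b) else set0 else set0.
have mE g g' a b : measurable_fun setT g -> measurable_fun setT g' -> measurable (E g g' a b).
  move=> mg mg'; apply: measurableI; apply: unbounded_sums_measurable => //;
    by apply: measurable_funB => //; exact: measurable_cst.
have mF n : measurable (F n).
  rewrite /F; case: choice.unpickle => [[a b]|] //; case: ifP => // _.
  by apply: measurableU; exact: mE.
have F0 n : mu (F n) = 0%E.
  rewrite /F; case: choice.unpickle => [[a b]|]; rewrite ?measure0//.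
  case: ifP; rewrite ?measure0// => ab.
  have ab' : ratr a < ratr b :> R by rewrite ltr_rat.
  apply/eqP; rewrite eq_le measure_ge0 andbT.
  apply: (@le_trans _ _ (mu (E f f' (ratr a) (ratr b)) + mu (E f' f (ratr a) (ratr b)))%E).
    by apply: measureU2; exact: mE.
  rewrite [mu (E f f' _ _)](@unbounded_sums_null f f' h B)//.
  by rewrite [mu (E f' f _ _)](@unbounded_sums_null f' f h B)// adde0.
exists (\bigcup_n F n); split.
- exact: bigcupT_measurable.
- apply/eqP; rewrite eq_le measure_ge0 andbT.
  apply: (@le_trans _ _ (\sum_(n <oo) mu (F n))%E).
    apply: measure_sigma_subadditive; [exact: mF|exact: bigcupT_measurable|exact: subset_refl].
  by rewrite eseries0// => n _ _; exact: F0.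
move=> y Ny.
have sumE g (c : R) n : birkhoff_sum g (fun z => h z - c) n y =
    birkhoff_sum g h n y - c * n%:R.
  by rewrite (birkhoff_sumD g h (fun=> - c)) birkhoff_sum_cst mulNr.
have sumE' g (c : R) n : birkhoff_sum g (fun z => c - h z) n y =
    c * n%:R - birkhoff_sum g h n y.
  by rewrite (birkhoff_sumD g (fun=> c) (fun z => - h z)) birkhoff_sum_cst birkhoff_sumN.
have FE (a b : rat) : a < b -> F (choice.pickle (a, b)) =
    E f f' (ratr a) (ratr b) `|` E f' f (ratr a) (ratr b).
  by rewrite /F choice.pickleK => ->.
have nE (a b : rat) : a < b -> ~ E f f' (ratr a) (ratr b) y /\ ~ E f' f (ratr a) (ratr b) y.
  by move=> ab; split=> Ey; apply: Ny; exists (choice.pickle (a, b)); rewrite ?FE//; [left|right].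
apply: (@common_average _ _ _ B).
- by move=> n; exact: birkhoff_sum_norm.
- move=> a b /nE[nE1 _] [h1 h2]; apply: nE1; split=> k.
    by have [n hn] := h1 k; exists n; rewrite sumE.
  by have [n hn] := h2 k; exists n; rewrite sumE'.
- move=> a b /nE[_ nE1] [h1 h2]; apply: nE1; split=> k.
    by have [n hn] := h1 k; exists n; rewrite sumE.
  by have [n hn] := h2 k; exists n; rewrite sumE'.
Qed.

End Birkhoff.

(** * Generic points of closed sets visited with positive frequency *)

Local Notation borel Y := (g_sigma_algebraType (@open Y)).

Lemma continuous_borel (Y : ptopologicalType) (Z : ptopologicalType) (f : Y -> Z) :
  continuous f -> measurable_fun setT (f : borel Y -> borel Z).
Proof.
move=> cf; apply: (@measurability _ _ (borel Y) (borel Z) setT f (@open Z)) => //.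
move=> _ [B oB <-]; rewrite setTI; apply: sub_sigma_algebra.
by apply: open_comp => // x _; exact: cf.
Qed.

Lemma continuous_borel_real (R : realType) (Y : ptopologicalType) (f : Y -> R) :
  continuous f -> measurable_fun setT (f : borel Y -> R).
Proof.
move=> cf; apply: (measurability _ (RGenOpens.measurableE R)).
move=> _ [_ [x [y ->]] <-]; rewrite setTI; apply: sub_sigma_algebra.
by apply: open_comp; [move=> z _; exact: cf|exact: interval_open].
Qed.

Lemma continuous_compact_norm (R : realType) (Y : topologicalType) (f : Y -> R) :
  compact [set: Y] -> continuous f -> exists B, forall y, `|f y| <= B.
Proof.
move=> cY cf; have : compact (f @` [set: Y]).
  by apply: continuous_compact => //; exact: continuous_subspaceT.
move=> /compact_bounded[M [_ hM]]; exists (M + 1) => y.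
by apply: (hM _ _ (f y)); [rewrite ltrDl|exists y].
Qed.

Section GenericPoint.
Variables (R : realType) (X Y : ptopologicalType).
Hypotheses (cptY : compact [set: Y]) (hausY : hausdorff_space Y).
Variables (f f' : Y -> Y) (proj : Y -> X) (g : X -> X).
Hypotheses (fK : cancel f f') (f'K : cancel f' f).
Hypotheses (cf : continuous f) (cf' : continuous f').
Hypotheses (cproj : continuous proj) (projf : forall y, proj (f y) = g (proj y)).

(** The measure on [Y] built from the visits of [p] gives mass at least [c] to
    [Q], while the points without averages and those lying over the complement of
    the support of the projected measure are negligible. *)
Theorem generic_point (p : Y) (Q : set Y) (c : R) (h1 h2 : Y -> R) :
  continuous h1 -> continuous h2 -> closed Q -> 0 < c ->
  (\forall n \near \oo, c <= visit_freq R f p Q n) ->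
  exists2 mu : probability (borel X) R, invariant_measure g mu &
  exists y, [/\ Q y, msupport mu (proj y) &
    exists l1 l2 : R,
    [/\ (n%:R)^-1 * birkhoff_sum f h1 n y @[n --> \oo] --> l1,
        (n%:R)^-1 * birkhoff_sum f' h1 n y @[n --> \oo] --> l1,
        (n%:R)^-1 * birkhoff_sum f h2 n y @[n --> \oo] --> l2 &
        (n%:R)^-1 * birkhoff_sum f' h2 n y @[n --> \oo] --> l2]].
Proof.
move=> ch1 ch2 cQ c0 hQ.
have [m [mm minv mQ]] := exists_orbit_mean R f p.
have [nu [nuQ nuloc nuinv]] := mean_regular_measure cptY hausY mm.
have nuf := nuinv _ _ fK f'K cf cf' minv.
have mproj := continuous_borel cproj.
pose mP := [the {mfun borel Y >-> borel X} of mfun_Sub (mem_set mproj : (proj : borel Y -> borel X) \in mfun)].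
pose mu : probability (borel X) R := distribution nu mP.
have muE (B : set (borel X)) : mu B = nu (proj @^-1` B) by [].
exists mu.
  move=> B mB; rewrite !muE -[RHS]nuf.
    by congr (nu _); apply/seteqP; split=> y /=; rewrite projf.
  by have := mproj measurableT _ mB; rewrite setTI.
have [B1 hB1] := continuous_compact_norm cptY ch1.
have [B2 hB2] := continuous_compact_norm cptY ch2.
have mf := continuous_borel cf; have mf' := continuous_borel cf'.
have mh1 := continuous_borel_real ch1; have mh2 := continuous_borel_real ch2.
have [N1 [mN1 N10 hN1]] :=
  @birkhoff_two_sided _ _ (borel Y) nu f f' h1 B1 fK f'K mf mf' nuf mh1 hB1.
have [N2 [mN2 N20 hN2]] :=
  @birkhoff_two_sided _ _ (borel Y) nu f f' h2 B2 fK f'K mf mf' nuf mh2 hB2.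
pose V := proj @^-1` (~` msupport mu).
have oV : open V.
  apply: open_comp => [x _|]; first exact: cproj.
  rewrite openE => x /existsNP[U /not_implyP[oU /not_implyP[Ux U0]]].
  rewrite /interior nbhsE/=; exists U => // z Uz /(_ U oU Uz).
  by [].
have V0 : nu V = 0%E.
  apply: nuloc => // y /existsNP[U /not_implyP[oU /not_implyP[Ux U0]]].
  exists (proj @^-1` U); split=> //.
    by apply: open_comp => // x _; exact: cproj.
  apply/eqP; rewrite eq_le measure_ge0 andbT leNgt.
  by apply/negP => h; apply: U0; rewrite muE.
have mV : measurable (V : set (borel Y)) by exact: sub_sigma_algebra.
have mQ' : measurable (Q : set (borel Y)).
  rewrite -[Q]setCK; apply: measurableC; apply: sub_sigma_algebra.
  exact: closed_openC.
have : exists y, Q y /\ ~ (N1 `|` N2 `|` V) y.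
  apply: contrapT => /forallNP hall.
  have QN : Q `<=` N1 `|` N2 `|` V.
    by move=> y Qy; apply: contrapT => nN; exact: (hall y).
  have mN12 : measurable (N1 `|` N2) by exact: measurableU.
  have : (c%:E <= 0)%E.
    apply: (@le_trans _ _ (m Q)%:E); first by rewrite lee_fin mQ.
    apply: le_trans (nuQ _ cQ) _.
    apply: (@le_trans _ _ (nu (N1 `|` N2 `|` V))).
      by apply: le_measure; rewrite ?inE//; exact: measurableU.
    apply: (@le_trans _ _ (nu (N1 `|` N2) + nu V)%E); first exact: measureU2.
    rewrite V0 adde0.
    apply: (@le_trans _ _ (nu N1 + nu N2)%E); first exact: measureU2.
    by rewrite N10 N20 adde0.
  by rewrite lee_fin leNgt c0.
move=> [y [Qy nN]]; exists y; split=> //.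
  by apply: contrapT => nsupp; apply: nN; right.
have [l1 [a1 a2]] := hN1 y (fun hy => nN (or_introl (or_introl hy))).
have [l2 [a3 a4]] := hN2 y (fun hy => nN (or_introl (or_intror hy))).
by exists l1, l2; split.
Qed.

End GenericPoint.

(** * Hermitian geometry of the fibres *)

Section ComplexModulus.
Variable R : realType.
Implicit Types (c : Cplx R).

Definition rc (x : R) : Cplx R := real_complex R x.

Lemma rc_inj : injective rc. Proof. exact: complexI. Qed.
Lemma rcB (x y : R) : rc (x - y) = rc x - rc y.
Proof. exact: (rmorphB (real_complex R)). Qed.
Lemma rcD (x y : R) : rc (x + y) = rc x + rc y.
Proof. exact: (rmorphD (real_complex R)). Qed.
Lemma rcM (x y : R) : rc (x * y) = rc x * rc y.
Proof. exact: (rmorphM (real_complex R)). Qed.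
Lemma rcX (x : R) n : rc (x ^+ n) = rc x ^+ n.
Proof. exact: (rmorphXn (real_complex R)). Qed.
Lemma rcV (x : R) : rc x^-1 = (rc x)^-1.
Proof. exact: (fmorphV (real_complex R)). Qed.
Lemma rc_eq0 (x : R) : (rc x == 0) = (x == 0).
Proof. exact: (fmorph_eq0 (real_complex R)). Qed.
Lemma le_rc (x y : R) : (rc x <= rc y) = (x <= y).
Proof. exact: lecR. Qed.
Lemma lt_rc (x y : R) : (rc x < rc y) = (x < y).
Proof. exact: ltcR. Qed.

Definition cmod c : R := complex.Re `|c|.

Lemma cmodC c : rc (cmod c) = `|c|.
Proof. by case: c => x y; rewrite /cmod normc_def. Qed.

Lemma cmod_ge0 c : 0 <= cmod c.
Proof. by case: c => x y; rewrite /cmod normc_def/= sqrtr_ge0. Qed.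

Lemma cmodM c c' : cmod (c * c') = cmod c * cmod c'.
Proof. by apply: rc_inj; rewrite rcM !cmodC normrM. Qed.

Lemma cmodD c c' : cmod (c + c') <= cmod c + cmod c'.
Proof. by rewrite -le_rc rcD !cmodC ler_normD. Qed.

Lemma cmodN c : cmod (- c) = cmod c.
Proof. by rewrite /cmod normrN. Qed.

Lemma cmod_eq0 c : (cmod c == 0) = (c == 0).
Proof. by rewrite -rc_eq0 cmodC normr_eq0. Qed.

Lemma cmod0 : cmod 0 = 0. Proof. by apply/eqP; rewrite cmod_eq0. Qed.

Lemma cmod1 : cmod 1 = 1.
Proof. by rewrite /cmod normr1. Qed.

Lemma cmodR (x : R) : cmod (rc x) = `|x|.
Proof. by rewrite /cmod normc_def/= expr0n addr0 sqrtr_sqr. Qed.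

Lemma cmod_sqr c : rc (cmod c ^+ 2) = c * Num.conj c.
Proof. by rewrite rcX cmodC normCK. Qed.

End ComplexModulus.

Lemma det_mx2 (S : comNzRingType) (M : 'M[S]_2) :
  \det M = M 0 0 * M 1 1 - M 0 1 * M 1 0.
Proof.
rewrite (expand_det_row _ 0) !big_ord_recl big_ord0 addr0 /cofactor !det_mx11 !mxE/=.
have -> : lift ord0 ord0 = 1 :> 'I_2 by exact: val_inj.
have -> : lift 1 0 = 0 :> 'I_2 by exact: val_inj.
by rewrite addn0 /bump/= expr0 expr1 mul1r mulN1r mulrN.
Qed.

Section FibreGeometry.
Variables (R : realType) (X : topologicalType) (TX : hermitian_bundle R X).
Local Notation T := (fibre TX).

Lemma hermE z (v : T z) : rc (hnorm v ^+ 2) = herm TX z v v.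
Proof.
have : 0 <= herm TX z v v by exact: dnorm_ge0.
rewrite /hnorm; case: (herm TX z v v) => x y; rewrite lecE/= => /andP[/eqP-> x0].
by rewrite sqr_sqrtr.
Qed.

Lemma hnorm_ge0 z (v : T z) : 0 <= hnorm v.
Proof. exact: sqrtr_ge0. Qed.

Lemma hnorm_eq0 z (v : T z) : (hnorm v == 0) = (v == 0).
Proof.
by rewrite -(dnorm_eq0 (herm TX z)) -hermE rc_eq0 sqrf_eq0.
Qed.

Lemma hnorm0 z : hnorm (0 : T z) = 0.
Proof. by apply/eqP; rewrite hnorm_eq0. Qed.

Lemma hnorm_gt0 z (v : T z) : (0 < hnorm v) = (v != 0).
Proof. by rewrite lt_def hnorm_ge0 andbT hnorm_eq0. Qed.

Lemma hnormZc z (a : Cplx R) (v : T z) : hnorm (a *: v) = cmod a * hnorm v.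
Proof. exact: hnormZ. Qed.

Lemma hermJ z (u v : T z) : herm TX z u v = Num.conj (herm TX z v u).
Proof. by rewrite hermC /= expr0 mul1r. Qed.

Let coordZ z (i : 'I_2) (c : Cplx R) (u : T z) :
  coord (onb TX z) i (c *: u) = c * coord (onb TX z) i u.
Proof. exact: linearZ. Qed.

Let coordB z (i : 'I_2) (u v : T z) :
  coord (onb TX z) i (u - v) = coord (onb TX z) i u - coord (onb TX z) i v.
Proof. exact: linearB. Qed.

(** The determinant of a pair of vectors in an orthonormal frame.  The choice of
    the frame affects it by a factor of modulus one, hence not [area]. *)
Definition det2 z (u v : T z) : Cplx R :=
  coord (onb TX z) 0 u * coord (onb TX z) 1 v -
  coord (onb TX z) 1 u * coord (onb TX z) 0 v.

Definition area z (u v : T z) : R := cmod (det2 u v).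

Lemma herm_coord z (u v : T z) : herm TX z u v =
  coord (onb TX z) 0 u * Num.conj (coord (onb TX z) 0 v) +
  coord (onb TX z) 1 u * Num.conj (coord (onb TX z) 1 v).
Proof.
have eP := onbP TX z; have /andP[be _] := eP.
have -> : herm TX z u v = \sum_i coord (onb TX z) i u * Num.conj (coord (onb TX z) i v).
  rewrite {1}(coord_basis be (memvf u)) linear_sumlz/=; apply: eq_bigr => i _.
  by rewrite linearZl_LR/= -(tnth_nth 0) [in RHS](onb_coord i v eP) -hermJ.
rewrite !big_ord_recl big_ord0 addr0.
by have -> : lift ord0 ord0 = 1 :> 'I_2 by exact: val_inj.
Qed.

(** Lagrange's identity. *)
Lemma area_sqr z (u v : T z) :
  area u v ^+ 2 = hnorm u ^+ 2 * hnorm v ^+ 2 - cmod (herm TX z u v) ^+ 2.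
Proof.
apply: rc_inj; rewrite rcB rcM !hermE !cmod_sqr !herm_coord /det2.
rewrite !(rmorphB, rmorphD, rmorphM)/= !conjCK; ring.
Qed.

Lemma area_ge0 z (u v : T z) : 0 <= area u v.
Proof. exact: cmod_ge0. Qed.

(** The inequality of Cauchy and Schwarz, from [area_sqr]. *)
Lemma herm_le z (u v : T z) : cmod (herm TX z u v) <= hnorm u * hnorm v.
Proof.
rewrite -(@ler_pXn2r _ 2)// ?nnegrE ?cmod_ge0 ?mulr_ge0 ?hnorm_ge0//.
by rewrite exprMn -subr_ge0 -area_sqr sqr_ge0.
Qed.

Lemma area_le z (u v : T z) : area u v <= hnorm u * hnorm v.
Proof.
rewrite -(@ler_pXn2r _ 2)// ?nnegrE ?area_ge0 ?mulr_ge0 ?hnorm_ge0//.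
by rewrite exprMn area_sqr lerBlDr lerDl sqr_ge0.
Qed.

Lemma area_orth z (u v : T z) : herm TX z u v = 0 -> area u v = hnorm u * hnorm v.
Proof.
move=> uv; apply/eqP; rewrite -(@eqrXn2 _ 2) ?area_ge0 ?mulr_ge0 ?hnorm_ge0//.
by rewrite area_sqr uv cmod0 expr0n subr0 exprMn.
Qed.

Lemma ler_hnormD z (u v : T z) : hnorm (u + v) <= hnorm u + hnorm v.
Proof.
rewrite -(@ler_pXn2r _ 2)// ?nnegrE ?addr_ge0 ?hnorm_ge0// -le_rc hermE.
have h := herm_le u v.
rewrite linearDl/= !linearD/= -!hermE (hermJ v u).
set c := herm TX z u v in h *.
rewrite sqrrD !rcD -!addrA lerD2l !addrA lerD2r.
have -> : c + Num.conj c = rc (2 * complex.Re c).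
  by case: (c) => x y; apply/eqP; rewrite eq_complex/= subrr eqxx andbT; apply/eqP; ring.
rewrite mulr2n -rcD le_rc.
suff : complex.Re c <= cmod c by lra.
case: (c) => x y; rewrite /cmod normc_def/=.
apply: le_trans (ler_norm _) _; rewrite -sqrtr_sqr ler_wsqrtr//.
by rewrite lerDl sqr_ge0.
Qed.

Lemma hnorm_opp z (u : T z) : hnorm (- u) = hnorm u.
Proof. by rewrite -scaleN1r hnormZc cmodN cmod1 mul1r. Qed.

Lemma ler_hnormB z (u v : T z) : hnorm (u - v) <= hnorm u + hnorm v.
Proof. by apply: le_trans (ler_hnormD _ _) _; rewrite hnorm_opp. Qed.

Lemma areaZl z (c : Cplx R) (u v : T z) : area (c *: u) v = cmod c * area u v.
Proof. by rewrite /area -cmodM /det2 !coordZ; congr cmod; ring. Qed.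

Lemma areaC z (u v : T z) : area u v = area v u.
Proof. by rewrite /area -[RHS]cmodN /det2; congr cmod; ring. Qed.

Lemma area_shear z (c : Cplx R) (u v : T z) : area (u - c *: v) v = area u v.
Proof. by rewrite /area /det2 !coordB !coordZ; congr cmod; ring. Qed.

Lemma area_eq0 z (u v : T z) : v != 0 -> (area u v == 0) = (u \in <[v]>%VS).
Proof.
move=> v0; apply/idP/vlineP; last first.
  by move=> [c ->]; rewrite areaZl (_ : area v v = 0) ?mulr0// /area /det2 mulrC subrr cmod0.
move=> /eqP a0; exists (herm TX z u v / herm TX z v v).
have hv : herm TX z v v != 0 by rewrite dnorm_eq0.
set c := _ / _; apply/eqP; rewrite -subr_eq0 -hnorm_eq0.
have orth : herm TX z (u - c *: v) v = 0.
  by rewrite linearBl/= linearZl_LR/= divfK// subrr.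
have := area_orth orth; rewrite area_shear a0 => /esym/eqP.
by rewrite mulf_eq0 [X in _ || X]hnorm_eq0 (negPf v0) orbF.
Qed.

Lemma det2_hom z w (L : 'Hom(T z, T w)) (u v : T z) :
  det2 (L u) (L v) = \det (lin_matrix (onb TX z) (onb TX w) L) * det2 u v.
Proof.
have /andP[be _] := onbP TX z.
pose M := lin_matrix (onb TX z) (onb TX w) L.
have LE i x : coord (onb TX w) i (L x) =
    M i 0 * coord (onb TX z) 0 x + M i 1 * coord (onb TX z) 1 x.
  rewrite {1}(coord_basis be (memvf x)) !linear_sum.
  rewrite (eq_bigr (fun k => M i k * coord (onb TX z) k x)) => [|k _]; last first.
    by rewrite mxE !linearZ/= -(tnth_nth 0) mulrC.
  rewrite !big_ord_recl big_ord0 addr0.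
  by have -> : lift ord0 ord0 = 1 :> 'I_2 by exact: val_inj.
rewrite /det2 !LE -/M.
rewrite det_mx2.
ring.
Qed.

Lemma area_hom z w (L : 'Hom(T z, T w)) (u v : T z) :
  area (L u) (L v) = absdet L * area u v.
Proof. by rewrite /area det2_hom cmodM. Qed.

Lemma absdet_ge0 z w (L : 'Hom(T z, T w)) : 0 <= absdet L.
Proof. exact: cmod_ge0. Qed.

Lemma exists_orth z (v : T z) : hnorm v = 1 ->
  exists w : T z, hnorm w = 1 /\ herm TX z w v = 0.
Proof.
move=> v1.
have v0 : v != 0 by rewrite -hnorm_gt0 v1.
have [u uv] : exists u, u \notin <[v]>%VS.
  apply: contrapT => /forallNP hall.
  have : ({:T z} <= <[v]>)%VS.
    by apply/subvP => u _; apply: contrapT => /negP; exact: hall.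
  by move=> /dimvS; rewrite dim_fibre dim_vline v0.
pose w := u - herm TX z u v *: v.
have vv : herm TX z v v = 1 by rewrite -hermE v1 expr1n.
have wv : herm TX z w v = 0 by rewrite linearBl/= linearZl_LR/= vv mulr1 subrr.
have w0 : w != 0.
  by apply: contra uv; rewrite subr_eq0 => /eqP ->; rewrite memvZ// memv_line.
exists (rc (hnorm w)^-1 *: w); split.
  rewrite hnormZc cmodR ger0_norm ?invr_ge0 ?hnorm_ge0// mulVf//.
  by rewrite hnorm_eq0.
by rewrite linearZl_LR/= wv mulr0.
Qed.

End FibreGeometry.

(** * Topology of the complex numbers *)

Section ComplexTopology.
Variable R : realType.

Lemma le_cmod_Re (c : Cplx R) : `|complex.Re c| <= cmod c.
Proof.
case: c => x y; rewrite /cmod normc_def/= -sqrtr_sqr ler_wsqrtr//.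
by rewrite lerDl sqr_ge0.
Qed.

Lemma le_cmod_Im (c : Cplx R) : `|complex.Im c| <= cmod c.
Proof.
case: c => x y; rewrite /cmod normc_def/= -sqrtr_sqr ler_wsqrtr//.
by rewrite lerDr sqr_ge0.
Qed.

Lemma cmod_le_ReIm (c : Cplx R) : cmod c <= `|complex.Re c| + `|complex.Im c|.
Proof.
rewrite -(@ler_pXn2r _ 2)// ?nnegrE ?cmod_ge0 ?addr_ge0//.
case: c => x y; rewrite /cmod normc_def/= sqr_sqrtr ?addr_ge0 ?sqr_ge0//.
rewrite sqrrD !real_normK ?num_real//.
have := normr_ge0 x; have := normr_ge0 y; nra.
Qed.

(** The topology of [Cplx R] is defined by balls with radii in [Cplx R] itself;
    this is the passage to real distances. *)
Lemma cvg_cmodP (T : Type) (F : set_system T) (FF : Filter F) (u : T -> Cplx R) (l : Cplx R) :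
  u @ F --> l <-> (fun t => cmod (u t - l)) @ F --> (0 : R).
Proof.
split.
  move=> ul; apply/cvgr0Pnorm_lt => e e0.
  have /cvgr_dist_lt/(_ (rc e)) := ul.
  rewrite -[0]/(rc 0) lt_rc => /(_ e0); apply: filterS => t.
  by rewrite -cmodC lt_rc ger0_norm ?cmod_ge0// -cmodN opprB.
move=> ul; apply/cvgrPdist_lt => e e0.
have [r r0 re] : exists2 r : R, 0 < r & rc r = e.
  by case: e e0 => x y; rewrite ltcE/= => /andP[/eqP-> x0]; exists x.
have /cvgr0Pnorm_lt/(_ _ r0) := ul.
apply: filterS => t; rewrite ger0_norm ?cmod_ge0// => h.
by rewrite -cmodC -re lt_rc -cmodN opprB.
Qed.

Lemma cmod_dist (c c' : Cplx R) : `|cmod c - cmod c'| <= cmod (c - c').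
Proof.
rewrite ler_norml; apply/andP; split.
  have := cmodD (c' - c) c; rewrite subrK -(cmodN (c' - c)) opprB; lra.
have := cmodD (c - c') c'; rewrite subrK; lra.
Qed.

Lemma cvg_cmod (T : Type) (F : set_system T) (FF : Filter F) (u : T -> Cplx R) (l : Cplx R) :
  u @ F --> l -> cmod (u t) @[t --> F] --> cmod l.
Proof.
move=> /(cvg_cmodP FF)/cvgr0Pnorm_le h; apply/cvgrPdist_le => e e0.
have := h e e0; apply: filterS => t; rewrite ger0_norm ?cmod_ge0//.
by move=> h2; rewrite distrC; apply: le_trans (cmod_dist _ _) h2.
Qed.

Lemma cvg_Re (T : Type) (F : set_system T) (FF : Filter F) (u : T -> Cplx R) (l : Cplx R) :
  u @ F --> l -> complex.Re (u t) @[t --> F] --> complex.Re l.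
Proof.
move=> /(cvg_cmodP FF)/cvgr0Pnorm_le h; apply/cvgrPdist_le => e e0.
have := h e e0; apply: filterS => t; rewrite ger0_norm ?cmod_ge0//.
move=> h2; rewrite distrC; apply: le_trans h2.
have := le_cmod_Re (u t - l).
by case: (u t) => x y; case: (l).
Qed.

Lemma cvg_rc (T : Type) (F : set_system T) (FF : Filter F) (u : T -> R) (l : R) :
  u @ F --> l -> rc (u t) @[t --> F] --> rc l.
Proof.
move=> ul; apply/cvg_cmodP/cvgr0Pnorm_le => e e0.
move/cvgrPdist_le : ul => /(_ e e0); apply: filterS => t.
by rewrite (ger0_norm (cmod_ge0 _)) -rcB cmodR distrC.
Qed.

Lemma compact_disc (r : R) : compact [set c : Cplx R | cmod c <= r].
Proof.
pose k (p : R * R) : Cplx R := Complex p.1 p.2.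
have ck : continuous k.
  move=> p; apply/cvg_cmodP.
  have lim : (fun q : R * R => `|q.1 - p.1| + `|q.2 - p.2|) @ p --> (0 : R).
    have -> : (0 : R) = `|p.1 - p.1| + `|p.2 - p.2| by rewrite !subrr normr0 addr0.
    by apply: cvgD; apply: cvg_norm; apply: cvgB (cvg_cst _); [exact: cvg_fst|exact: cvg_snd].
  apply: squeeze_cvgr (cvg_cst (0 : R)) lim; apply: nearW => q.
  by rewrite cmod_ge0/=; apply: le_trans (cmod_le_ReIm _) _.
have cb : compact (k @` (`[- r, r] `*` `[- r, r])).
  apply: continuous_compact; first exact: continuous_subspaceT.
  by apply: compact_setX; exact: segment_compact.
apply: (subclosed_compact _ cb).
  rewrite (_ : [set c | _] = (@cmod R) @^-1` [set x | x <= r])//.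
  by apply: closed_comp => [c _|]; [exact: (@cvg_cmod _ (nbhs c) _ id c)|exact: closed_le].
move=> [x y] /= h; exists (x, y) => //.
have := le_cmod_Re (x +i* y)%C; have := le_cmod_Im (x +i* y)%C => /= h1 h2.
by split; rewrite /= in_itv/= -ler_norml; [apply: le_trans h2 h|apply: le_trans h1 h].
Qed.

End ComplexTopology.

Lemma within_cvg (W V Z : topologicalType) (D : set V) (G : V -> Z) (x0 : V)
    (F : set_system W) (FF : Filter F) (k : W -> V) :
  {within D, continuous G} -> D x0 -> k @ F --> x0 ->
  (\forall w \near F, D (k w)) -> G (k w) @[w --> F] --> G x0.
Proof.
move=> cG Dx0 kx0 kD B GB.
have := cG x0 B GB; rewrite /= nbhs_simpl/=.
rewrite /nbhs/= -nbhs_subspace_in// => wB.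
have h : \forall x \near x0, D x -> B (G x) by exact: wB.
have h2 : \forall w \near F, D (k w) -> B (G (k w)) by exact: (kx0 _ h).
by apply: filterS2 h2 kD => w; exact.
Qed.

(** * Topology of the total space *)

Section TotalSpace.
Variables (R : realType) (X : topologicalType) (TX : hermitian_bundle R X).
Local Notation T := (fibre TX).
Local Notation E := (Defs.total TX).

Definition pt z (v : T z) : E := pack (Tagged T v).
Definition tbase (e : E) : X := tag (unpack e).
Definition tvec (e : E) : T (tbase e) := tagged (unpack e).
Definition tnorm (e : E) : R := hnorm (tvec e).
Definition tscale (c : Cplx R) (e : E) : E := pt (c *: tvec e).

Lemma ptK e : pt (tvec e) = e.
Proof. by rewrite /pt /tvec /tbase; case: (unpack e) (unpackK e). Qed.

Lemma tbase_pt z (v : T z) : tbase (pt v) = z.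
Proof. by rewrite /tbase /pt packK. Qed.

Lemma tnorm_pt z (v : T z) : tnorm (pt v) = hnorm v.
Proof. by rewrite /tnorm /tvec /tbase /pt packK. Qed.

Lemma tscale_pt c z (v : T z) : tscale c (pt v) = pt (c *: v).
Proof. by rewrite /tscale /tvec /tbase /pt packK. Qed.

Lemma pt_inj z : injective (@pt z).
Proof.
move=> u v /(congr1 (@unpack _ _ TX)); rewrite !packK => /eqP.
by rewrite eq_Tagged => /eqP.
Qed.

Lemma tbase_continuous : continuous tbase.
Proof. exact: Defs.proj_continuous. Qed.

(** The Hermitian product as a continuous function of two points of the total
    space; only its values on pairs of points of one fibre are meaningful. *)
Definition therm (p : E * E) : Cplx R := projT1 (cid (herm_continuous TX)) p.

Lemma therm_pt z (u v : T z) : therm (pt u, pt v) = herm TX z u v.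
Proof. by rewrite /therm; case: cid => G [cG h] /=; exact: h. Qed.

Section Limits.
Variables (W : topologicalType) (F : set_system W) (FF : Filter F).

Lemma cvg_therm (e1 e2 : W -> E) (a1 a2 : E) : tbase a1 = tbase a2 ->
  (\forall w \near F, tbase (e1 w) = tbase (e2 w)) ->
  e1 @ F --> a1 -> e2 @ F --> a2 ->
  therm (e1 w, e2 w) @[w --> F] --> therm (a1, a2).
Proof.
move=> a12 e12 ea1 ea2; rewrite /therm; case: cid => G [cG h] /=.
apply: (within_cvg FF (k := fun w => (e1 w, e2 w)) cG) => //.
exact: cvg_pair.
Qed.

Lemma tnormE e : tnorm e = Num.sqrt (complex.Re (therm (e, e))).
Proof. by rewrite -[in RHS](ptK e) therm_pt. Qed.

Lemma cvg_tnorm (e : W -> E) (a : E) : e @ F --> a -> tnorm (e w) @[w --> F] --> tnorm a.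
Proof.
move=> ea; under eq_fun do rewrite tnormE; rewrite tnormE.
apply: (@continuous_cvg W R R F FF (fun w => complex.Re (therm (e w, e w))) Num.sqrt).
  exact: sqrt_continuous.
by apply: cvg_Re; apply: cvg_therm => //; exact: nearW.
Qed.

Lemma cvg_tbase (e : W -> E) (a : E) : e @ F --> a -> tbase (e w) @[w --> F] --> tbase a.
Proof. by move=> ea; apply: (@continuous_cvg W E X F FF e tbase) => //; exact: tbase_continuous. Qed.

End Limits.

Record local_chart (x : X) := LocalChart {
  chart_dom : set X;
  chart : forall z, 'Hom(T z, 'rV[Cplx R]_2);
  chart_inv : forall z, 'Hom('rV[Cplx R]_2, T z);
  chart_open : open chart_dom;
  chart_in : chart_dom x;
  chartK : forall z, chart_dom z -> cancel (chart z) (chart_inv z);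
  chart_invK : forall z, chart_dom z -> cancel (chart_inv z) (chart z);
  chart_continuous : {within [set e | chart_dom (tbase e)],
           continuous (fun e => chart (tbase e) (tvec e))};
  chart_inv_continuous : {within chart_dom `*` [set: 'rV[Cplx R]_2],
           continuous (fun p => pt (chart_inv p.1 p.2))}
}.

Lemma exists_chart x : exists k : local_chart x, True.
Proof.
have [U [phi [psi [[oU Ux] UK c1 c2]]]] := local_triviality TX x.
unshelve eexists; last by [].
exists U phi psi => //.
- by move=> z /UK[].
- by move=> z /UK[].
Qed.

Section ChartLimits.
Variables (x : X) (k : local_chart x).
Variables (W : topologicalType) (F : set_system W) (FF : Filter F).

Lemma near_chart_dom z : chart_dom k z -> \forall y \near z, chart_dom k y.
Proof. by move=> kz; apply: open_nbhs_nbhs; split=> //; exact: chart_open. Qed.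

Lemma cvg_chart (e : W -> E) (a : E) : chart_dom k (tbase a) -> e @ F --> a ->
  chart k (tbase (e w)) (tvec (e w)) @[w --> F] --> chart k (tbase a) (tvec a).
Proof.
move=> ka ea; apply: (within_cvg FF (@chart_continuous x k)) => //.
exact: (cvg_tbase FF ea) (near_chart_dom ka).
Qed.

Lemma cvg_chart_inv (z : W -> X) (a : X) (c : W -> 'rV[Cplx R]_2) (ca : 'rV[Cplx R]_2) :
  chart_dom k a -> z @ F --> a -> c @ F --> ca ->
  pt (chart_inv k (z w) (c w)) @[w --> F] --> pt (chart_inv k a ca).
Proof.
move=> ka za cca.
apply: (@within_cvg W _ _ _ (fun p : X * 'rV[Cplx R]_2 => pt (chart_inv k p.1 p.2))
  (a, ca) F FF (fun w => (z w, c w)) (@chart_inv_continuous x k)).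
- by split.
- exact: (cvg_pair za cca).
have h : \forall w \near F, chart_dom k (z w) by exact: za _ (near_chart_dom ka).
by apply: filterS h.
Qed.

End ChartLimits.

Section MoreLimits.
Variables (W : topologicalType) (F : set_system W) (FF : Filter F).

(** In a chart, scaling is the continuous scaling of row vectors. *)
Lemma cvg_tscale (c : W -> Cplx R) (ca : Cplx R) (e : W -> E) (a : E) :
  c @ F --> ca -> e @ F --> a -> tscale (c w) (e w) @[w --> F] --> tscale ca a.
Proof.
move=> cc ea; have [k _] := exists_chart (tbase a).
have ka := chart_in k.
have kE (d : Cplx R) (y : E) : chart_dom k (tbase y) ->
    tscale d y = pt (chart_inv k (tbase y) (d *: chart k (tbase y) (tvec y))).
  by move=> ky; rewrite linearZ/= chartK.
rewrite kE//.
have h : pt (chart_inv k (tbase (e w)) (c w *: chart k (tbase (e w)) (tvec (e w)))) @[w --> F]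
   --> pt (chart_inv k (tbase a) (ca *: chart k (tbase a) (tvec a))).
  apply: cvg_chart_inv => //; first exact: cvg_tbase.
  by apply: cvgZ => //; exact: cvg_chart.
apply: cvg_trans h; apply: near_eq_cvg.
have : \forall w \near F, chart_dom k (tbase (e w)).
  exact: (cvg_tbase FF ea) (near_chart_dom ka).
by apply: filterS => w kw; rewrite kE.
Qed.

End MoreLimits.

(** Points of different fibres are separated by their projections, and points of
    one fibre by a chart. *)
Lemma total_hausdorff : hausdorff_space X -> hausdorff_space E.
Proof.
move=> hX a b ab.
have bab : tbase a = tbase b.
  apply: hX => A B Aa Bb.
  have [e [Ae Be]] := ab _ _ (tbase_continuous Aa) (tbase_continuous Bb).
  by exists (tbase e).
have [x0 [k [ka kb]]] : exists x (k : local_chart x),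
    chart_dom k (tbase a) /\ chart_dom k (tbase b).
  have [k _] := exists_chart (tbase a); exists (tbase a), k.
  by rewrite -bab; split; exact: chart_in.
have cE (y : E) : chart_dom k (tbase y) -> (fun e => chart k (tbase e) (tvec e)) @ y
    --> chart k (tbase y) (tvec y).
  by move=> ky; apply: cvg_chart => //; exact: cvg_id.
have eq : chart k (tbase a) (tvec a) = chart k (tbase b) (tvec b).
  have hM : hausdorff_space 'rV[Cplx R]_2 by exact: norm_hausdorff.
  apply: hM => A B Aa Bb.
  have [e [Ae Be]] := ab _ _ (cE _ ka _ Aa) (cE _ kb _ Bb).
  by exists (chart k (tbase e) (tvec e)).
transitivity (pt (chart_inv k (tbase a) (chart k (tbase a) (tvec a)))).
  by rewrite chartK// ptK.
by rewrite eq bab chartK// ptK.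
Qed.

End TotalSpace.

(** * Compactness of the unit sphere and continuity of the determinant *)

Section TotalArea.
Variables (R : realType) (X : topologicalType) (TX : hermitian_bundle R X).
Local Notation T := (fibre TX).
Local Notation E := (Defs.total TX).

(** The square of [area] in terms of [therm], which makes its continuity on the
    total space visible. *)
Definition tarea2 (e1 e2 : E) : R :=
  tnorm e1 ^+ 2 * tnorm e2 ^+ 2 - cmod (therm (e1, e2)) ^+ 2.

Lemma tarea2_pt z (u v : T z) : tarea2 (pt u) (pt v) = area u v ^+ 2.
Proof. by rewrite /tarea2 therm_pt !tnorm_pt area_sqr. Qed.

Lemma cvg_tarea2 (W : topologicalType) (F : set_system W) (FF : Filter F)
    (e1 e2 : W -> E) (a1 a2 : E) : tbase a1 = tbase a2 ->
  (\forall w \near F, tbase (e1 w) = tbase (e2 w)) ->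
  e1 @ F --> a1 -> e2 @ F --> a2 ->
  tarea2 (e1 w) (e2 w) @[w --> F] --> tarea2 a1 a2.
Proof.
move=> a12 e12 ea1 ea2; rewrite /tarea2 !expr2.
have n1 := cvg_tnorm FF ea1; have n2 := cvg_tnorm FF ea2.
have h := cvg_cmod FF (cvg_therm FF a12 e12 ea1 ea2).
under eq_fun do rewrite !expr2.
by apply: cvgB; [apply: cvgM; exact: cvgM|exact: cvgM].
Qed.

Section Frame.
Variables (x : X) (k : local_chart TX x).

Definition frame_vec (i : 'I_2) (z : X) : T z := chart_inv k z (delta_mx 0 i).

Lemma cvg_frame_vec i (z : X) : chart_dom k z ->
  pt (frame_vec i y) @[y --> z] --> pt (frame_vec i z).
Proof. by move=> kz; apply: cvg_chart_inv => //; exact: cvg_cst. Qed.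

Lemma frame_vecE z (u : T z) : chart_dom k z ->
  u = chart k z u 0 0 *: frame_vec 0 z + chart k z u 0 1 *: frame_vec 1 z.
Proof.
move=> kz; rewrite -{1}(chartK kz u) {1}(row_sum_delta (chart k z u)).
rewrite !big_ord_recl big_ord0 addr0 linearD !linearZ/=.
by have -> : lift ord0 ord0 = 1 :> 'I_2 by exact: val_inj.
Qed.

Lemma frame_area_gt0 z : chart_dom k z -> 0 < area (frame_vec 0 z) (frame_vec 1 z).
Proof.
move=> kz; rewrite lt_def area_ge0 andbT area_eq0; last first.
  apply/eqP => h; have := congr1 (chart k z) h; rewrite chart_invK// linear0.
  by move=> /matrixP/(_ 0 1); rewrite !mxE/= => /eqP; rewrite oner_eq0.
apply/negP => /vlineP[c]; move=> /(congr1 (chart k z)); rewrite linearZ/= !chart_invK//.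
by move=> /matrixP/(_ 0 0); rewrite !mxE/= mulr0 => /eqP; rewrite oner_eq0.
Qed.

Definition frame_area2 (z : X) : R := tarea2 (pt (frame_vec 0 z)) (pt (frame_vec 1 z)).

Lemma cvg_frame_area2 z : chart_dom k z -> frame_area2 y @[y --> z] --> frame_area2 z.
Proof.
move=> kz; apply: cvg_tarea2; rewrite ?tbase_pt//; try exact: cvg_frame_vec.
by apply: nearW => y; rewrite !tbase_pt.
Qed.

Lemma frame_area2_gt0 z : chart_dom k z -> 0 < frame_area2 z.
Proof. by move=> kz; rewrite /frame_area2 tarea2_pt exprn_gt0// frame_area_gt0. Qed.

(** Cramer's rule: the coordinates of [u] in the frame are quotients of areas. *)
Lemma chart_bound z (u : T z) i : chart_dom k z -> hnorm u = 1 ->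
  cmod (chart k z u 0 i) ^+ 2 <=
  (hnorm (frame_vec 0 z) ^+ 2 + hnorm (frame_vec 1 z) ^+ 2) / frame_area2 z.
Proof.
move=> kz u1; rewrite ler_pdivlMr ?frame_area2_gt0// /frame_area2 tarea2_pt -exprMn.
set p0 := frame_vec 0 z; set p1 := frame_vec 1 z.
have uE := frame_vecE u kz.
have h0 : cmod (chart k z u 0 0) * area p0 p1 <= hnorm p1.
  rewrite -areaZl -(area_shear (- chart k z u 0 1)) scaleNr opprK -uE.
  by apply: le_trans (area_le _ _) _; rewrite u1 mul1r.
have h1 : cmod (chart k z u 0 1) * area p0 p1 <= hnorm p0.
  rewrite areaC -areaZl -(area_shear (- chart k z u 0 0)) scaleNr opprK addrC -uE.
  by apply: le_trans (area_le _ _) _; rewrite u1 mul1r.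
have g0 c : 0 <= cmod c * area p0 p1 by rewrite mulr_ge0 ?cmod_ge0 ?area_ge0.
have [-> | ->] : i = 0 \/ i = 1.
  by case: i => [[|[|]]]// ?; [left|right]; exact: val_inj.
- by rewrite (@le_trans _ _ (hnorm p1 ^+ 2))// ?lerDr ?sqr_ge0// ler_pXn2r// nnegrE ?hnorm_ge0.
- by rewrite (@le_trans _ _ (hnorm p0 ^+ 2))// ?lerDl ?sqr_ge0// ler_pXn2r// nnegrE ?hnorm_ge0.
Qed.

End Frame.

(** An ultrafilter on the unit sphere converges in the base; near the limit
    the chart coordinates of unit vectors remain in a fixed polydisc, so that they
    converge as well. *)
Lemma unit_sphere_compact : compact [set: X] -> compact [set e : E | tnorm e = 1].
Proof.
move=> cX; rewrite compact_ultra => G GU G1.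
have GP : ProperFilter G by exact: ultra_proper.
have [x _ Gx] : exists2 x, [set: X] x & @tbase _ _ TX @ G --> x.
  by apply: ultra_cvg_compact => //; exact: filterE.
have [k _] := exists_chart TX x; have kx := chart_in k.
pose b z := (tnorm (pt (frame_vec k 0 z)) ^+ 2 + tnorm (pt (frame_vec k 1 z)) ^+ 2) / frame_area2 k z.
have cb : b y @[y --> x] --> b x.
  apply: cvgM; last by apply: cvgV; [rewrite gt_eqF// frame_area2_gt0|exact: cvg_frame_area2].
  have n i : tnorm (pt (frame_vec k i y)) ^+ 2 @[y --> x] --> tnorm (pt (frame_vec k i x)) ^+ 2.
    have h := cvg_tnorm (nbhs_filter x) (@cvg_frame_vec _ k i x kx).
    by under eq_fun do rewrite expr2; rewrite expr2; exact: cvgM.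
  exact: cvgD.
have nb : \forall y \near x, b y <= b x + 1.
  by apply: (cvgr_le _ cb); rewrite ltrDl.
pose r := Num.sqrt (b x + 1).
pose K := [set c : 'rV[Cplx R]_2 | forall i, [set d | cmod d <= r] (c 0 i)].
have cK : compact K.
  by apply: (@rV_compact (Cplx R) 2 (fun=> [set d | cmod d <= r])) => i; exact: compact_disc.
have kdom : \forall e \near G, chart_dom k (tbase e) by exact: (Gx _ (near_chart_dom kx)).
have [c0 _ Gc] : exists2 c, K c & (fun e => chart k (tbase e) (tvec e)) @ G --> c.
  apply: ultra_cvg_compact => //.
  have nbG : \forall e \near G, b (tbase e) <= b x + 1 by exact: (Gx _ nb).
  apply: filterS3 kdom nbG G1 => e ke be e1 i /=.
  have := chart_bound i ke e1; rewrite -!tnorm_pt => h.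
  rewrite -(ger0_norm (cmod_ge0 _)) -sqrtr_sqr ler_wsqrtr//.
  exact: le_trans h be.
pose e0 := pt (chart_inv k x c0).
have Ge0 : (id : E -> E) @ G --> e0.
  apply: cvg_trans (cvg_chart_inv GP kx Gx Gc).
  by apply: near_eq_cvg; apply: filterS kdom => e ke; rewrite /= chartK// ptK.
exists e0; split => //=.
have h := cvg_tnorm GP Ge0.
apply: (cvg_unique _ h) => //.
by apply: cvg_near_cst; apply: filterS G1.
Qed.

Section BundleMap.
Variables (f : X -> X) (A : forall z, 'Hom(T z, T (f z))).
Hypothesis cA : continuous (total_map A).

Lemma total_map_pt z (v : T z) : total_map A (pt v) = pt (A z v).
Proof. by rewrite /total_map /pt packK. Qed.

(** Locally |det A| is the quotient of the area of the image of a continuous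
    frame by the area of this frame. *)
Lemma absdet_continuous : continuous (fun z => absdet (A z)).
Proof.
move=> x; have [k _] := exists_chart TX x; have kx := chart_in k.
pose num z := tarea2 (total_map A (pt (frame_vec k 0 z))) (total_map A (pt (frame_vec k 1 z))).
have dE z : chart_dom k z -> absdet (A z) = Num.sqrt (num z / frame_area2 k z).
  move=> kz; rewrite /num /frame_area2 !total_map_pt !tarea2_pt area_hom.
  rewrite exprMn mulfK ?sqrtr_sqr ?ger0_norm ?absdet_ge0//.
  by rewrite expf_neq0// gt_eqF// frame_area_gt0.
have cvgf i : total_map A (pt (frame_vec k i z)) @[z --> x] -->
    total_map A (pt (frame_vec k i x)).
  apply: (@continuous_cvg X E E _ _ (fun z => pt (frame_vec k i z)) (total_map A)).
    exact: cA.
  exact: cvg_frame_vec.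
rewrite /continuous_at dE//.
have : Num.sqrt (num z / frame_area2 k z) @[z --> x] --> Num.sqrt (num x / frame_area2 k x).
  apply: (@continuous_cvg X R R _ _ (fun z => num z / frame_area2 k z) Num.sqrt).
    exact: sqrt_continuous.
  apply: cvgM; last by apply: cvgV; [rewrite gt_eqF// frame_area2_gt0|exact: cvg_frame_area2].
  apply: cvg_tarea2; rewrite ?total_map_pt ?tbase_pt//.
  - by apply: nearW => z; rewrite !total_map_pt !tbase_pt.
  - by rewrite -total_map_pt; exact: cvgf.
  - by rewrite -total_map_pt; exact: cvgf.
move=> h; apply: cvg_trans h; apply: near_eq_cvg.
by apply: filterS (near_chart_dom kx) => z kz; rewrite dE.
Qed.

End BundleMap.

End TotalArea.

(** * The unit sphere bundle *)

Section InverseCocycle.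
Variables (R : realType) (X : topologicalType) (TX : hermitian_bundle R X).

Definition inv_cocycle (A : linear_cocycle TX) : linear_cocycle TX :=
  @LinearCocycle R X TX (base_inv A) (base A) (base_invK A) (baseK A)
    (@base_inv_continuous _ _ _ A) (@base_continuous _ _ _ A)
    (cocycle_inv A) (cocycle_map A) (@cocycle_invK _ _ _ A) (@cocycleK _ _ _ A)
    (@cocycle_inv_continuous _ _ _ A) (@cocycle_continuous _ _ _ A).

End InverseCocycle.

Section Sphere.
Variables (R : realType) (X : ptopologicalType) (TX : hermitian_bundle R X).
Local Notation T := (fibre TX).
Local Notation E := (Defs.total TX).

Definition sphere : Type := set_type [set e : E | tnorm e = 1].

HB.instance Definition _ := Topological.copy sphere (set_type [set e : E | tnorm e = 1]).

Lemma exists_unit_vec z : exists v : T z, hnorm v = 1.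
Proof.
have : (fullv : {vspace T z}) != 0%VS by rewrite -dimv_eq0 dim_fibre.
rewrite -vpick0 => /exists_unit[a [_ a1]].
by exists (a *: vpick {:T z}); exact: hnorm_eq1.
Qed.

Definition sph z (v : T z) (v1 : hnorm v = 1) : sphere :=
  exist _ (pt v) (mem_set (etrans (tnorm_pt v) v1)).

Definition sphere_point : sphere :=
  let v := cid (exists_unit_vec point) in sph (projT2 v).

HB.instance Definition _ := isPointed.Build sphere sphere_point.

Definition svec (s : sphere) : E := set_val s.
Definition sproj (s : sphere) : X := tbase (svec s).

Lemma svec_norm (s : sphere) : tnorm (svec s) = 1.
Proof. by case: s => e h; exact: set_mem h. Qed.

Lemma svec_sph z (v : T z) (v1 : hnorm v = 1) : svec (sph v1) = pt v.
Proof. by []. Qed.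

Lemma svec_inj : injective svec. Proof. exact: val_inj. Qed.

Lemma svec_continuous : continuous svec.
Proof. exact: initial_continuous. Qed.

Lemma sproj_continuous : continuous sproj.
Proof.
move=> s; apply: (@continuous_comp sphere E X svec (@tbase _ _ TX)).
  exact: svec_continuous.
exact: tbase_continuous.
Qed.

Lemma continuous_to_sphere (W : topologicalType) (h : W -> sphere) :
  continuous (svec \o h) -> continuous h.
Proof. by move=> ch; apply: continuous_comp_initial. Qed.

Lemma sph_surj (s : sphere) : exists z (v : T z) (v1 : hnorm v = 1), s = sph v1.
Proof.
exists (sproj s), (tvec (svec s)), (svec_norm s); apply: svec_inj.
by rewrite svec_sph ptK.
Qed.

Lemma sproj_sph z (v : T z) (v1 : hnorm v = 1) : sproj (sph v1) = z.
Proof. exact: tbase_pt. Qed.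

Lemma sphere_hausdorff : hausdorff_space X -> hausdorff_space sphere.
Proof.
move=> /(@total_hausdorff _ _ TX) hE s t st; apply: svec_inj.
apply: hE => B C Bs Ct.
have [u [Bu Cu]] := st _ _ (svec_continuous Bs) (svec_continuous Ct).
by exists (svec u).
Qed.

Lemma sphere_compact : compact [set: X] -> compact [set: sphere].
Proof.
move=> /(@unit_sphere_compact _ _ TX) cE F FF _.
have FP : ProperFilter (svec @ F) by exact: fmap_proper_filter.
have [|e [e1 ce]] := cE (svec @ F) FP.
  by change (F [set s | tnorm (svec s) = 1]); apply: filterE; exact: svec_norm.
pose s : sphere := exist _ e (mem_set e1).
exists s; split=> // B C FB Cs.
have [V [oV Vs VC]] : exists V, [/\ open V, V (svec s) & svec @^-1` V `<=` C].
  move: Cs; rewrite nbhsE => -[C' [[V oV VC'] C's] C'C].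
  exists V; split=> //; first by rewrite -VC' in C's.
  by move=> t Vt; apply: C'C; rewrite -VC'.
have [] := ce (svec @` B) V.
- change (F (svec @^-1` (svec @` B))).
  by apply: filterS FB => t Bt; exists t.
- by apply: open_nbhs_nbhs; split.
by move=> _ [[t Bt <-] Vt]; exists t; split=> //; exact: VC.
Qed.

(** A unit vector extends to the neighbouring fibres: keep its coordinates in a
    chart and normalize. *)
Lemma sproj_open (V : set sphere) : open V -> open (sproj @` V).
Proof.
move=> oV; rewrite openE => _ [s Vs <-].
have [k _] := exists_chart TX (sproj s); have ks := chart_in k.
pose c := chart k (sproj s) (tvec (svec s)).
pose w z := chart_inv k z c.
have ws : w (sproj s) = tvec (svec s) by rewrite /w chartK.
have cw : pt (w z) @[z --> sproj s] --> svec s.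
  rewrite -(ptK (svec s)) -[X in _ --> pt X]ws.
  by apply: cvg_chart_inv => //; exact: cvg_cst.
have cn := cvg_tnorm (nbhs_filter _) cw; rewrite svec_norm in cn.
have cd : tscale (rc (tnorm (pt (w z)))^-1) (pt (w z)) @[z --> sproj s] --> svec s.
  have -> : svec s = tscale (rc (1 : R)) (svec s) by rewrite /tscale scale1r ptK.
  apply: cvg_tscale => //; apply: cvg_rc; rewrite -[X in _ --> X]invr1.
  by apply: cvgV => //; exact: oner_neq0.
have [V' oV' V'V] : exists2 V', open V' & svec @^-1` V' = V by case: oV => V' ? ?; exists V'.
have nV' : \forall z \near sproj s, V' (tscale (rc (tnorm (pt (w z)))^-1) (pt (w z))).
  by apply: cd; apply: open_nbhs_nbhs; split => //; move: Vs; rewrite -V'V.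
have nn : \forall z \near sproj s, 0 < tnorm (pt (w z)) by exact: (cvgr_gt _ cn _ ltr01).
apply: filterS2 nV' nn => z Vz nz.
rewrite tscale_pt in Vz.
have u1 : hnorm (rc (tnorm (pt (w z)))^-1 *: w z) = 1.
  by rewrite hnormZc cmodR tnorm_pt ger0_norm ?invr_ge0 ?hnorm_ge0// mulVf// gt_eqF// -tnorm_pt.
by exists (sph u1); rewrite ?sproj_sph// -V'V.
Qed.

End Sphere.

Arguments sproj {R X TX}.
Arguments svec {R X TX}.

(** * The cocycle acting on the unit sphere bundle *)

Section Determinant.
Variables (R : realType) (X : topologicalType) (TX : hermitian_bundle R X).
Local Notation T := (fibre TX).

Lemma absdet_comp z w y (L : 'Hom(T z, T w)) (K : 'Hom(T w, T y)) :
  absdet (K \o L)%VF = absdet K * absdet L.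
Proof.
rewrite /absdet (lin_matrix_comp _ _ _ _ (onbP TX w)) det_mulmx.
exact: cmodM.
Qed.

Lemma absdet_id z : absdet (\1%VF : 'Hom(T z, T z)) = 1.
Proof.
have [v v1] : exists v : T z, hnorm v = 1.
  have : (fullv : {vspace T z}) != 0%VS by rewrite -dimv_eq0 dim_fibre.
  rewrite -vpick0 => /exists_unit[a [_ a1]].
  by exists (a *: vpick {:T z}); exact: hnorm_eq1.
have [w [w1 wv]] := exists_orth v1.
have := area_hom \1%VF w v; rewrite !id_lfunE (area_orth wv) v1 w1 !mulr1.
by move=> <-.
Qed.

(** An injective map of vanishing determinant would send orthonormal vectors to
    collinear ones. *)
Lemma absdet_gt0 z w (L : 'Hom(T z, T w)) : (forall v, L v = 0 -> v = 0) -> 0 < absdet L.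
Proof.
move=> L0; rewrite lt_def absdet_ge0 andbT; apply/negP => /eqP d0.
have [v v1] : exists v : T z, hnorm v = 1.
  have : (fullv : {vspace T z}) != 0%VS by rewrite -dimv_eq0 dim_fibre.
  rewrite -vpick0 => /exists_unit[a [_ a1]].
  by exists (a *: vpick {:T z}); exact: hnorm_eq1.
have [u [u1 uv]] := exists_orth v1.
have v0 : v != 0 by rewrite -hnorm_gt0 v1.
have Lv0 : L v != 0 by apply: contra v0 => /eqP/L0/eqP.
have := area_hom L u v; rewrite d0 mul0r => /eqP; rewrite area_eq0// => /vlineP[c Lu].
have /L0/eqP : L (u - c *: v) = 0 by rewrite linearB linearZ/= Lu subrr.
have := area_shear c u v; rewrite (area_orth uv) u1 v1 mulr1 => h.
move=> /eqP uc; move: h; rewrite uc /area /det2 !linear0 !mul0r subrr cmod0 => /eqP.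
by rewrite eq_sym oner_eq0.
Qed.

End Determinant.

Section SphereMap.
Variables (R : realType) (X : ptopologicalType) (TX : hermitian_bundle R X).
Local Notation T := (fibre TX).
Local Notation E := (Defs.total TX).
Local Notation S := (sphere TX).
Implicit Type A : linear_cocycle TX.

Local Notation tmap A := (total_map (cocycle_map A)).

Lemma tmapE A z (v : T z) : tmap A (pt v) = pt (cocycle_map A z v).
Proof. exact: total_map_pt. Qed.

Lemma tmap_inv A e : tmap (inv_cocycle A) (tmap A e) = e.
Proof. exact: cocycleK. Qed.

Lemma cocycle_map_eq0 A z (v : T z) : cocycle_map A z v = 0 -> v = 0.
Proof.
move=> v0; apply: (@pt_inj _ _ TX z); rewrite -[LHS](tmap_inv A) -[RHS](tmap_inv A).
by rewrite (tmapE A v) (tmapE A 0) v0 linear0.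
Qed.

Lemma pt_exists (e : E) : exists z (v : T z), e = pt v.
Proof. by exists (tbase e), (tvec e); rewrite ptK. Qed.

Lemma tmap_scale A c e : tmap A (tscale c e) = tscale c (tmap A e).
Proof. by have [z [v ->]] := pt_exists e; rewrite tscale_pt !tmapE tscale_pt linearZ. Qed.

Lemma tbase_tmap A e : tbase (tmap A e) = base A (tbase e).
Proof. by have [z [v ->]] := pt_exists e; rewrite tmapE !tbase_pt. Qed.

Lemma tnorm_scale c (e : E) : tnorm (tscale c e) = cmod c * tnorm e.
Proof. by have [z [v ->]] := pt_exists e; rewrite tscale_pt !tnorm_pt hnormZc. Qed.

Lemma tscaleA c d (e : E) : tscale c (tscale d e) = tscale (c * d) e.
Proof. by have [z [v ->]] := pt_exists e; rewrite !tscale_pt scalerA. Qed.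

Lemma tscale1 (e : E) : tscale 1 e = e.
Proof. by have [z [v ->]] := pt_exists e; rewrite tscale_pt scale1r. Qed.

Definition stretch A (s : S) : R := tnorm (tmap A (svec s)).

Lemma stretch_gt0 A s : 0 < stretch A s.
Proof.
have [z [v [v1 ->]]] := sph_surj s.
rewrite /stretch svec_sph tmapE tnorm_pt hnorm_gt0.
by apply/eqP => /cocycle_map_eq0 v0; move/eqP: v1; rewrite v0 hnorm0 eq_sym oner_eq0.
Qed.

Lemma smap_subproof A s : tnorm (tscale (rc (stretch A s)^-1) (tmap A (svec s))) = 1.
Proof.
rewrite tnorm_scale cmodR ger0_norm ?invr_ge0 ?(ltW (stretch_gt0 _ _))//.
by rewrite mulVf// gt_eqF// stretch_gt0.
Qed.

Definition smap A (s : S) : S :=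
  exist _ (tscale (rc (stretch A s)^-1) (tmap A (svec s))) (mem_set (smap_subproof A s)).

Lemma svec_smap A s : svec (smap A s) = tscale (rc (stretch A s)^-1) (tmap A (svec s)).
Proof. by []. Qed.

Lemma sproj_smap A s : sproj (smap A s) = base A (sproj s).
Proof.
rewrite /sproj svec_smap -tbase_tmap.
by have [z [v ->]] := pt_exists (tmap A (svec s)); rewrite tscale_pt !tbase_pt.
Qed.

Lemma stretch_inv A s : stretch (inv_cocycle A) (smap A s) = (stretch A s)^-1.
Proof.
rewrite /stretch svec_smap tmap_scale tmap_inv tnorm_scale svec_norm mulr1.
by rewrite cmodR ger0_norm ?invr_ge0 ?(ltW (stretch_gt0 _ _)).
Qed.

Lemma smapK A : cancel (smap A) (smap (inv_cocycle A)).
Proof.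
move=> s; apply: svec_inj; rewrite svec_smap stretch_inv svec_smap tmap_scale tmap_inv.
rewrite tscaleA -rcM invrK mulfV ?gt_eqF ?stretch_gt0//.
exact: tscale1.
Qed.

Lemma inv_cocycle_inv A : inv_cocycle (inv_cocycle A) = A.
Proof. by case: A. Qed.

Lemma smap_invK A : cancel (smap (inv_cocycle A)) (smap A).
Proof. by have := smapK (inv_cocycle A); rewrite inv_cocycle_inv. Qed.

Let tmap_svec_continuous A : continuous (tmap A \o svec).
Proof.
move=> s; apply: (@continuous_comp S E E svec (tmap A)); first exact: svec_continuous.
exact: cocycle_continuous.
Qed.

Lemma stretch_continuous A : continuous (stretch A).
Proof. move=> s.
exact: (@cvg_tnorm _ _ TX S (nbhs s) _ (tmap A \o svec) _ (@tmap_svec_continuous A s)). Qed.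

Lemma smap_continuous A : continuous (smap A).
Proof.
apply: continuous_to_sphere => s.
apply: (@cvg_tscale _ _ TX S (nbhs s) _ (fun t => rc (stretch A t)^-1) _ (tmap A \o svec) _
  _ (@tmap_svec_continuous A s)).
apply: cvg_rc; apply: cvgV; first by rewrite gt_eqF// stretch_gt0.
exact: stretch_continuous.
Qed.

(** The functions whose Birkhoff sums are ln |A^n v| and ln |det A^n|.  The
    second one is constant on fibres, but is considered on the sphere bundle so
    that all the sums are over the same dynamics. *)
Definition lgr A (s : S) : R := ln (stretch A s).
Definition ldet A (s : S) : R := ln (absdet (cocycle_map A (sproj s))).

Lemma cocycle_absdet_gt0 A z : 0 < absdet (cocycle_map A z).
Proof. by apply: absdet_gt0 => v; exact: cocycle_map_eq0. Qed.

Lemma lgr_continuous A : continuous (lgr A).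
Proof.
move=> s; apply: (@continuous_comp S R R (stretch A) (@ln R)).
  exact: stretch_continuous.
by apply: continuous_ln; exact: stretch_gt0.
Qed.

Lemma ldet_continuous A : continuous (ldet A).
Proof.
move=> s; apply: (@continuous_comp S R R (fun t => absdet (cocycle_map A (sproj t))) (@ln R)).
  apply: (@continuous_comp S X R sproj (fun z => absdet (cocycle_map A z))).
    exact: sproj_continuous.
  by apply: absdet_continuous; exact: cocycle_continuous.
by apply: continuous_ln; exact: cocycle_absdet_gt0.
Qed.

Lemma lgr_inv A s : lgr (inv_cocycle A) (smap A s) = - lgr A s.
Proof. by rewrite /lgr stretch_inv lnV// posrE stretch_gt0. Qed.

Lemma absdet_inv A z :
  absdet (cocycle_map (inv_cocycle A) (base A z)) * absdet (cocycle_map A z) = 1.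
Proof.
have [v v1] := exists_unit_vec TX z; have [w [w1 wv]] := exists_orth v1.
have h : tarea2 (tmap (inv_cocycle A) (tmap A (pt w))) (tmap (inv_cocycle A) (tmap A (pt v))) = 1.
  by rewrite !tmap_inv tarea2_pt (area_orth wv) v1 w1 mulr1 expr1n.
move: h; rewrite (tmapE A) (tmapE A v) (tmapE (inv_cocycle A)).
rewrite (tmapE (inv_cocycle A) (cocycle_map A z v)) tarea2_pt !area_hom (area_orth wv) v1 w1 !mulr1 => h.
apply/eqP; rewrite -(@eqrXn2 _ 2) ?expr1n ?h//.
by rewrite mulr_ge0 ?absdet_ge0.
Qed.

Lemma ldet_inv A s : ldet (inv_cocycle A) (smap A s) = - ldet A s.
Proof.
rewrite /ldet sproj_smap; have h := absdet_inv A (sproj s).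
have -> : absdet (cocycle_map (inv_cocycle A) (base A (sproj s))) =
    (absdet (cocycle_map A (sproj s)))^-1.
  by rewrite -[LHS]mulr1 -(@mulfV _ (absdet (cocycle_map A (sproj s)))) ?mulrA ?h ?mul1r// gt_eqF// cocycle_absdet_gt0.
by rewrite lnV// posrE cocycle_absdet_gt0.
Qed.

Local Notation Sl A := (birkhoff_sum (smap A) (lgr A)).
Local Notation Sd A := (birkhoff_sum (smap A) (ldet A)).
Local Notation itc A := (iter_cocycle (cocycle_map A)).

Lemma svec_iter_smap A n z (v : T z) (v1 : hnorm v = 1) :
  svec (iter n (smap A) (sph v1)) =
  tscale (rc (expR (- Sl A n (sph v1)))) (pt (itc A n z v)).
Proof.
elim: n => [|n IH]; first by rewrite birkhoff_sum0 oppr0 expR0 tscale1 /= id_lfunE.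
rewrite [in LHS]iterS svec_smap IH tmap_scale tscaleA -rcM tmapE /= comp_lfunE.
congr (tscale (rc _) _).
rewrite birkhoff_sumS opprD expRD mulrC; congr (_ * _).
by rewrite expRN /lgr lnK// posrE stretch_gt0.
Qed.

Lemma hnorm_iter A n z (v : T z) (v1 : hnorm v = 1) :
  hnorm (itc A n z v) = expR (Sl A n (sph v1)).
Proof.
have := svec_norm (iter n (smap A) (sph v1)).
rewrite svec_iter_smap tnorm_scale cmodR tnorm_pt ger0_norm ?expR_ge0// expRN => h.
by rewrite -[LHS]mul1r -(@mulfV _ (expR (Sl A n (sph v1)))) ?gt_eqF ?expR_gt0// -mulrA h mulr1.
Qed.

Lemma sproj_iter A n s : sproj (iter n (smap A) s) = iter n (base A) (sproj s).
Proof. by elim: n => //= n IH; rewrite sproj_smap IH. Qed.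

Lemma absdet_iter A n (s : S) :
  absdet (itc A n (sproj s)) = expR (Sd A n s).
Proof.
elim: n => [|n IH]; first by rewrite birkhoff_sum0 expR0 absdet_id.
rewrite [iter_cocycle _ _ _]/= absdet_comp IH birkhoff_sumS expRD mulrC.
by congr (_ * _); rewrite /ldet lnK ?posrE ?cocycle_absdet_gt0// sproj_iter.
Qed.

Lemma hnorm_cocycleZ_pos A n z (v : T z) : cocycleZ A n%:Z z v = itc A n z v.
Proof. by []. Qed.

Lemma hnorm_cocycleZ_neg A n z (v : T z) :
  hnorm (cocycleZ A (- n%:Z) z v) = hnorm (itc (inv_cocycle A) n z v).
Proof. by case: n. Qed.

Lemma absdet_cocycleZ_neg A n z :
  absdet (cocycleZ A (- n%:Z) z) = absdet (itc (inv_cocycle A) n z).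
Proof. by case: n. Qed.

End SphereMap.

(** * Directions transverse to a given one *)

Section Sequences.
Variable R : realType.
Implicit Types (s : nat -> R) (l : R).

Lemma average_bound s l : (n%:R)^-1 * s n @[n --> \oo] --> l ->
  forall e, 0 < e -> exists K, 0 <= K /\ forall n, `|s n - l * n%:R| <= e * n%:R + K.
Proof.
move=> sl e e0; move/cvgrPdist_le : sl => /(_ _ e0)[N _ hN].
exists (\sum_(k < N.+1) `|s k - l * k%:R|); split; first exact: sumr_ge0.
move=> n; have [nN|Nn] := leqP n N.
  apply: (@le_trans _ _ (\sum_(k < N.+1) `|s k - l * k%:R|)); last first.
    by rewrite lerDr mulr_ge0// ltW.
  rewrite (bigD1 (Ordinal (nN : (n < N.+1)%N)))//= lerDl.
  exact: sumr_ge0.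
have n0 : 0 < n%:R :> R by rewrite ltr0n (leq_ltn_trans _ Nn).
apply: (@le_trans _ _ (e * n%:R)); last by rewrite lerDl sumr_ge0.
have := hN n (ltnW Nn); rewrite /= => h.
have -> : s n - l * n%:R = - (n%:R * (l - n%:R^-1 * s n)).
  by rewrite mulrBr mulrA mulfV ?gt_eqF// mul1r; ring.
by rewrite normrN normrM (gtr0_norm n0) mulrC ler_wpM2r// ltW.
Qed.

Lemma average_of_bounds s l :
  (forall e, 0 < e -> exists K, forall n, s n <= (l + e) * n%:R + K) ->
  (forall e, 0 < e -> exists K, forall n, (l - e) * n%:R - K <= s n) ->
  (n%:R)^-1 * s n @[n --> \oo] --> l.
Proof.
move=> hi lo; apply: cvg_average => x xl.
  have [K hK] := hi (x - l) ltac:(by rewrite subr_gt0).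
  by exists K => n; rewrite -[X in X * _](subrKC l).
have [K hK] := lo (l - x) ltac:(by rewrite subr_gt0).
by exists K => n; apply: le_trans (hK n); rewrite subKr.
Qed.

Lemma average_shift s t l C : (forall n, `|s n - t n| <= C) ->
  (n%:R)^-1 * s n @[n --> \oo] --> l -> (n%:R)^-1 * t n @[n --> \oo] --> l.
Proof.
move=> st /average_bound sl.
apply: average_of_bounds => e e0; have [K [_ hK]] := sl e e0;
  exists (K + C) => n; have := hK n; have := st n;
  rewrite !ler_norml => /andP[? ?] /andP[? ?]; lra.
Qed.

Lemma averageN s l : (n%:R)^-1 * s n @[n --> \oo] --> l ->
  (n%:R)^-1 * - s n @[n --> \oo] --> - l.
Proof.
move=> h; rewrite (_ : (fun n => _) = (fun n => - ((n%:R)^-1 * s n))).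
  exact: cvgN.
by apply: funext => n; rewrite mulrN.
Qed.

(** The limit is the supremum of the lower bounds c n - B over the tails bounded
    by B.  It comes with its distance to [c n] for every [n] at which the tail is
    under control. *)
Lemma real_summable_limit (c h : nat -> R) :
  (forall n, `|c n.+1 - c n| <= h n) ->
  exists l, forall n B, (forall m, \sum_(n <= k < n + m) h k <= B) -> `|l - c n| <= B.
Proof.
move=> ch.
have step n m : `|c (n + m)%N - c n| <= \sum_(n <= k < n + m) h k.
  elim: m => [|m IH]; first by rewrite addn0 subrr normr0 big_geq.
  rewrite addnS big_nat_recr ?leq_addr//=.
  have -> : c (n + m).+1 - c n = (c (n + m).+1 - c (n + m)%N) + (c (n + m)%N - c n) by ring.
  by apply: le_trans (ler_normD _ _) _; rewrite addrC lerD.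
pose tail n B := forall m, \sum_(n <= k < n + m) h k <= B.
pose Lo := [set x | exists n B, tail n B /\ x = c n - B].
have LoHi x n B : Lo x -> tail n B -> x <= c n + B.
  move=> [n' [B' [t' ->]]] t.
  have h1 := le_trans (step n (maxn n n' - n)%N) (t _).
  have h2 := le_trans (step n' (maxn n n' - n')%N) (t' _).
  move: h1 h2; rewrite !subnKC ?leq_maxl ?leq_maxr// !ler_norml.
  by move=> /andP[? ?] /andP[? ?]; lra.
exists (sup Lo) => n B t.
have hs : has_sup Lo.
  split; first by exists (c n - B), n, B.
  by exists (c n + B) => x Lx; exact: LoHi.
rewrite ler_norml; apply/andP; split.
  rewrite lerBrDl addrC; apply: ub_le_sup; first exact: hs.2.
  by exists n, B; split=> //; rewrite addrC.
by rewrite lerBlDl; apply: ge_sup; [exact: hs.1|move=> x Lx; exact: LoHi].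
Qed.

(** Applied to real and imaginary parts, whence the factor two. *)
Lemma complex_summable_limit (c : nat -> Cplx R) (h : nat -> R) :
  (forall n, cmod (c n.+1 - c n) <= h n) ->
  exists l : Cplx R, forall n (B : R), (forall m, \sum_(n <= k < n + m) h k <= B) ->
    cmod (l - c n) <= B + B.
Proof.
move=> ch.
have ReB (x y : Cplx R) : complex.Re (x - y) = complex.Re x - complex.Re y.
  by case: x; case: y.
have ImB (x y : Cplx R) : complex.Im (x - y) = complex.Im x - complex.Im y.
  by case: x; case: y.
have [l1 h1] := @real_summable_limit (fun n => complex.Re (c n)) h
  (fun n => le_trans (eq_ind _ (fun x => `|x| <= _) (le_cmod_Re _) _ (ReB _ _)) (ch n)).
have [l2 h2] := @real_summable_limit (fun n => complex.Im (c n)) h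
  (fun n => le_trans (eq_ind _ (fun x => `|x| <= _) (le_cmod_Im _) _ (ImB _ _)) (ch n)).
exists (Complex l1 l2) => n B t; apply: le_trans (cmod_le_ReIm _) _.
by rewrite ReB ImB/= lerD ?h1 ?h2.
Qed.

Lemma geometric_tail (q : R) n m : 0 < q -> q < 1 ->
  \sum_(n <= k < n + m) q ^+ k <= q ^+ n / (1 - q).
Proof.
move=> q0 q1; have q1' : 0 < 1 - q by rewrite subr_gt0.
suff -> : \sum_(n <= k < n + m) q ^+ k = (q ^+ n - q ^+ (n + m)) / (1 - q).
  by rewrite ler_pM2r ?invr_gt0// gerBl exprn_ge0// ltW.
elim: m => [|m IH]; first by rewrite addn0 big_geq// subrr mul0r.
rewrite addnS big_nat_recr ?leq_addr//= IH exprS.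
by field; rewrite gt_eqF.
Qed.

Lemma natr_le_expR (e : R) n : 0 < e -> n%:R <= e^-1 * expR (e * n%:R).
Proof.
move=> e0; rewrite mulrC ler_pdivlMr// mulrC.
by apply: le_trans (expR_ge1Dx _); rewrite lerDr.
Qed.

End Sequences.

Section Shear.
Variables (R : realType) (X : ptopologicalType) (TX : hermitian_bundle R X).
Local Notation T := (fibre TX).
Variable A : linear_cocycle TX.
Local Notation itc := (iter_cocycle (cocycle_map A)).
Hypothesis cptX : compact [set: X].

Lemma lgr_bounded : exists B, 0 <= B /\ forall s, `|lgr A s| <= B.
Proof.
have [B hB] := continuous_compact_norm (@sphere_compact _ _ TX cptX) (@lgr_continuous _ _ TX A).
by exists B; split=> //; exact: le_trans (normr_ge0 _) (hB point).
Qed.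

Lemma ldet_bounded : exists B, forall s, `|ldet A s| <= B.
Proof.
exact: continuous_compact_norm (@sphere_compact _ _ TX cptX) (@ldet_continuous _ _ TX A).
Qed.

Lemma unit_decomp z (u : T z) : u != 0 ->
  exists v : T z, hnorm v = 1 /\ u = rc (hnorm u) *: v.
Proof.
rewrite -hnorm_gt0 => u0; exists (rc (hnorm u)^-1 *: u); split.
  by rewrite hnormZc cmodR ger0_norm ?invr_ge0 ?hnorm_ge0// mulVf// gt_eqF.
by rewrite scalerA -rcM mulfV ?scale1r// gt_eqF.
Qed.

Lemma hnorm_step : exists M, 1 <= M /\ forall z (u : T z),
  hnorm (cocycle_map A z u) <= M * hnorm u /\ hnorm u <= M * hnorm (cocycle_map A z u).
Proof.
have [B [B0 hB]] := lgr_bounded; exists (expR B); split.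
  by rewrite -expR0 ler_expR.
move=> z u; have [->|/unit_decomp[v [v1 ->]]] := eqVneq u 0.
  by rewrite linear0 !hnorm0 mulr0.
have e : hnorm (cocycle_map A z v) = expR (lgr A (sph v1)).
  by rewrite /lgr lnK ?posrE ?stretch_gt0// /stretch svec_sph tmapE tnorm_pt.
rewrite linearZ/= !hnormZc v1 e mulr1; have := hB (sph v1); rewrite ler_norml => /andP[h1 h2].
have c0 := cmod_ge0 (rc (hnorm u)).
split; first by rewrite mulrC ler_wpM2r// ler_expR.
rewrite mulrCA -[leLHS]mulr1 ler_wpM2l// -expRD -expR0 ler_expR; lra.
Qed.

(** The coefficient of the orthogonal projection of A^n w on A^n v: the vector
    A^n (w - shear v w n v) is orthogonal to A^n v. *)
Definition shear z (v w : T z) (n : nat) : Cplx R :=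
  herm TX _ (itc n z w) (itc n z v) / herm TX _ (itc n z v) (itc n z v).

Lemma itc_eq0 n z (v : T z) : (itc n z v == 0) = (v == 0).
Proof.
apply/eqP/eqP => [|->]; last by rewrite linear0.
elim: n => [|n IH]; first by rewrite /= id_lfunE.
by rewrite /= comp_lfunE => /cocycle_map_eq0.
Qed.

Lemma shear_orth z (v w : T z) n : v != 0 ->
  herm TX _ (itc n z (w - shear v w n *: v)) (itc n z v) = 0.
Proof.
move=> v0; rewrite linearB linearZ/= linearBl/= linearZl_LR/= divfK ?subrr//.
by rewrite dnorm_eq0 itc_eq0.
Qed.

(** By orthogonality the area is the product of the two norms. *)
Lemma hnorm_shear z (v w : T z) n : v != 0 ->
  hnorm (itc n z (w - shear v w n *: v)) = absdet (itc n z) * area w v / hnorm (itc n z v).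
Proof.
move=> v0; have := area_hom (itc n z) (w - shear v w n *: v) v.
rewrite area_shear (area_orth (shear_orth _ _ v0)) => <-.
by rewrite mulfK// hnorm_eq0 itc_eq0.
Qed.

(** The increment is the coefficient along A^(n+1) v of the image under A of the
    orthogonal part at time [n], whose norm is given by [hnorm_shear]; [P] bounds
    the distortion of one application of A. *)
Lemma shear_step : exists P, 0 < P /\ forall z (v w : T z) n, v != 0 ->
  cmod (shear v w n.+1 - shear v w n) <=
  P * (absdet (itc n z) * area w v / hnorm (itc n z v) ^+ 2).
Proof.
have [M [M1 hM]] := hnorm_step; have M0 : 0 < M by apply: lt_le_trans M1.
exists (M * M); split; first by rewrite mulr_gt0.
move=> z v w n v0.
set u := w - shear v w n *: v.
have an0 : 0 < hnorm (itc n z v) by rewrite hnorm_gt0 itc_eq0.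
have an1 : 0 < hnorm (itc n.+1 z v) by rewrite hnorm_gt0 itc_eq0.
have dE : shear v w n.+1 - shear v w n =
    herm TX _ (itc n.+1 z u) (itc n.+1 z v) / rc (hnorm (itc n.+1 z v) ^+ 2).
  have -> : itc n.+1 z u = itc n.+1 z w - shear v w n *: itc n.+1 z v.
    by rewrite /u linearB linearZ.
  by rewrite hermE linearBl linearZl_LR mulrBl mulfK// dnorm_eq0 (itc_eq0 n.+1).
rewrite dE cmodM -rcV cmodR ger0_norm ?invr_ge0 ?sqr_ge0//.
have [h1 h2] := hM _ (itc n z u).
have [h3 h4] := hM _ (itc n z v).
have e1 k (y : T z) : itc k.+1 z y = cocycle_map A _ (itc k z y) by rewrite /= comp_lfunE.
rewrite -!e1 in h1 h2 h3 h4.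
have hu := hnorm_shear w n v0; rewrite -/u in hu.
apply: (@le_trans _ _ (hnorm (itc n.+1 z u) / hnorm (itc n.+1 z v))).
  rewrite expr2 invfM mulrA ler_wpM2r ?invr_ge0 ?hnorm_ge0//.
  by rewrite ler_pdivrMr// herm_le.
apply: (@le_trans _ _ (M * hnorm (itc n z u) / hnorm (itc n.+1 z v))).
  by rewrite ler_wpM2r// invr_ge0 hnorm_ge0.
apply: (@le_trans _ _ (M * hnorm (itc n z u) * (M / hnorm (itc n z v)))).
  rewrite ler_wpM2l ?mulr_ge0 ?hnorm_ge0 ?(ltW M0)//.
  by rewrite ler_pdivlMr// mulrC ler_pdivrMr// mulrC.
rewrite hu expr2 invfM le_eqVlt; apply/orP; left; apply/eqP; ring.
Qed.

Lemma shear_split z (v w : T z) (t : Cplx R) n : v != 0 ->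
  hnorm (itc n z (w - t *: v)) <= absdet (itc n z) * area w v / hnorm (itc n z v) +
    cmod (t - shear v w n) * hnorm (itc n z v).
Proof.
move=> v0.
have -> : w - t *: v = (w - shear v w n *: v) - (t - shear v w n) *: v.
  by rewrite scalerBl opprB addrA subrK.
have -> : itc n z (w - shear v w n *: v - (t - shear v w n) *: v) =
    itc n z (w - shear v w n *: v) - (t - shear v w n) *: itc n z v.
  by rewrite [LHS]linearB [X in _ - X]linearZ.
have := ler_hnormB (itc n z (w - shear v w n *: v)) ((t - shear v w n) *: itc n z v).
by rewrite hnorm_shear// hnormZc.
Qed.

Lemma hnorm_lower z (v e : T z) n : v != 0 ->
  absdet (itc n z) * area e v / hnorm (itc n z v) <= hnorm (itc n z e).
Proof.
move=> v0; rewrite -area_hom ler_pdivrMr ?area_le//.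
by rewrite hnorm_gt0 itc_eq0.
Qed.

End Shear.

(** * Exponents of the transverse directions *)

Section Exponents.
Variables (R : realType) (X : ptopologicalType) (TX : hermitian_bundle R X).
Local Notation T := (fibre TX).
Variable A : linear_cocycle TX.
Local Notation itc := (iter_cocycle (cocycle_map A)).
Hypothesis cptX : compact [set: X].

Definition fwd_exponent z (u : T z) (l : R) : Prop :=
  (n%:R)^-1 * ln (hnorm (itc n z u)) @[n --> \oo] --> l.

Lemma fwd_exponentZ z (u : T z) (c : Cplx R) l : u != 0 -> c != 0 ->
  fwd_exponent u l -> fwd_exponent (c *: u) l.
Proof.
move=> u0 c0; apply: (@average_shift _ _ _ _ `|ln (cmod c)|) => n.
have h1 : 0 < hnorm (itc n z u) by rewrite hnorm_gt0 itc_eq0.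
have h2 : 0 < cmod c by rewrite lt_def cmod_ge0 cmod_eq0 c0.
by rewrite linearZ/= hnormZc lnM ?posrE// opprD addrCA subrr addr0 normrN.
Qed.

Variables (z : X) (v : T z) (lam d : R).
Hypothesis v1 : hnorm v = 1.
Hypothesis lamP : fwd_exponent v lam.
Hypothesis dP : (n%:R)^-1 * ln (absdet (itc n z)) @[n --> \oo] --> d.

Let v0 : v != 0. Proof. by rewrite -hnorm_gt0 v1. Qed.
Let a n := ln (hnorm (itc n z v)).
Let D n := ln (absdet (itc n z)).

Let aE n : hnorm (itc n z v) = expR (a n).
Proof. by rewrite /a lnK// posrE hnorm_gt0 itc_eq0. Qed.

Let DE n : absdet (itc n z) = expR (D n).
Proof.
rewrite /D lnK// posrE; apply: absdet_gt0 => u /eqP.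
by rewrite itc_eq0 => /eqP.
Qed.

Let bounds (e : R) : 0 < e -> exists K, [/\ 0 <= K,
  forall n, lam * n%:R - e * n%:R - K <= a n <= lam * n%:R + e * n%:R + K &
  forall n, d * n%:R - e * n%:R - K <= D n <= d * n%:R + e * n%:R + K].
Proof.
move=> e0; have [K1 [K10 h1]] := average_bound lamP e0.
have [K2 [K20 h2]] := average_bound dP e0.
exists (K1 + K2); split; first exact: addr_ge0.
  by move=> n; have := h1 n; rewrite -/(a n) ler_norml => /andP[? ?]; apply/andP; split; lra.
by move=> n; have := h2 n; rewrite -/(D n) ler_norml => /andP[? ?]; apply/andP; split; lra.
Qed.

Let gE n x : absdet (itc n z) * x / hnorm (itc n z v) ^+ 2 = x * expR (D n - 2 * a n).
Proof.
have e2 : expR (2 * a n) = expR (a n) ^+ 2.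
  by rewrite expr2 -expRD; congr expR; ring.
by rewrite DE aE expRB e2 mulrA [x * _]mulrC.
Qed.

Let lower (e : T z) : area e v != 0 -> forall eps, 0 < eps ->
  exists K, forall n, (d - lam - eps) * n%:R - K <= ln (hnorm (itc n z e)).
Proof.
move=> ev eps eps0; have [K [K0 ha hD]] := @bounds (eps / 2) ltac:(lra).
have ev0 : 0 < area e v by rewrite lt_def ev area_ge0.
exists (K + K - ln (area e v)) => n.
have := hnorm_lower A e n v0; rewrite DE aE => h.
have : ln (expR (D n) * area e v / expR (a n)) <= ln (hnorm (itc n z e)).
  have p1 : 0 < expR (D n) * area e v / expR (a n) by rewrite divr_gt0 ?mulr_gt0 ?expR_gt0.
  by rewrite ler_ln ?posrE// (lt_le_trans p1 h).
rewrite ln_div ?posrE ?mulr_gt0 ?expR_gt0// lnM ?posrE ?expR_gt0// !expRK.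
by move=> h2; have /andP[? ?] := ha n; have /andP[? ?] := hD n; nra.
Qed.

Let upper (e : T z) (eps : R) C : e != 0 -> 0 < C ->
  (forall n, hnorm (itc n z e) <= C * expR ((d - lam + eps) * n%:R)) ->
  exists K, forall n, ln (hnorm (itc n z e)) <= (d - lam + eps) * n%:R + K.
Proof.
move=> e0 C0 h; exists (ln C) => n.
have p : 0 < hnorm (itc n z e) by rewrite hnorm_gt0 itc_eq0.
have := h n; rewrite -ler_ln ?posrE//; last by rewrite mulr_gt0// expR_gt0.
by rewrite lnM ?posrE ?expR_gt0// expRK addrC.
Qed.

Let indep (e : T z) : area e v != 0 -> e != 0.
Proof. by apply: contra => /eqP ->; rewrite /area /det2 !linear0 !mul0r subrr cmod0. Qed.

(** When |det A^n| / |A^n v|^2 does not decay, the sum of its first [n] values,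
    which bounds the component of A^n e along A^n v, is itself at most of that
    order of growth. *)
Lemma exponent_dominant (e : T z) : 0 <= d - 2 * lam -> area e v != 0 ->
  fwd_exponent e (d - lam).
Proof.
move=> r0 ev; apply: average_of_bounds; last exact: lower.
move=> eps eps0; have ev0 : 0 < area e v by rewrite lt_def ev area_ge0.
(* the estimates below lose a few multiples of eta n, never more than 8 eta n *)
pose eta := eps / 8; have eta0 : 0 < eta by rewrite divr_gt0.
have epsE : eps = 8 * eta by rewrite /eta; field.
have [K [K0 ha hD]] := bounds eta0.
have [P [P0 hP]] := shear_step A cptX.
pose r := d - 2 * lam; pose c0 := cmod (shear A v e 0).
pose Q := P * area e v * expR (3 * K) * eta^-1.
have Q0 : 0 < Q by rewrite !mulr_gt0// ?invr_gt0// expR_gt0.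
have c00 : 0 <= c0 by exact: cmod_ge0.
have hs n : cmod (shear A v e n) <= (c0 + Q) * expR ((r + 4 * eta) * n%:R).
  have h1 : cmod (shear A v e n) <= c0 + n%:R * (P * area e v * expR ((r + 3 * eta) * n%:R + 3 * K)).
    have inc m : cmod (shear A v e m) <= c0 + \sum_(k < m) P * (area e v * expR (D k - 2 * a k)).
      elim: m => [|m IH]; first by rewrite big_ord0 addr0.
      rewrite big_ord_recr/= addrA -[X in cmod X](subrK (shear A v e m)) addrC.
      apply: le_trans (cmodD _ _) _; rewrite lerD//.
      by apply: le_trans (hP _ _ _ _ v0) _; rewrite gE.
    apply: le_trans (inc n) _; rewrite lerD2l; set y := P * _ * _.
    have -> : n%:R * y = \sum_(k < n) y by rewrite sumr_const card_ord mulr_natl.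
    rewrite /y; apply: ler_sum => k _; rewrite mulrA ler_wpM2l ?mulr_ge0 ?area_ge0 ?(ltW P0)// ler_expR.
    have /andP[x1 x2] := ha k; have /andP[x3 x4] := hD k.
    have kn : (k : nat)%:R <= n%:R :> R by rewrite ler_nat ltnW.
    have : (r + 3 * eta) * (k : nat)%:R <= (r + 3 * eta) * n%:R.
      by rewrite ler_wpM2l// addr_ge0// mulr_ge0// ltW.
    rewrite /r; lra.
  apply: le_trans h1 _; rewrite [leRHS]mulrDl lerD//.
    rewrite -[leLHS]mulr1 ler_wpM2l// -expR0 ler_expR mulr_ge0// addr_ge0// mulr_ge0// ltW//.
  apply: (@le_trans _ _ ((eta^-1 * expR (eta * n%:R)) * (P * area e v * expR ((r + 3 * eta) * n%:R + 3 * K)))).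
    by rewrite ler_wpM2r ?natr_le_expR// !mulr_ge0 ?expR_ge0// ltW.
  rewrite expRD le_eqVlt; apply/orP; left; apply/eqP.
  have -> : expR ((r + 4 * eta) * n%:R) = expR (eta * n%:R) * expR ((r + 3 * eta) * n%:R).
    by rewrite -expRD; congr expR; ring.
  by rewrite /Q; ring.
have [K' hK'] : exists K', forall n, ln (hnorm (itc n z e)) <= (d - lam + eps) * n%:R + K'.
  apply: (@upper _ _ (area e v * expR (2 * K) + (c0 + Q) * expR K)).
  - exact: indep.
  - have cQ : 0 < c0 + Q by exact: ltr_wpDl.
    by apply: addr_gt0; apply: mulr_gt0; rewrite ?expR_gt0.
  move=> n; have := shear_split A e 0 n v0; rewrite scale0r subr0 sub0r cmodN => h.
  apply: le_trans h _; rewrite [leRHS]mulrDl lerD//.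
    rewrite DE aE [X in X / _]mulrC -!mulrA ler_wpM2l ?area_ge0// -expRN -!expRD ler_expR.
    have /andP[? ?] := ha n; have /andP[? ?] := hD n.
    have p : 0 <= eta * n%:R by rewrite mulr_ge0// ltW.
    rewrite epsE; lra.
  apply: (@le_trans _ _ ((c0 + Q) * expR ((r + 4 * eta) * n%:R) * expR (a n))).
    by rewrite aE ler_wpM2r// expR_ge0.
  rewrite -!mulrA ler_wpM2l ?addr_ge0 ?(ltW Q0)// -!expRD ler_expR.
  have /andP[? ?] := ha n.
  have p : 0 <= eta * n%:R by rewrite mulr_ge0// ltW.
  rewrite epsE /r; lra.
by exists K'.
Qed.

(** When |det A^n| / |A^n v|^2 decays exponentially, [shear] converges to some l,
    and w - l v is the one direction whose component along A^n v stays below the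
    orthogonal part. *)
Lemma exponent_dominated : d - 2 * lam < 0 ->
  exists e : T z, area e v != 0 /\ fwd_exponent e (d - lam).
Proof.
move=> r0; have [w [w1 wv]] := exists_orth v1.
have awv : area w v = 1 by rewrite area_orth// w1 v1 mulr1.
have [P [P0 hP]] := shear_step A cptX.
pose h n := P * expR (D n - 2 * a n).
have [l hl] := @complex_summable_limit _ (shear A v w) h
  (fun n => le_trans (hP _ _ _ _ v0) (eq_ind_r (fun x => P * x <= h n)
     (eq_ind_r (fun x => P * x <= h n) (lexx _) (mul1r _)) (eq_ind_r (fun x => _ * x / _ = _) (gE n 1) awv))).
pose e := w - l *: v.
have ev : area e v != 0 by rewrite area_shear awv oner_neq0.
exists e; split=> //.
apply: average_of_bounds; last exact: lower.
move=> eps eps0.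
pose r := d - 2 * lam.
(* - r / 6 keeps r + 3 eta negative, so that q < 1 *)
pose eta := Num.min (eps / 8) (- r / 6).
have eta0 : 0 < eta by rewrite lt_min; apply/andP; split; rewrite divr_gt0// oppr_gt0.
have etae : eta <= eps / 8 by rewrite ge_min lexx.
have etar : eta <= - r / 6 by rewrite ge_min lexx orbT.
have [K [K0 ha hD]] := bounds eta0.
pose q := expR (r + 3 * eta).
have q0 : 0 < q by exact: expR_gt0.
have rn : r < 0 by [].
have q1 : q < 1 by rewrite -expR0 ltr_expR; lra.
have q1' : 0 < 1 - q by rewrite subr_gt0.
pose C := P * expR (3 * K) / (1 - q).
have C0 : 0 < C by rewrite divr_gt0 ?mulr_gt0 ?expR_gt0.
have lsh n : cmod (l - shear A v w n) <= (C + C) * q ^+ n.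
  rewrite mulrDl; apply: hl => m.
  apply: (@le_trans _ _ (\sum_(n <= k < n + m) P * expR (3 * K) * q ^+ k)).
    apply: ler_sum => k _; rewrite /h -mulrA ler_wpM2l ?(ltW P0)//.
    rewrite /q -expRM_natl -expRD ler_expR.
    have /andP[? ?] := ha k; have /andP[? ?] := hD k.
    rewrite -mulr_natl /r; lra.
  rewrite -mulr_sumr; apply: (@le_trans _ _ (P * expR (3 * K) * (q ^+ n / (1 - q)))).
    by rewrite ler_wpM2l ?geometric_tail// mulr_ge0 ?expR_ge0// ltW.
  by rewrite /C le_eqVlt; apply/orP; left; apply/eqP; ring.
have [K' hK'] : exists K', forall n, ln (hnorm (itc n z e)) <= (d - lam + eps) * n%:R + K'.
  apply: (@upper _ _ (expR (2 * K) + (C + C) * expR K)).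
  - exact: indep.
  - by rewrite addr_gt0 ?mulr_gt0 ?expR_gt0// addr_gt0.
  move=> n; apply: le_trans (shear_split A w l n v0) _; rewrite [leRHS]mulrDl lerD//.
    rewrite awv mulr1 DE aE -expRN -!expRD ler_expR.
    have /andP[? ?] := ha n; have /andP[? ?] := hD n.
    have p : 0 <= eta * n%:R by rewrite mulr_ge0// ltW.
    have p2 : 8 * eta * n%:R <= eps * n%:R by rewrite ler_wpM2r//; lra.
    lra.
  apply: (@le_trans _ _ ((C + C) * q ^+ n * expR (a n))).
    by rewrite aE ler_wpM2r// expR_ge0.
  rewrite -!mulrA ler_wpM2l ?addr_ge0 ?(ltW C0)//.
  rewrite /q -expRM_natl -!expRD ler_expR.
  have /andP[? ?] := ha n.
  have p : 0 <= eta * n%:R by rewrite mulr_ge0// ltW.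
  have p2 : 8 * eta * n%:R <= eps * n%:R by rewrite ler_wpM2r//; lra.
  rewrite /r; lra.
by exists K'.
Qed.

End Exponents.

(** * Regular points and the absence of attractors *)

Section Regular.
Variables (R : realType) (X : ptopologicalType) (TX : hermitian_bundle R X).
Local Notation T := (fibre TX).
Implicit Type A : linear_cocycle TX.
Hypothesis cptX : compact [set: X].

Lemma lgr_inv_sum A n s : birkhoff_sum (smap (inv_cocycle A)) (lgr (inv_cocycle A)) n s =
  - birkhoff_sum (smap (inv_cocycle A)) (lgr A) n (smap (inv_cocycle A) s).
Proof.
rewrite -birkhoff_sumN /birkhoff_sum; apply: eq_bigr => k _.
by rewrite -iterSr iterS -lgr_inv smap_invK.
Qed.

Lemma ldet_inv_sum A n s : birkhoff_sum (smap (inv_cocycle A)) (ldet (inv_cocycle A)) n s =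
  - birkhoff_sum (smap (inv_cocycle A)) (ldet A) n (smap (inv_cocycle A) s).
Proof.
rewrite -birkhoff_sumN /birkhoff_sum; apply: eq_bigr => k _.
by rewrite -iterSr iterS -ldet_inv smap_invK.
Qed.

Lemma absdet_iter_sph A n z (v : T z) (v1 : hnorm v = 1) :
  absdet (iter_cocycle (cocycle_map A) n z) = expR (birkhoff_sum (smap A) (ldet A) n (sph v1)).
Proof. by have := absdet_iter A n (sph v1); rewrite sproj_sph. Qed.

Lemma sum_shift_average (f : sphere TX -> sphere TX) h B s (l : R) :
  (forall t, `|h t| <= B) ->
  (n%:R)^-1 * birkhoff_sum f h n s @[n --> \oo] --> l ->
  (n%:R)^-1 * birkhoff_sum f h n (f s) @[n --> \oo] --> l.
Proof.
move=> hB; apply: (@average_shift _ _ _ _ (B + B)) => n.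
have -> : birkhoff_sum f h n s - birkhoff_sum f h n (f s) = h s - h (iter n f s).
  by have := birkhoff_sumS f h n s; rewrite birkhoff_sumSl => e; lra.
by apply: le_trans (ler_normB _ _) _; rewrite lerD.
Qed.

Lemma lyapunov_exponentE A z (u : T z) l :
  fwd_exponent A u l -> fwd_exponent (inv_cocycle A) u (- l) ->
  lyapunov_exponent A u l.
Proof.
move=> h1 h2; split; first exact: h1.
rewrite (_ : (fun n => _) = (fun n => (n%:R)^-1 * - ln (hnorm
  (iter_cocycle (cocycle_map (inv_cocycle A)) n z u)))).
  by rewrite -[X in _ --> X]opprK; exact: averageN.
by apply: funext => n; rewrite hnorm_cocycleZ_neg invrN mulNr mulrN.
Qed.

Lemma lyapunov_exponent_line A z (v u : T z) l : v != 0 -> u \in <[v]>%VS -> u != 0 ->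
  fwd_exponent A v l -> fwd_exponent (inv_cocycle A) v (- l) ->
  lyapunov_exponent A u l.
Proof.
move=> v0 /vlineP[c ->]; rewrite scaler_eq0 negb_or => /andP[c0 _] h1 h2.
by apply: lyapunov_exponentE; exact: fwd_exponentZ.
Qed.

Lemma line_splitting_area z (u v : T z) : area u v != 0 ->
  line_splitting <[u]>%VS <[v]>%VS.
Proof.
move=> uv.
have u0 : u != 0.
  by apply: contra uv => /eqP ->; rewrite /area /det2 !linear0 !mul0r subrr cmod0.
have v0 : v != 0.
  by apply: contra uv => /eqP ->; rewrite /area /det2 !linear0 !mulr0 subrr cmod0.
have cap : (<[u]> :&: <[v]> = 0)%VS.
  apply/eqP; rewrite -subv0; apply/subvP => x; rewrite memv_cap => /andP[/vlineP[c ->] hv].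
  rewrite memv0; have [->|c0] := eqVneq c 0; first by rewrite scale0r.
  have : area u v == 0.
    rewrite area_eq0//; have := memvZ c^-1 hv; rewrite scalerA mulVf// scale1r //.
  by rewrite (negPf uv).
have dimuv : \dim (<[u]> + <[v]>) = 2%N.
  by rewrite dimv_disjoint_sum// !dim_vline u0 v0.
split; rewrite ?dim_vline ?u0 ?v0//.
by apply/eqP; rewrite eqEdim subvf dim_fibre dimuv.
Qed.

(** A vector [v] with the same averages in both time directions gives a second
    direction with exponent [l2 - l1] in both of them.  The quotient
    |det A^n| / |A^n v|^2 cannot decay in both time directions: in the direction in
    which it decays [exponent_dominated] selects the second vector, and in the
    other one [exponent_dominant] applies to any vector. *)
Theorem oseledets A z (v : T z) (v1 : hnorm v = 1) (l1 l2 : R) :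
  let f := smap A in let f' := smap (inv_cocycle A) in let s := sph v1 in
  (n%:R)^-1 * birkhoff_sum f (lgr A) n s @[n --> \oo] --> l1 ->
  (n%:R)^-1 * birkhoff_sum f' (lgr A) n s @[n --> \oo] --> l1 ->
  (n%:R)^-1 * birkhoff_sum f (ldet A) n s @[n --> \oo] --> l2 ->
  (n%:R)^-1 * birkhoff_sum f' (ldet A) n s @[n --> \oo] --> l2 ->
  regular_with A z (Num.min l1 (l2 - l1)) (Num.max l1 (l2 - l1)).
Proof.
move=> f f' s a1 a2 a3 a4.
have [B [_ hB]] := lgr_bounded A cptX.
have [B' hB'] := ldet_bounded A cptX.
have lP : fwd_exponent A v l1.
  rewrite /fwd_exponent; under eq_fun do rewrite (hnorm_iter A _ v1) expRK.
  exact: a1.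
have lN : fwd_exponent (inv_cocycle A) v (- l1).
  rewrite /fwd_exponent; under eq_fun do rewrite (hnorm_iter (inv_cocycle A) _ v1) expRK lgr_inv_sum.
  by apply: averageN; exact: sum_shift_average a2.
have dP : (n%:R)^-1 * ln (absdet (iter_cocycle (cocycle_map A) n z)) @[n --> \oo] --> l2.
  under eq_fun do rewrite (absdet_iter_sph A _ v1) expRK.
  exact: a3.
have dN : (n%:R)^-1 * ln (absdet (iter_cocycle (cocycle_map (inv_cocycle A)) n z))
    @[n --> \oo] --> - l2.
  under eq_fun do rewrite (absdet_iter_sph (inv_cocycle A) _ v1) expRK ldet_inv_sum.
  by apply: averageN; exact: sum_shift_average a4.
have v0 : v != 0 by rewrite -hnorm_gt0 v1.
have [e [ev eP eN]] : exists e : T z, [/\ area e v != 0,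
    fwd_exponent A e (l2 - l1) & fwd_exponent (inv_cocycle A) e (- (l2 - l1))].
  have eE : - (l2 - l1) = - l2 - - l1 by ring.
  have [r0|r0] := ltP (l2 - 2 * l1) 0.
    have [e [ev eP]] := exponent_dominated cptX v1 lP dP r0.
    exists e; split=> //; rewrite eE.
    have r0' : 0 <= - l2 - 2 * - l1 by lra.
    exact: (exponent_dominant cptX v1 lN dN r0' ev).
  have [r1|r1] := ltP (- l2 - 2 * - l1) 0.
    have [e [ev eN]] := exponent_dominated cptX v1 lN dN r1.
    exists e; split=> //; rewrite ?eE//.
    exact: (exponent_dominant cptX v1 lP dP r0 ev).
  have [w [w1 wv]] := exists_orth v1.
  have awv : area w v != 0 by rewrite area_orth// w1 v1 mulr1 oner_neq0.
  exists w; split=> //; first exact: (exponent_dominant cptX v1 lP dP r0 awv).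
  by rewrite eE; exact: (exponent_dominant cptX v1 lN dN r1 awv).
have e0 : e != 0.
  by apply: contra ev => /eqP ->; rewrite /area /det2 !linear0 !mul0r subrr cmod0.
split; first by rewrite le_max ge_min lexx.
have [h|h] := leP l1 (l2 - l1).
  exists <[v]>%VS, <[e]>%VS; split.
  - by apply: line_splitting_area; rewrite areaC.
  - by move=> u uv u0; exact: (lyapunov_exponent_line v0).
  - by move=> u ue u0; exact: (lyapunov_exponent_line e0).
exists <[e]>%VS, <[v]>%VS; split.
- exact: line_splitting_area.
- by move=> u ue u0; exact: (lyapunov_exponent_line e0).
- by move=> u uv u0; exact: (lyapunov_exponent_line v0).
Qed.

End Regular.

Section NoAttractors.
Variables (R : realType) (X : ptopologicalType) (TX : hermitian_bundle R X).
Local Notation T := (fibre TX).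
Local Notation S := (sphere TX).
Variable A : linear_cocycle TX.
Hypothesis cptX : compact [set: X].
Hypothesis hausX : hausdorff_space X.
Hypothesis noA : no_attractors A.

Lemma invariant_measure_inv (mu : probability (g_sigma_algebraType (@open X)) R) :
  invariant_measure (base_inv A) mu -> invariant_measure (base A) mu.
Proof.
move=> inv B mB; rewrite -[LHS]inv.
  by congr (mu _); apply/seteqP; split=> x /=; rewrite base_invK.
have := continuous_borel (@base_continuous _ _ _ A) measurableT mB.
by rewrite setTI.
Qed.

(** The backward averages are those of the functions of [A], not of its inverse:
    this is what a two-sided ergodic theorem yields, and the shift and the change
    of sign between the two are harmless. *)
Definition birkhoff_regular (y : S) (l1 l2 : R) :=
  [/\ (n%:R)^-1 * birkhoff_sum (smap A) (lgr A) n y @[n --> \oo] --> l1,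
      (n%:R)^-1 * birkhoff_sum (smap (inv_cocycle A)) (lgr A) n y @[n --> \oo] --> l1,
      (n%:R)^-1 * birkhoff_sum (smap A) (ldet A) n y @[n --> \oo] --> l2 &
      (n%:R)^-1 * birkhoff_sum (smap (inv_cocycle A)) (ldet A) n y @[n --> \oo] --> l2].

Lemma birkhoff_regular_exponents y l1 l2 (mu : probability (g_sigma_algebraType (@open X)) R) :
  birkhoff_regular y l1 l2 -> invariant_measure (base A) mu -> msupport mu (sproj y) ->
  [/\ Num.min l1 (l2 - l1) < 0, 0 <= Num.max l1 (l2 - l1) &
    regular_with A (sproj y) (Num.min l1 (l2 - l1)) (Num.max l1 (l2 - l1))].
Proof.
have [z [v [v1 ->]]] := sph_surj y; rewrite sproj_sph => -[a1 a2 a3 a4] imu sz.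
have reg := oseledets cptX a1 a2 a3 a4.
by have [h1 h2] := noA imu sz reg; split.
Qed.

(** The form in which the absence of attractors is used: positive frequency of
    visits to a closed set produces a regular point that is not contracted, with a
    unit vector over it in that set. *)
Theorem fwd_regular_point (p : S) (Q : set S) (c : R) : closed Q -> 0 < c ->
  (\forall n \near \oo, c <= visit_freq R (smap A) p Q n) ->
  exists y, Q y /\ exists l1 l2, [/\ birkhoff_regular y l1 l2,
    Num.min l1 (l2 - l1) < 0, 0 <= Num.max l1 (l2 - l1) &
    regular_with A (sproj y) (Num.min l1 (l2 - l1)) (Num.max l1 (l2 - l1))].
Proof.
move=> cQ c0 hQ.
have [mu imu [y [Qy sy [l1 [l2 [a1 a2 a3 a4]]]]]] :=
  @generic_point R X S (sphere_compact cptX) (sphere_hausdorff hausX)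
  (smap A) (smap (inv_cocycle A)) (@sproj _ _ TX) (base A) (@smapK _ _ _ A) (@smap_invK _ _ _ A)
  (@smap_continuous _ _ _ A) (@smap_continuous _ _ _ (inv_cocycle A))
  (@sproj_continuous _ _ TX) (@sproj_smap _ _ _ A)
  p Q c (lgr A) (ldet A) (@lgr_continuous _ _ _ A) (@ldet_continuous _ _ _ A) cQ c0 hQ.
exists y; split=> //; exists l1, l2.
have g : birkhoff_regular y l1 l2 := And4 a1 a2 a3 a4.
by have [h1 h2 h3] := birkhoff_regular_exponents g imu sy.
Qed.

(** The version of [fwd_regular_point] for backward orbits; a measure invariant
    under the inverse is invariant, so the same exponents occur. *)
Theorem bwd_regular_point (p : S) (Q : set S) (c : R) : closed Q -> 0 < c ->
  (\forall n \near \oo, c <= visit_freq R (smap (inv_cocycle A)) p Q n) ->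
  exists y, Q y /\ exists l1 l2, [/\ birkhoff_regular y l1 l2,
    Num.min l1 (l2 - l1) < 0, 0 <= Num.max l1 (l2 - l1) &
    regular_with A (sproj y) (Num.min l1 (l2 - l1)) (Num.max l1 (l2 - l1))].
Proof.
move=> cQ c0 hQ.
have [mu imu [y [Qy sy [l1 [l2 [a1 a2 a3 a4]]]]]] :=
  @generic_point R X S (sphere_compact cptX) (sphere_hausdorff hausX)
  (smap (inv_cocycle A)) (smap A) (@sproj _ _ TX) (base_inv A) (@smap_invK _ _ _ A) (@smapK _ _ _ A)
  (@smap_continuous _ _ _ (inv_cocycle A)) (@smap_continuous _ _ _ A)
  (@sproj_continuous _ _ TX) (@sproj_smap _ _ _ (inv_cocycle A))
  p Q c (lgr A) (ldet A) (@lgr_continuous _ _ _ A) (@ldet_continuous _ _ _ A) cQ c0 hQ.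
exists y; split=> //; exists l1, l2.
have g : birkhoff_regular y l1 l2 := And4 a2 a1 a4 a3.
by have [h1 h2 h3] := birkhoff_regular_exponents g (invariant_measure_inv imu) sy.
Qed.

End NoAttractors.

(** * A lemma of Pliss and nested compact sets *)

Section PlissLemma.
Variable R : realType.

(** The maximum M n of [f] over [n, +oo) decreases from a nonnegative value to
    at most C - a n, and it drops between n and n + 1 only if n is one of the
    counted times, and then by at most [B]. *)
Lemma pliss (f : nat -> R) (C a B : R) : 0 < a -> 0 < B ->
  (forall n, f n <= C - a * n%:R) -> 0 <= f 0%N -> (forall n, f n - f n.+1 <= B) ->
  forall n, a * n%:R - C <= B * (\sum_(k < n) (`[< forall j, f (k + j)%N <= f k >])%:R).
Proof.
move=> a0 B0 fC f0 fB.
(* f tends to -oo, so that only finitely many times compete *)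
have att n : exists k, (n <= k)%N /\ forall j, (n <= j)%N -> f j <= f k.
  have [N hN] := natr_unbounded ((C - f n) / a).
  have far j : (N <= j)%N -> f j <= f n.
    move=> Nj; apply: le_trans (fC j) _; rewrite lerBlDl -lerBlDr.
    rewrite mulrC -ler_pdivrMr//; apply: le_trans (ltW hN) _; by rewrite ler_nat.
  have [i hi] : exists i : 'I_N.+1, forall j : 'I_N.+1, f (n + j)%N <= f (n + i)%N.
    case: (@Order.TotalTheory.arg_maxP _ _ _ (ord0 : 'I_N.+1) xpredT
      (fun j : 'I_N.+1 => f (n + j)%N) isT) => i _ hi.
    by exists i => j; exact: hi.
  exists (n + i)%N; split=> [|j nj]; first exact: leq_addr.
  have [jN|jN] := ltnP (j - n) N.+1.
    by have := hi (Ordinal jN); rewrite /= subnKC.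
  apply: (@le_trans _ _ (f n)); last by have := hi ord0; rewrite /= addn0.
  by apply: far; apply: leq_trans (leq_subr n j); exact: ltnW.
have /choice[K hK] := att.
pose M n := f (K n).
have Mge n j : (n <= j)%N -> f j <= M n by move=> nj; have [_] := hK n; exact.
pose good k := `[< forall j, f (k + j)%N <= f k >].
have step n : M n - M n.+1 <= B * (good n)%:R.
  have [nK hKn] := hK n.
  move: nK; rewrite leq_eqVlt => /orP[/eqP nK|nK]; last first.
    have : M n <= M n.+1 by apply: Mge.
    have : 0 <= B * (good n)%:R by rewrite mulr_ge0// ltW.
    lra.
  have gn : good n by apply/asboolP => j; rewrite {2}nK; apply: hKn; exact: leq_addr.
  rewrite gn mulr1; have := Mge n.+1 n.+1 (leqnn _); have := fB n.
  by rewrite /M -nK; lra.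
have tot n : M 0%N - M n <= B * \sum_(k < n) (good k)%:R.
  elim: n => [|n IH]; first by rewrite big_ord0 mulr0 subrr.
  rewrite big_ord_recr/= mulrDr; have := step n; lra.
move=> n; apply: le_trans (tot n).
have h1 : M n <= C - a * n%:R.
  apply: le_trans (fC _) _; rewrite lerD2l lerN2 ler_wpM2l ?(ltW a0)// ler_nat.
  by have [] := hK n.
have h2 := le_trans f0 (Mge 0%N 0%N (leqnn _)); lra.
Qed.

Lemma exp_decay_le0 (x K s : R) : 0 < s -> (forall n : nat, x <= expR (K - s * n%:R)) -> x <= 0.
Proof.
move=> s0 h; rewrite leNgt; apply/negP => x0.
have [n hn] := natr_unbounded ((K - ln x) / s).
have := h n; rewrite -ler_ln ?posrE ?expR_gt0// expRK.
by move: hn; rewrite ltr_pdivrMr//; lra.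
Qed.

End PlissLemma.

Section Compactness.
Variable Y : topologicalType.

Lemma compact_nested (C : nat -> set Y) : compact [set: Y] ->
  (forall n, closed (C n)) -> (forall n, C n !=set0) ->
  (forall n, C n.+1 `<=` C n) -> exists y, forall n, C n y.
Proof.
move=> cY cC C0 Cd.
have mono n k : C (n + k)%N `<=` C n.
  by elim: k => [|k IH]; rewrite ?addn0// addnS; exact: subset_trans (Cd _) IH.
have [p hp] := choice C0.
have [|y [_ cy]] := cY (p @ \oo) _; first exact: filterT.
exists y => n; rewrite ((closure_id (C n)).1 (cC n)) => B By.
apply: (cy (C n) B) => //.
by exists n => // k /= nk; have := hp k; rewrite -(subnKC nk); exact: mono.
Qed.

Lemma closed_le_fun (R : realType) (h : Y -> R) (c : R) : continuous h ->
  closed [set y | h y <= c].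
Proof.
by move=> ch; apply: (@closed_comp Y R h [set x | x <= c]) => [x _|];
  [exact: ch|exact: closed_le].
Qed.

Lemma closed_ge_fun (R : realType) (h : Y -> R) (c : R) : continuous h ->
  closed [set y | c <= h y].
Proof.
by move=> ch; apply: (@closed_comp Y R h [set x | c <= x]) => [x _|];
  [exact: ch|exact: closed_ge].
Qed.

Lemma closed_forall (I : Type) (C : I -> set Y) : (forall i, closed (C i)) ->
  closed [set y | forall i, C i y].
Proof.
move=> cC; have -> : [set y | forall i, C i y] = \bigcap_i C i.
  by apply/seteqP; split=> y h i => [_|]; exact: h.
by apply: closed_bigI => i _; exact: cC.
Qed.

Lemma birkhoff_sum_continuous (R : realType) (f : Y -> Y) (h : Y -> R) n :
  continuous f -> continuous h -> continuous (birkhoff_sum f h n).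
Proof.
move=> cf ch; elim: n => [|n IH].
  rewrite (_ : birkhoff_sum f h 0 = cst 0); first exact: cst_continuous.
  by apply: funext => y; rewrite birkhoff_sum0.
rewrite (_ : birkhoff_sum f h n.+1 = (fun y => h y + birkhoff_sum f h n (f y))).
  move=> y; apply: cvgD; first exact: ch.
  exact: (@continuous_comp Y Y R f (birkhoff_sum f h n) y (cf y) (IH (f y))).
by apply: funext => y; rewrite birkhoff_sumSl.
Qed.

End Compactness.

(** * The projective derivative *)

Section ProjectiveDerivative.
Variables (R : realType) (X : ptopologicalType) (TX : hermitian_bundle R X).
Local Notation T := (fibre TX).
Local Notation S := (sphere TX).
Implicit Type A : linear_cocycle TX.
Local Notation itc A := (iter_cocycle (cocycle_map A)).

(** ln g(1, .), whose Birkhoff sums [lng A n] are ln g(n, .). *)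
Definition gam A (s : S) : R := ldet A s - 2 * lgr A s.
Definition lng A n (s : S) : R := birkhoff_sum (smap A) (gam A) n s.

Lemma gam_continuous A : continuous (gam A).
Proof.
move=> s; have h1 := @ldet_continuous _ _ _ A s; have h2 := @lgr_continuous _ _ _ A s.
exact: (cvgB h1 (cvgM (cvg_cst (2 : R)) h2)).
Qed.

Lemma lng_continuous A n : continuous (lng A n).
Proof. by apply: birkhoff_sum_continuous; [exact: smap_continuous|exact: gam_continuous]. Qed.

Lemma lngE A n s : lng A n s =
  birkhoff_sum (smap A) (ldet A) n s - 2 * birkhoff_sum (smap A) (lgr A) n s.
Proof. by rewrite /lng /gam birkhoff_sumD birkhoff_sumN birkhoff_sumZ. Qed.

Lemma lng_add A n k s : lng A (n + k) s = lng A n s + lng A k (iter n (smap A) s).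
Proof. exact: birkhoff_sum_add. Qed.

Lemma gam_inv A s : gam (inv_cocycle A) (smap A s) = - gam A s.
Proof. by rewrite /gam lgr_inv ldet_inv; ring. Qed.

(** Forward and backward derivatives along an orbit are mutually inverse; every
    backward estimate on g below is a forward one seen from the other end. *)
Lemma lng_inv A n s : lng (inv_cocycle A) n (iter n (smap A) s) = - lng A n s.
Proof.
elim: n => [|n IH]; first by rewrite /lng !birkhoff_sum0 oppr0.
rewrite /lng in IH *; rewrite birkhoff_sumSl [in LHS]iterS gam_inv smapK IH birkhoff_sumS.
by rewrite -opprD [X in _ = - X]addrC.
Qed.

Lemma iter_smapK A n s : iter n (smap (inv_cocycle A)) (iter n (smap A) s) = s.
Proof. by elim: n => //= n IH; rewrite -iterS iterSr smapK IH. Qed.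

Lemma iter_smap_invK A n s : iter n (smap A) (iter n (smap (inv_cocycle A)) s) = s.
Proof. by elim: n => //= n IH; rewrite -iterS iterSr smap_invK IH. Qed.

Lemma gfun_pos A n z (xi : P1 TX z) (v : T z) (v1 : hnorm v = 1) : v \in val xi ->
  gfun A n%:Z xi = expR (lng A n (sph v1)).
Proof.
move=> vxi; rewrite (gfunE _ _ vxi v1) lngE expRB.
rewrite hnorm_cocycleZ_pos (hnorm_iter A n v1).
have -> : absdet (cocycleZ A n z) = absdet (itc A n z) by [].
by rewrite (absdet_iter_sph A n v1) expr2 -expRD -mulr2n mulr_natl.
Qed.

Lemma gfun_neg A n z (xi : P1 TX z) (v : T z) (v1 : hnorm v = 1) : v \in val xi ->
  gfun A (- n%:Z) xi = expR (lng (inv_cocycle A) n (sph v1)).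
Proof.
move=> vxi; rewrite (gfunE _ _ vxi v1) lngE expRB hnorm_cocycleZ_neg absdet_cocycleZ_neg.
rewrite (hnorm_iter (inv_cocycle A) n v1) (absdet_iter_sph (inv_cocycle A) n v1).
by rewrite expr2 -expRD -mulr2n mulr_natl.
Qed.

Lemma CritP A (bm bp : R) x : 0 < bp -> 0 < bm ->
  Crit A bm bp x <-> exists s : S, sproj s = x /\ forall n,
    ln bp * n%:R <= lng A n s /\ - ln bm * n%:R <= lng (inv_cocycle A) n s.
Proof.
move=> bp0 bm0.
have e1 n y : (bp ^+ n <= expR y) = (ln bp * n%:R <= y).
  by rewrite -[X in X ^+ _](@lnK _ bp) ?posrE// -expRM_natl ler_expR mulrC.
have e2 n y : (bm ^- n <= expR y) = (- ln bm * n%:R <= y).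
  rewrite -[X in X ^- _](@lnK _ bm) ?posrE// -expRM_natl -expRN ler_expR.
  by rewrite mulNr mulrC.
split=> [[xi h]|[s [<- h]]].
  have [vxi v1] := unit_vecP xi; exists (sph v1); rewrite sproj_sph; split=> // n.
  have [h1 h2] := h n; rewrite (gfun_pos A n v1 vxi) e1 in h1.
  by rewrite (gfun_neg A n v1 vxi) e2 in h2; split.
have [z [v [v1 sE]]] := sph_surj s.
have zE : sproj s = z by rewrite sE sproj_sph.
rewrite zE; have v0 : v != 0 by rewrite -hnorm_gt0 v1.
have dv : \dim <[v]>%VS == 1%N by rewrite dim_vline v0.
exists (exist _ <[v]>%VS dv) => n; have [h1 h2] := h n.
rewrite (@gfun_pos _ _ _ (exist _ <[v]>%VS dv) v v1) ?memv_line// e1 -sE.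
by rewrite (@gfun_neg _ _ _ (exist _ <[v]>%VS dv) v v1) ?memv_line// e2 -sE.
Qed.

Lemma sum_ldet_fibre A n (p q : S) : sproj p = sproj q ->
  birkhoff_sum (smap A) (ldet A) n p = birkhoff_sum (smap A) (ldet A) n q.
Proof.
move=> pq; apply: expR_inj.
by have := absdet_iter A n p; rewrite pq => h; exact: etrans (esym h) (absdet_iter A n q).
Qed.

(** Divide by |det A^n| the inequality area(A^n u, A^n v) <= |A^n u| |A^n v|. *)
Lemma area_lng A n z (u v : T z) (u1 : hnorm u = 1) (v1 : hnorm v = 1) :
  area u v <= expR (- ((lng A n (sph u1) + lng A n (sph v1)) / 2)).
Proof.
have := area_le (itc A n z u) (itc A n z v).
rewrite area_hom (hnorm_iter A n u1) (hnorm_iter A n v1) (absdet_iter_sph A n u1) !lngE.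
have -> : birkhoff_sum (smap A) (ldet A) n (sph v1) = birkhoff_sum (smap A) (ldet A) n (sph u1).
  by apply: sum_ldet_fibre; rewrite !sproj_sph.
set D := birkhoff_sum _ _ _ _; move: (birkhoff_sum _ _ _ _) (birkhoff_sum _ _ _ _) => x y h.
rewrite -(ler_pM2l (expR_gt0 D)); apply: le_trans h _.
by rewrite -!expRD ler_expR; lra.
Qed.

(** By [area_lng] the area of [u] and [v] is at most a quantity that tends to
    zero. *)
Lemma collinear_of_lng A z (u v : T z) (u1 : hnorm u = 1) (v1 : hnorm v = 1) (s K : R) :
  0 < s -> (forall n : nat, s * n%:R - K <= lng A n (sph u1)) ->
  (forall n : nat, s * n%:R - K <= lng A n (sph v1)) -> u \in <[v]>%VS.
Proof.
move=> s0 hu hv; rewrite -area_eq0 -?hnorm_gt0 ?v1// eq_le area_ge0 andbT.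
apply: (@exp_decay_le0 _ _ K s s0) => n; apply: le_trans (area_lng A n u1 v1) _.
by rewrite ler_expR; have := hu n; have := hv n; lra.
Qed.

End ProjectiveDerivative.

Section LineNorm.
Variables (R : realType) (X : topologicalType) (TX : hermitian_bundle R X).
Local Notation T := (fibre TX).

Lemma restr_normE z w (L : 'Hom(T z, T w)) (E : {vspace T z}) (e : T z) :
  \dim E = 1%N -> e \in E -> hnorm e = 1 -> restr_norm L E = hnorm (L e).
Proof.
move=> dE eE e1; have e0 : e != 0 by rewrite -hnorm_gt0 e1.
have EE : E = <[e]>%VS.
  by apply/esym/eqP; rewrite eqEdim -memvE eE dim_vline e0 dE.
rewrite /restr_norm (_ : [set _ | v in _] = [set hnorm (L e)]) ?sup1//.
apply/seteqP; split=> [_ [v [vE v1] <-]|_ ->]; last by exists e.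
have /vlineP[c vc] : v \in <[e]>%VS by rewrite -EE.
have c1 : cmod c = 1 by move: v1; rewrite vc hnormZc e1 mulr1.
by rewrite vc linearZ/= hnormZc c1 mul1r.
Qed.

Lemma line_unit_vec z (E : {vspace T z}) : \dim E = 1%N ->
  exists e : T z, e \in E /\ hnorm e = 1.
Proof.
move=> /eqP dE; exists (unit_vec (exist _ E dE : P1 TX z)).
exact: (unit_vecP (exist _ E dE : P1 TX z)).
Qed.

End LineNorm.

(** * Domination excludes critical points *)

Section LineFields.
Variables (R : realType) (X : ptopologicalType) (TX : hermitian_bundle R X).
Local Notation T := (fibre TX).
Local Notation S := (sphere TX).
Variable A : linear_cocycle TX.

Definition in_line (E : forall z, {vspace T z}) (s : S) : Prop :=
  tvec (svec s) \in E (sproj s).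

Lemma in_line_sph E z (v : T z) (v1 : hnorm v = 1) : in_line E (sph v1) <-> v \in E z.
Proof. by rewrite /in_line /sproj svec_sph /tvec /tbase /pt packK. Qed.

Lemma smap_sph z (v : T z) (v1 : hnorm v = 1) :
  exists a, a != 0 /\ exists u1 : hnorm (a *: cocycle_map A z v) = 1,
    smap A (sph v1) = sph u1.
Proof.
have a0 : 0 < hnorm (cocycle_map A z v).
  by rewrite -tnorm_pt -tmapE -(svec_sph v1); exact: stretch_gt0.
have u1 : hnorm (rc (hnorm (cocycle_map A z v))^-1 *: cocycle_map A z v) = 1.
  by rewrite hnormZc cmodR ger0_norm ?invr_ge0 ?hnorm_ge0// mulVf// gt_eqF.
exists (rc (hnorm (cocycle_map A z v))^-1); split.
  by rewrite rc_eq0 invr_eq0 gt_eqF.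
exists u1; apply: svec_inj; rewrite svec_smap svec_sph tmapE tscale_pt /stretch !svec_sph.
by rewrite (tmapE A v) tnorm_pt.
Qed.

Lemma in_line_smap E s : (forall z, (cocycle_map A z @: E z)%VS = E (base A z)) ->
  in_line E (smap A s) <-> in_line E s.
Proof.
move=> invE; have [z [v [v1 ->]]] := sph_surj s.
have [a [a0 [u1 ->]]] := smap_sph v1.
rewrite !in_line_sph -invE; split=> [h|vE]; last by rewrite memvZ// memv_img.
have := memvZ a^-1 h; rewrite scalerA mulVf// scale1r => /memv_imgP[w wE].
move=> /eqP; rewrite -subr_eq0 -linearB => /eqP/cocycle_map_eq0/eqP.
by rewrite subr_eq0 => /eqP ->.
Qed.

Lemma in_line_iter E n s : (forall z, (cocycle_map A z @: E z)%VS = E (base A z)) ->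
  in_line E (iter n (smap A) s) <-> in_line E s.
Proof. by move=> invE; elim: n => //= n IH; rewrite in_line_smap. Qed.

Lemma norm_back z n (v : T z) :
  hnorm (cocycleZ A (- n%:Z) (baseZ A n z) (iter_cocycle (cocycle_map A) n z v)) = hnorm v.
Proof.
have h : forall m z (v : T z), iter m (total_map (cocycle_map A)) (pt v) = pt (iter_cocycle (cocycle_map A) m z v).
  elim=> [|m IH] y w; first by rewrite /= id_lfunE.
  by rewrite iterS IH tmapE /= comp_lfunE.
have h' : forall m y (w : T y), iter m (total_map (cocycle_map (inv_cocycle A))) (pt w) =
    pt (iter_cocycle (cocycle_map (inv_cocycle A)) m y w).
  elim=> [|m IH] y w; first by rewrite /= id_lfunE.
  by rewrite iterS IH tmapE /= comp_lfunE.
rewrite hnorm_cocycleZ_neg -tnorm_pt -h' -(tnorm_pt v) -h; congr tnorm.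
by elim: n => //= n IH; rewrite -iterS iterSr tmap_inv.
Qed.

Lemma restr_norm_back (F : forall z, {vspace T z}) l z (v : T z) :
  (forall z, \dim (F z) = 1%N) ->
  (forall z, (cocycle_map A z @: F z)%VS = F (base A z)) ->
  v \in F z -> hnorm v = 1 ->
  restr_norm (cocycleZ A (- l%:Z) (baseZ A l z)) (F (baseZ A l z)) =
  (hnorm (iter_cocycle (cocycle_map A) l z v))^-1.
Proof.
move=> dF invF vF v1; set a := hnorm _.
have a0 : 0 < a by rewrite hnorm_gt0 itc_eq0 -hnorm_gt0 v1.
pose u : T (baseZ A l z) := rc a^-1 *: iter_cocycle (cocycle_map A) l z v.
have u1 : hnorm u = 1.
  by rewrite hnormZc cmodR ger0_norm ?invr_ge0 ?ltW// mulVf// gt_eqF.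
have itF n : iter_cocycle (cocycle_map A) n z v \in F (iter n (base A) z).
  elim: n => [|n IH]; first by rewrite /= id_lfunE.
  by rewrite /= comp_lfunE -invF memv_img.
have uF : u \in F (baseZ A l z) by rewrite memvZ// itF.
rewrite (restr_normE _ (dF _) uF u1) /u linearZ/= hnormZc norm_back v1 mulr1.
by rewrite cmodR ger0_norm// invr_ge0 ltW.
Qed.

End LineFields.

Section DominatedNoCritical.
Variables (R : realType) (X : ptopologicalType) (TX : hermitian_bundle R X).
Local Notation T := (fibre TX).
Local Notation S := (sphere TX).
Variable A : linear_cocycle TX.
Hypothesis cptX : compact [set: X].
Local Notation itc := (iter_cocycle (cocycle_map A)).
Local Notation Sl := (birkhoff_sum (smap A) (lgr A)).
Variables (E F : forall z, {vspace T z}) (l : nat).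
Hypothesis EF : forall z, line_splitting (E z) (F z).
Hypothesis invE : forall z, (cocycle_map A z @: E z)%VS = E (base A z).
Hypothesis invF : forall z, (cocycle_map A z @: F z)%VS = F (base A z).
Hypothesis l1 : (1 <= l)%N.
Hypothesis dom : forall z, restr_norm (cocycleZ A l z) (E z) *
  restr_norm (cocycleZ A (- l%:Z) (baseZ A l z)) (F (baseZ A l z)) < 1 / 2.

Lemma domination_step z (e v : T z) : e \in E z -> v \in F z -> hnorm e = 1 ->
  hnorm v = 1 -> hnorm (itc l z e) < 1 / 2 * hnorm (itc l z v).
Proof.
move=> eE vF e1 v1; have [dE _ _ _] := EF z.
have dF y : \dim (F y) = 1%N by have [] := EF y.
have av : 0 < hnorm (itc l z v) by rewrite hnorm_gt0 itc_eq0 -hnorm_gt0 v1.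
have := dom z; rewrite (restr_normE _ dE eE e1) (restr_norm_back _ dF invF vF v1).
by rewrite hnorm_cocycleZ_pos ltr_pdivrMr.
Qed.

Lemma domination_sum (q p : S) : in_line E q -> in_line F p -> sproj q = sproj p ->
  Sl l q - Sl l p <= - ln 2.
Proof.
have [z [e [e1 ->]]] := sph_surj q; have [y [v [v1 ->]]] := sph_surj p.
rewrite !in_line_sph !sproj_sph => eE vF zy; move: v v1 vF; rewrite -{y}zy => v v1 vF.
have := domination_step eE vF e1 v1.
rewrite !hnorm_iter -ltr_ln ?posrE ?mulr_gt0 ?expR_gt0//.
rewrite lnM ?posrE ?expR_gt0// !expRK mul1r lnV ?posrE//; lra.
Qed.

(** Were e close to v, then A^l e would be close to a multiple of A^l v of norm
    about |A^l v|, against |A^l e| < |A^l v| / 2. *)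
Lemma angle_bound : exists a0, 0 < a0 /\ forall z (e v : T z), e \in E z -> v \in F z ->
  hnorm e = 1 -> hnorm v = 1 -> a0 <= area e v.
Proof.
have [B [B0 hB]] := lgr_bounded A cptX.
pose M := expR (B * l%:R).
have M1 : 1 <= M by rewrite -expR0 ler_expR mulr_ge0.
have M0 : 0 < M by exact: expR_gt0.
have hM z (u : T z) : hnorm u = 1 -> hnorm (itc l z u) <= M /\ M^-1 <= hnorm (itc l z u).
  move=> u1; rewrite (hnorm_iter A l u1).
  have := birkhoff_sum_norm (smap A) l (sph u1) hB; rewrite ler_norml => /andP[h1 h2].
  by rewrite /M -expRN !ler_expR; split.
(* this bound on a = area e v ensures a <= 1 / 4 and M a < |A^l v| / 4, because
   |A^l v| >= 1 / M *)
exists ((4 * M ^+ 2)^-1); split; first by rewrite invr_gt0 mulr_gt0// exprn_gt0.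
move=> z e v eE vF e1 v1; rewrite leNgt; apply/negP => small.
have dstep := domination_step eE vF e1 v1.
pose c := herm TX z e v; pose w := e - c *: v.
have vv : herm TX z v v = 1 by rewrite -hermE v1 expr1n.
have wv : herm TX z w v = 0.
  by rewrite /w linearBl/= linearZl_LR/= vv mulr1 subrr.
have wn : hnorm w = area e v.
  by rewrite -(area_shear c e v) -/w (area_orth wv) v1 mulr1.
have cn : 1 - area e v <= cmod c.
  have := ler_hnormD w (c *: v); rewrite /w subrK -/w e1 hnormZc v1 mulr1 wn; lra.
have [hv1 hv2] := hM z v v1.
have hw : hnorm (itc l z w) <= M * area e v.
  have [->|/unit_decomp[w' [w'1 wE]]] := eqVneq w 0.
    by rewrite linear0 hnorm0 mulr_ge0 ?area_ge0// ltW.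
  rewrite wE linearZ/= hnormZc cmodR ger0_norm ?hnorm_ge0// wn mulrC.
  by rewrite ler_wpM2r ?area_ge0//; have [] := hM z w' w'1.
have low : cmod c * hnorm (itc l z v) <= hnorm (itc l z e) + M * area e v.
  have eE' : c *: itc l z v = itc l z e - itc l z w.
    by rewrite /w linearB linearZ/= subKr.
  rewrite -hnormZc eE'; apply: le_trans (ler_hnormB _ _) _.
  by rewrite lerD2l.
set x := hnorm (itc l z v) in dstep hv1 hv2 low; set y := hnorm (itc l z e) in dstep low.
set a := area e v in small cn low hw wn.
have a_ge0 : 0 <= a by exact: area_ge0.
have s1 : a * (4 * M ^+ 2) < 1.
  by rewrite -ltr_pdivlMr ?mulr_gt0 ?exprn_gt0// mul1r.
have s2 : a * 4 <= a * (4 * M ^+ 2).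
  by rewrite ler_wpM2l// ler_peMr// expr_ge1// ltW.
have x0 : 0 < x by apply: lt_le_trans hv2; rewrite invr_gt0.
have xM : 1 <= x * M by rewrite -ler_pdivrMr// mul1r.
have k1 : (1 - a) * x <= cmod c * x by rewrite ler_wpM2r// ltW.
have k2 : M * a < x / 4.
  have : M * (a * (4 * M ^+ 2)) < M by rewrite -[ltRHS]mulr1 ltr_pM2l.
  have : M <= x * M ^+ 2 by rewrite expr2 mulrA ler_peMl// ltW.
  have M2 : 0 < M ^+ 2 by rewrite exprn_gt0.
  move=> h1 h2; rewrite -(ltr_pM2r M2); nra.
have k3 : x * 3 <= (1 - a) * x * 4.
  have : a * 4 * x <= 1 * x by rewrite ler_wpM2r ?(ltW x0)//; apply: le_trans s2 (ltW s1).
  lra.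
lra.
Qed.

(** Compare F with E over blocks of length [l]: |A^n|E| <= K e^(- s n) |A^n|F|.
    The angle bound makes |det A^n| comparable with the product of these norms, so
    that g(n, F) is comparable with their quotient. *)
Lemma dominated_lng : exists C s, 0 < s /\ forall p : S, in_line F p ->
  forall n, lng A n p <= C - s * n%:R.
Proof.
have [B [B0 hB]] := lgr_bounded A cptX.
have [a0 [a00 ha]] := angle_bound.
have l0 : 0 < l%:R :> R by rewrite ltr0n.
(* 2 B l + ln 2 accounts for an incomplete block of length l, and a0 for the
   angle between E and F *)
exists (2 * B * l%:R + ln 2 - ln a0), (ln 2 / l%:R).
have ln2 : 0 < ln 2 :> R by rewrite ln_gt0// ltr1n.
split; first by rewrite divr_gt0.
move=> p pF n.
have [z [v [v1 pE]]] := sph_surj p.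
have [dE _ _ _] := EF z; have [e [eE e1]] := line_unit_vec dE.
pose q := sph e1.
have qE : in_line E q by apply/in_line_sph.
have qp : sproj q = sproj p by rewrite pE !sproj_sph.
have vF : v \in F z by move: pF; rewrite pE in_line_sph.
have block k : Sl (k * l) q - Sl (k * l) p <= - ln 2 * k%:R.
  elim: k => [|k IH]; first by rewrite mul0n !birkhoff_sum0 subrr mulr0.
  rewrite mulSn addnC !birkhoff_sum_add.
  have := @domination_sum (iter (k * l) (smap A) q) (iter (k * l) (smap A) p).
  rewrite !in_line_iter// !sproj_iter qp => /(_ qE pF erefl).
  rewrite -natr1; lra.
have diff : Sl n q - Sl n p <= 2 * B * l%:R + ln 2 - ln 2 / l%:R * n%:R.
  rewrite {1 2}(divn_eq n l) !birkhoff_sum_add.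
  set k := (n %/ l)%N; set r := (n %% l)%N.
  have rl : r%:R <= l%:R :> R by rewrite ler_nat ltnW// ltn_mod.
  have h1 := birkhoff_sum_norm (smap A) r (iter (k * l) (smap A) q) hB.
  have h2 := birkhoff_sum_norm (smap A) r (iter (k * l) (smap A) p) hB.
  have h3 : B * r%:R <= B * l%:R by rewrite ler_wpM2l.
  move: h1 h2; rewrite !ler_norml => /andP[_ h1] /andP[h2 _].
  have nk : ln 2 / l%:R * n%:R <= ln 2 * k%:R + ln 2 :> R.
    have hn : n%:R <= (k%:R + 1) * l%:R :> R.
      rewrite natr1 -natrM ler_nat {1}(divn_eq n l) -/k -/r mulSn addnC.
      by rewrite leq_add2r ltnW// ltn_mod.
    rewrite mulrAC ler_pdivrMr//; have := ler_wpM2l (ltW ln2) hn; lra.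
  have := block k; lra.
have arL := ha z e v eE vF e1 v1.
have ar := area_le (itc n z e) (itc n z v).
rewrite area_hom (hnorm_iter A n e1) (hnorm_iter A n v1) (absdet_iter_sph A n v1) in ar.
have := le_trans (ler_wpM2l (expR_ge0 _) arL) ar; rewrite -expRD => hexp.
set D := birkhoff_sum _ _ _ _ in hexp.
have hln : ln (expR D * a0) <= ln (expR (Sl n (sph e1) + Sl n (sph v1))).
  by rewrite ler_ln ?posrE ?mulr_gt0 ?expR_gt0.
rewrite lnM ?posrE ?expR_gt0// !expRK in hln.
by rewrite lngE pE -/D; move: diff; rewrite pE /q; lra.
Qed.

Hypothesis hausX : hausdorff_space X.
Hypothesis noA : no_attractors A.
Variable b : R.
Hypothesis b0 : 0 < b.
Hypothesis diss : asymptotically_dissipative A b.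

(** A critical direction lies in F and would be contracted.  The regular vector
    found in the closed set of directions contracted at all later times has
    exponents [k1] and [k2 - k1], both negative. *)
Theorem dominated_no_critical bm bp : Delta bm bp -> b < bp -> Crit A bm bp = set0.
Proof.
move=> [bp0 bpm bm1] bbp; have bm0 : 0 < bm by apply: lt_le_trans bpm.
apply/seteqP; split=> // x /(CritP _ _ bp0 bm0)[p [px hp]].
have [C [s [s0 hF]]] := dominated_lng.
(* both the critical direction and F have ln g growing linearly in backward
   time, and only one direction of the fibre can do so *)
have pF : in_line F p.
  have [z [u [u1 pE]]] := sph_surj p.
  have [_ dF _ _] := EF z; have [v [vF v1]] := line_unit_vec dF.
  have lnm : 0 < - ln bm by rewrite oppr_gt0 ln_lt0// bm0 bm1.
  pose s' := Num.min s (- ln bm).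
  have s'0 : 0 < s' by rewrite lt_min s0.
  have uv : u \in <[v]>%VS.
    apply: (@collinear_of_lng _ _ _ (inv_cocycle A) z u v u1 v1 s' `|C| s'0) => n.
      rewrite -pE; have [_ h] := hp n; apply: le_trans h.
      apply: (@le_trans _ _ (s' * n%:R)); first by rewrite gerBl.
      by rewrite ler_wpM2r// ge_min lexx orbT.
    pose t := iter n (smap (inv_cocycle A)) (sph v1).
    have tv : iter n (smap A) t = sph v1 by exact: iter_smap_invK.
    rewrite -tv lng_inv.
    have tF : in_line F t by rewrite -(in_line_iter n t invF) tv in_line_sph.
    have h1 := hF t tF n; have h2 := ler_norm C.
    have : s' * n%:R <= s * n%:R by rewrite ler_wpM2r// ge_min lexx.
    lra.
  rewrite pE in_line_sph; move/vlineP : uv => [c ->]; exact: memvZ.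
have [C0 [C00 hdiss]] := diss.
pose a := (ln bp - ln b) / 2.
have a0 : 0 < a by rewrite divr_gt0// subr_gt0 ltr_ln// posrE.
have Sp n : Sl n p <= ln C0 / 2 - a * n%:R.
  have [h _] := hp n; move: h; rewrite lngE.
  have [z [u [u1 pE]]] := sph_surj p.
  have := hdiss z n.
  have -> : absdet (cocycleZ A n z) = absdet (itc n z) by [].
  rewrite (absdet_iter_sph A n u1) -pE.
  move=> hd.
  have {}hd : ln (expR (birkhoff_sum (smap A) (ldet A) n p)) <= ln (C0 * b ^+ n).
    by rewrite ler_ln// posrE ?expR_gt0// mulr_gt0// exprn_gt0.
  move: hd; rewrite expRK lnM ?posrE ?exprn_gt0// lnXn// -mulr_natr /a => h1 h2.
  lra.
have [B [B0 hB]] := lgr_bounded A cptX.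
have a20 : 0 < a / 2 by rewrite divr_gt0.
(* f decreases at the rate a / 2; at a time after which it never exceeds its
   present value, F is contracted at that rate for all later times *)
pose f n := Sl n p + a / 2 * n%:R.
have fC n : f n <= `|ln C0 / 2| - a / 2 * n%:R.
  rewrite /f; have := Sp n; have := ler_norm (ln C0 / 2); lra.
have fB n : f n - f n.+1 <= B + 1.
  rewrite /f birkhoff_sumS -(natr1 n); have := hB (iter n (smap A) p).
  rewrite ler_norml => /andP[h _]; lra.
have B10 : 0 < B + 1 by rewrite ltr_wpDl.
have pl := pliss a20 B10 fC _ fB.
have {}pl := pl _; rewrite {1}/f birkhoff_sum0 add0r mulr0 in pl.
have {}pl := pl (lexx _).
pose Q := [set y : S | forall k, lng A k y <= C - s * k%:R] `&`
          [set y : S | forall k, Sl k y <= - (a / 2) * k%:R].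
have cQ : closed Q.
  apply: closedI; apply: closed_forall => k; apply: closed_le_fun.
    exact: lng_continuous.
  by apply: birkhoff_sum_continuous; [exact: smap_continuous|exact: lgr_continuous].
have Qgood k : (forall j, f (k + j)%N <= f k) -> Q (iter k (smap A) p).
  move=> gk; split=> j /=; first by apply: hF; rewrite in_line_iter.
  have := gk j; rewrite /f birkhoff_sum_add natrD; lra.
(* the frequency a / 2 / (B + 1) given by the lemma of Pliss, halved in order to
   absorb the additive constant *)
pose c := a / 4 / (B + 1).
have c0 : 0 < c by apply: divr_gt0 => //; apply: divr_gt0.
have freq : \forall n \near \oo, c <= visit_freq R (smap A) p Q n.
  have [N hN] := natr_unbounded (`|ln C0 / 2| / (a / 4)).
  exists N.+1 => // n /= Nn.
  have n0 : 0 < n%:R :> R by rewrite ltr0n; apply: leq_ltn_trans Nn.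
  rewrite /visit_freq ler_pdivlMr// /c mulrAC ler_pdivrMr//.
  have h1 : \sum_(k < n) (`[< forall j, f (k + j)%N <= f k >])%:R <=
      \sum_(k < n) (iter k (smap A) p \in Q)%:R :> R.
    apply: ler_sum => k _; case: asboolP => [gk|_]; last by case: (_ \in _).
    by rewrite (mem_set (Qgood k gk)).
  have h2 : `|ln C0 / 2| <= a / 4 * n%:R.
    rewrite [leRHS]mulrC -ler_pdivrMr; last by rewrite divr_gt0.
    by apply: le_trans (ltW hN) _; rewrite ler_nat ltnW.
  have h3 := pl n.
  have h4 := ler_wpM2l (ltW B10) h1.
  rewrite [leRHS]mulrC; lra.
have [y [[Qy1 Qy2] [k1 [k2 [[g1 _ g3 _] _ hpos _]]]]] :=
  fwd_regular_point cptX hausX noA cQ c0 freq.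
have k1neg : k1 <= - (a / 2).
  apply: (cvgr_to_le g1); exists 1%N => // n /= n0.
  by rewrite mulrC ler_pdivrMr ?ltr0n//; exact: Qy2.
have k2neg : k2 - 2 * k1 <= - s.
  have g : (n%:R)^-1 * lng A n y @[n --> \oo] --> k2 - 2 * k1.
    rewrite (_ : (fun n => _) = (fun n => n%:R^-1 * birkhoff_sum (smap A) (ldet A) n y -
       2 * (n%:R^-1 * Sl n y))); last first.
      by apply: funext => n; rewrite lngE mulrBr; congr (_ - _); rewrite mulrCA.
    exact: (cvgB g3 (cvgM (cvg_cst (2 : R)) g1)).
  have gC : (n%:R)^-1 * (lng A n y - C) @[n --> \oo] --> k2 - 2 * k1.
    by apply: (@average_shift _ _ _ _ `|C|) g => n; rewrite subKr.
  apply: (cvgr_to_le gC); exists 1%N => // n /= n0.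
  rewrite mulrC ler_pdivrMr ?ltr0n//; have := Qy1 n => /=; lra.
move: hpos; rewrite le_max => /orP[]; lra.
Qed.

End DominatedNoCritical.

(** * Absence of critical points yields domination *)

Section ExpandedLines.
Variables (R : realType) (X : ptopologicalType) (TX : hermitian_bundle R X).
Local Notation T := (fibre TX).
Local Notation S := (sphere TX).
Implicit Type A : linear_cocycle TX.

Lemma lng_line A n z (u v : T z) (u1 : hnorm u = 1) (v1 : hnorm v = 1) :
  u \in <[v]>%VS -> lng A n (sph u1) = lng A n (sph v1).
Proof.
move=> /vlineP[c uc]; rewrite !lngE.
have c1 : cmod c = 1 by move: u1; rewrite uc hnormZc v1 mulr1.
have -> : birkhoff_sum (smap A) (ldet A) n (sph u1) = birkhoff_sum (smap A) (ldet A) n (sph v1).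
  by apply: sum_ldet_fibre; rewrite !sproj_sph.
suff -> : birkhoff_sum (smap A) (lgr A) n (sph u1) = birkhoff_sum (smap A) (lgr A) n (sph v1).
  by [].
apply: expR_inj; rewrite -(hnorm_iter A n u1) -(hnorm_iter A n v1).
by rewrite {1}uc linearZ/= hnormZc c1 mul1r.
Qed.

(** Backward from time [n], one first undoes the [n] forward steps. *)
Lemma lng_back A n k s : lng (inv_cocycle A) (n + k) (iter n (smap A) s) =
  lng (inv_cocycle A) k s - lng A n s.
Proof. by rewrite lng_add lng_inv iter_smapK addrC. Qed.

(** Uniqueness of the direction along which ln g grows linearly. *)
Lemma in_line_of_lng A (E : forall z, {vspace T z}) (s K K' : R) (p : S) : 0 < s ->
  (forall z, \dim (E z) = 1%N) ->
  (forall q, in_line E q -> forall n : nat, s * n%:R - K <= lng A n q) ->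
  (forall n : nat, s * n%:R - K' <= lng A n p) -> in_line E p.
Proof.
move=> s0 dE hE; have [z [u [u1 ->]]] := sph_surj p => hp.
have [v [vE v1]] := line_unit_vec (dE z).
have hv := hE (sph v1) ((in_line_sph E v1).2 vE).
apply/in_line_sph.
have /vlineP[c ->] : u \in <[v]>%VS.
  apply: (@collinear_of_lng _ _ _ A z u v u1 v1 s (`|K| + `|K'|) s0) => n.
    have := hp n; have := ler_norm K'; have := normr_ge0 K; lra.
  have := hv n; have := ler_norm K; have := normr_ge0 K'; lra.
exact: memvZ.
Qed.

Lemma invariant_lines A (E : forall z, {vspace T z}) : (forall z, \dim (E z) = 1%N) ->
  (forall p, in_line E p -> in_line E (smap A p)) ->
  forall z, (cocycle_map A z @: E z)%VS = E (base A z).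
Proof.
move=> dE hE z; have [v [vE v1]] := line_unit_vec (dE z).
have v0 : v != 0 by rewrite -hnorm_gt0 v1.
have EE : E z = <[v]>%VS.
  by apply/esym/eqP; rewrite eqEdim -memvE vE dim_vline v0 dE.
have Av0 : cocycle_map A z v != 0 by apply: contra v0 => /eqP/cocycle_map_eq0/eqP.
rewrite EE limg_line; apply/eqP; rewrite eqEdim -memvE dim_vline Av0 dE leqnn andbT.
have := hE _ ((in_line_sph E v1).2 vE); have [a [a0 [u1 ->]]] := smap_sph A v1.
by rewrite in_line_sph => /(memvZ a^-1); rewrite scalerA mulVf// scale1r.
Qed.

End ExpandedLines.

Section NoCriticalDominated.
Variables (R : realType) (X : ptopologicalType) (TX : hermitian_bundle R X).
Local Notation T := (fibre TX).
Local Notation S := (sphere TX).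
Variable A : linear_cocycle TX.
Hypothesis cptX : compact [set: X].
Hypothesis hausX : hausdorff_space X.
Local Notation A' := (inv_cocycle A).
Local Notation itc := (iter_cocycle (cocycle_map A)).
Local Notation Sl := (birkhoff_sum (smap A) (lgr A)).
Local Notation Sd := (birkhoff_sum (smap A) (ldet A)).

Lemma lng_bounded : exists M, 0 <= M /\ (forall s, `|gam A s| <= M) /\
  forall s, `|gam A' s| <= M.
Proof.
have [M hM] := continuous_compact_norm (@sphere_compact _ _ TX cptX) (@gam_continuous _ _ _ A).
exists M; split; first exact: le_trans (normr_ge0 _) (hM point).
by split=> // s; rewrite -(smap_invK A s) gam_inv normrN.
Qed.

(** Otherwise the closed sets of directions satisfying the critical inequalities
    up to time N would all be nonempty, and a common point is critical. *)
Lemma no_critical_window bt : 0 < bt -> bt < 1 -> Crit A bt bt = set0 ->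
  exists N, forall p, (forall k, (k <= N)%N -> - ln bt * k%:R <= lng A' k p) ->
  exists n, (n <= N)%N /\ lng A n p < ln bt * n%:R.
Proof.
move=> b0 b1 none; apply/not_existsP => nN.
pose W n := [set p : S | forall k, (k <= n)%N ->
  ln bt * k%:R <= lng A k p /\ - ln bt * k%:R <= lng A' k p].
have [||||p hp] := @compact_nested S W.
- exact: sphere_compact.
- move=> n; apply: closed_forall => k; apply: closed_forall => _.
  by apply: closedI; apply: closed_ge_fun; exact: lng_continuous.
- move=> n; have /existsNP[p /not_implyP[h1 h2]] := nN n; exists p => k kn; split; last exact: h1.
  by rewrite leNgt; apply/negP => h; apply: h2; exists k.
- by move=> n p hp k kn; apply: hp; rewrite leqW.
have : Crit A bt bt (sproj p).
  by apply/(CritP A (sproj p) b0 b0); exists p; split=> // n; exact: (hp n n (leqnn n)).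
by rewrite none.
Qed.

Variables (s : R) (N : nat).
Hypothesis s0 : 0 < s.
Let W m p := forall k, (k <= m)%N -> s * k%:R <= lng A' k p.
Hypothesis window : forall p, W N p -> exists n, (n <= N)%N /\ lng A n p < - s * n%:R.

(** [n] is the first time at which the forward inequality fails.  Up to it, the
    backward inequalities at time [n] compare two values of ln g; beyond it, they
    add those of [p]. *)
Lemma window_step m p : W m p -> (N <= m)%N ->
  exists n, (0 < n <= N)%N /\ W (m + n) (iter n (smap A) p).
Proof.
move=> Wp Nm.
have [n0 [n0N h0]] : exists n, (n <= N)%N /\ lng A n p < - s * n%:R.
  by apply: window => k kN; apply: Wp; exact: leq_trans Nm.
have exn : exists n, lng A n p < - s * n%:R by exists n0.
case: (ex_minnP exn) => n hn nmin; exists n; split.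
  rewrite (leq_trans (nmin _ h0) n0N) andbT lt0n; apply/eqP => n0'.
  by move: hn; rewrite n0' /lng birkhoff_sum0 mulr0 ltxx.
move=> k kmn; have [kn|nk] := leqP k n.
  have e : iter n (smap A) p = iter k (smap A) (iter (n - k) (smap A) p).
    by rewrite -iterD subnKC.
  have := lng_add A (n - k) k p; rewrite subnK// e lng_inv => e'.
  have [->|k0] := posnP k; first by rewrite mulr0 /lng birkhoff_sum0 oppr0.
  have h : - s * (n - k)%:R <= lng A (n - k) p.
    rewrite leNgt; apply/negP => /nmin; rewrite leqNgt ltn_subrL k0 (leq_trans k0 kn)//.
  by move: h; rewrite natrB//; lra.
rewrite -(subnKC (ltnW nk)) lng_back natrD.
have := Wp (k - n)%N; rewrite leq_subLR addnC => /(_ kmn); lra.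
Qed.

Variable M : R.
Hypothesis M0 : 0 <= M.
Hypothesis hM : forall s, `|gam A s| <= M.
Hypothesis hM' : forall s, `|gam A' s| <= M.
(* M N bounds ln g during at most N steps without control, and s N is the growth
   missed during them *)
Let C := (M + s) * N%:R.

(** The times reached by iterating [window_step] have gaps at most [N], and the
    constant [C] pays for the steps since the last of them. *)
Lemma window_forward p n k : W N p -> (k <= n)%N ->
  s * k%:R - C <= lng A' k (iter n (smap A) p).
Proof.
move=> Wp kn.
have [n0 [n0n nN Wn]] : exists n0, [/\ (n0 <= n)%N, (n <= n0 + N)%N &
    W (N + n0) (iter n0 (smap A) p)].
  elim: n {k kn} => [|n [n0 [n0n nN Wn]]]; first by exists 0%N; rewrite addn0.
  have [nN'|nN'] := ltnP n (n0 + N); first by exists n0; split=> //; exact: leqW.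
  have [j [/andP[j0 jN] Wj]] := window_step Wn (leq_addr _ _).
  exists (j + n0)%N; split; last by rewrite iterD [(j + _)%N]addnC addnA.
    by apply: leqW; apply: leq_trans nN'; rewrite addnC leq_add2l.
  by apply: leq_ltn_trans nN _; rewrite -addnA -addn1 addnC leq_add// leq_addr.
have back r q : (r <= N)%N -> s * r%:R - C <= lng A' r q.
  move=> rN; have := birkhoff_sum_norm (smap A') r q hM'; rewrite -/(lng A' r q).
  rewrite ler_norml => /andP[h _].
  have h1 : r%:R <= N%:R :> R by rewrite ler_nat.
  have h2 := ler_wpM2l M0 h1; have h3 := ler_wpM2l (ltW s0) h1; rewrite /C; lra.
have rN : (n - n0 <= N)%N by rewrite leq_subLR.
have [kr|rk] := leqP k (n - n0); first by apply: back; exact: leq_trans rN.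
have -> : iter n (smap A) p = iter (n - n0) (smap A) (iter n0 (smap A) p).
  by rewrite -iterD subnK.
have h := back (n - n0)%N (iter (n - n0) (smap A) (iter n0 (smap A) p)) rN.
have := Wn (k - (n - n0))%N; rewrite leq_subLR => hk.
have {}hk : s * (k - (n - n0))%:R <= lng A' (k - (n - n0)) (iter n0 (smap A) p).
  apply: hk; rewrite addnCA subnK//; apply: leq_trans kn _; exact: leq_addl.
have e : k = ((n - n0) + (k - (n - n0)))%N by rewrite subnKC// ltnW.
rewrite [X in lng A' X _]e lng_add iter_smapK.
move: h hk; rewrite (natrB _ (ltnW rk)); lra.
Qed.

Hypothesis noA : no_attractors A.
Variable b : R.
Hypothesis b0 : 0 < b.
Hypothesis diss : asymptotically_dissipative A b.
Hypothesis sb : s < - ln b.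

Let O n := [set p : S | forall k, (0 < k <= n)%N -> s * k%:R < lng A' k p].

Let O_open n : open (O n).
Proof.
elim: n => [|n IH].
  rewrite (_ : O 0 = setT); first exact: openT.
  by apply/seteqP; split=> // p _ k; case: k.
rewrite (_ : O n.+1 = O n `&` [set p | s * n.+1%:R < lng A' n.+1 p]).
  apply: openI => //; apply: (@open_comp S R (lng A' n.+1) [set x | s * n.+1%:R < x]) => [p _|].
    exact: lng_continuous.
  exact: open_gt.
apply/seteqP; split=> [p hp|p [h1 h2] k /andP[k0]].
  split=> [k /andP[k0 kn]|]; last by apply: hp; rewrite /= leqnn.
  by apply: hp; rewrite k0 leqW.
rewrite leq_eqVlt => /orP[/eqP ->//|kn]; by apply: h1; rewrite k0.
Qed.

(** In backward time ln g grows along [v] at the rate 2 lambda^+ minus the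
    exponent of the determinant, at least - ln b > s. *)
Lemma expanded_backward z l1 l2 lp (v : T z) (v1 : hnorm v = 1) (y : S) :
  sproj y = z -> birkhoff_regular A y l1 l2 -> lyapunov_exponent A v lp -> 0 <= lp ->
  exists j, forall k, (0 < k)%N -> s * k%:R < lng A' k (iter j (smap A') (sph v1)).
Proof.
move=> yz [_ _ a3 a4] [_ vN] lp0.
have [B hB] := ldet_bounded A cptX.
have dE n : birkhoff_sum (smap A') (ldet A') n (sph v1) =
    birkhoff_sum (smap A') (ldet A') n y.
  by apply: sum_ldet_fibre; rewrite sproj_sph yz.
have dP n : Sd n y = ln (absdet (itc n z)) by rewrite -yz absdet_iter expRK.
have dN : (n%:R)^-1 * birkhoff_sum (smap A') (ldet A') n (sph v1) @[n --> \oo] --> - l2.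
  under eq_fun do rewrite dE ldet_inv_sum.
  by apply: averageN; exact: sum_shift_average a4.
have gN : (n%:R)^-1 * birkhoff_sum (smap A') (lgr A') n (sph v1) @[n --> \oo] --> - lp.
  rewrite (_ : (fun n => _) = (fun n => - ((- n%:R)^-1 * ln (hnorm (cocycleZ A (- n%:Z) z v))))).
    exact: cvgN.
  apply: funext => n; rewrite hnorm_cocycleZ_neg (hnorm_iter A' n v1) expRK.
  by rewrite invrN mulNr opprK.
have gam' : (n%:R)^-1 * lng A' n (sph v1) @[n --> \oo] --> - l2 - 2 * - lp.
  rewrite (_ : (fun n => _) = (fun n => n%:R^-1 * birkhoff_sum (smap A') (ldet A') n (sph v1) -
     2 * (n%:R^-1 * birkhoff_sum (smap A') (lgr A') n (sph v1)))); last first.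
    by apply: funext => n; rewrite lngE mulrBr; congr (_ - _); rewrite mulrCA.
  exact: (cvgB dN (cvgM (cvg_cst (2 : R)) gN)).
have l2b : l2 <= ln b.
  have [C0 [C00 hd]] := diss.
  have g : (n%:R)^-1 * (Sd n y - ln C0) @[n --> \oo] --> l2.
    by apply: (@average_shift _ _ _ _ `|ln C0|) a3 => n; rewrite subKr.
  apply: (cvgr_to_le g); exists 1%N => // n /= n0.
  rewrite mulrC ler_pdivrMr ?ltr0n// dP lerBlDl.
  have a0 : 0 < absdet (itc n z) by rewrite -yz absdet_iter expR_gt0.
  have := hd z n; have -> : absdet (cocycleZ A n z) = absdet (itc n z) by [].
  move=> h; have : ln (absdet (itc n z)) <= ln (C0 * b ^+ n).
    by rewrite ler_ln// posrE mulr_gt0// exprn_gt0.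
  by rewrite lnM ?posrE ?exprn_gt0// lnXn// mulr_natr.
pose L := - l2 - 2 * - lp.
(* the room between s and the rate L makes the final inequalities strict *)
pose s' := (s + L) / 2.
have sL : s < L by rewrite /L; have := sb; lra.
have e0 : 0 < L - s' by rewrite /s'; lra.
have s's : s < s' by rewrite /s'; lra.
pose e := (L - s') / 2; have e0' : 0 < e by rewrite divr_gt0.
have [K [K0 hK]] := average_bound gam' e0'.
have [m hm] := natr_unbounded (K / e).
pose a n := lng A' n (sph v1) - s' * n%:R.
have far n : (m <= n)%N -> 0 <= a n.
  move=> mn; have := hK n; rewrite ler_norml => /andP[h _].
  have : K <= e * n%:R.
    rewrite mulrC -ler_pdivrMr//; apply: le_trans (ltW hm) _; by rewrite ler_nat.
  by move: h; rewrite /a /e /L; lra.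
(* the time at which the deviation a is least starts an orbit satisfying every
   one of the lower bounds *)
have [j hj] : exists j, forall n, a j <= a n.
  have [i hi] : exists i : 'I_m.+1, forall j : 'I_m.+1, a i <= a j.
    case: (@Order.TotalTheory.arg_minP _ _ _ (ord0 : 'I_m.+1) xpredT
      (fun j : 'I_m.+1 => a j) isT) => i _ hi.
    by exists i => j; exact: hi.
  exists i => n; have [nm|mn] := ltnP n m.+1; first exact: (hi (Ordinal nm)).
  apply: (@le_trans _ _ 0); last exact: far (ltnW mn).
  by apply: le_trans (hi ord0) _; rewrite /a /= /lng birkhoff_sum0 mulr0 subrr.
exists j => k k0; have := hj (j + k)%N; rewrite /a lng_add natrD.
have : s * k%:R < s' * k%:R by rewrite ltr_pM2r// ltr0n.
lra.
Qed.

(** Otherwise all later points of the backward orbit avoid the open projection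
    of the directions satisfying the strict inequalities, and so does the backward
    orbit of some regular point, contrary to [expanded_backward]. *)
Lemma window_recurrent x n0 : exists n, (n0 <= n)%N /\
  exists p, W N p /\ sproj p = iter n (base_inv A) x.
Proof.
apply: contrapT => none.
have ON n : (n0 <= n)%N -> ~ (sproj @` O N) (iter n (base_inv A) x).
  move=> nn [p Op pE]; apply: none; exists n; split=> //; exists p; split=> // k kN.
  have [->|k0] := posnP k; first by rewrite mulr0 /lng birkhoff_sum0.
  by apply: ltW; apply: Op; rewrite k0.
have [v v1] := exists_unit_vec TX (iter n0 (base_inv A) x).
pose Q := [set q : S | forall j, ~ (sproj @` O N) (iter j (base_inv A) (sproj q))].
have cQ : closed Q.
  apply: closed_forall => j.
  apply: (@open_closedC S [set q | (sproj @` O N) (iter j (base_inv A) (sproj q))]).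
  have -> : [set q : S | (sproj @` O N) (iter j (base_inv A) (sproj q))] =
      (fun q : S => sproj (iter j (smap A') q)) @^-1` (sproj @` O N).
    by apply/seteqP; split=> q /=; rewrite sproj_iter.
  apply: open_comp; last exact/sproj_open/O_open.
  move=> q _; apply: (@continuous_comp S S X (iter j (smap A')) sproj).
    elim: j => [|j IH]; first exact: cvg_id.
    by apply: (@continuous_comp S S S (iter j (smap A')) (smap A')) => //; exact: smap_continuous.
  exact: sproj_continuous.
have hQ : \forall n \near \oo, 1 <= visit_freq R (smap A') (sph v1) Q n.
  exists 1%N => // n /= n1; rewrite /visit_freq ler_pdivlMr ?ltr0n// mul1r.
  rewrite (eq_bigr (fun=> 1)); first by rewrite sumr_const card_ord.
  move=> k _; rewrite mem_set// => j; rewrite sproj_iter sproj_sph -!iterD.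
  by apply: ON; rewrite leq_addl.
have [y [Qy [l1 [l2 [g _ hmax [_ [E [F [[_ dF _ _] _ hF]]]]]]]]] :=
  bwd_regular_point cptX hausX noA cQ ltr01 hQ.
have [u [uF u1]] := line_unit_vec dF.
have u0 : u != 0 by rewrite -hnorm_gt0 u1.
have [j hj] := expanded_backward u1 erefl g (hF u uF u0) hmax.
apply: (Qy j); exists (iter j (smap A') (sph u1)); first by move=> k /andP[k0 _]; exact: hj.
by rewrite sproj_iter sproj_sph.
Qed.

(** Over a point of the backward orbit of [z] far in the past and in the
    window, [window_forward] gives a direction over [z] with the estimate up to a
    large time; pass to the limit. *)
Lemma expanded_direction z : exists v : T z, exists v1 : hnorm v = 1,
  forall k, s * k%:R - C <= lng A' k (sph v1).
Proof.
pose D n := [set p : S | sproj p = z /\ forall k, (k <= n)%N -> s * k%:R - C <= lng A' k p].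
have [||||p hp] := @compact_nested S D.
- exact: sphere_compact.
- move=> n; apply: closedI.
    apply: (@closed_comp S X sproj [set z]) => [p _|]; first exact: sproj_continuous.
    by apply: accessible_closed_set1; exact: hausdorff_accessible.
  apply: closed_forall => k; apply: closed_forall => _.
  by apply: closed_ge_fun; exact: lng_continuous.
- move=> n; have [m [nm [p [Wp pE]]]] := window_recurrent z n.
  exists (iter m (smap A) p); split.
    by rewrite sproj_iter pE; elim: m {nm pE} => //= m IH; rewrite -iterS iterSr /= base_invK.
  by move=> k kn; apply: window_forward => //; exact: leq_trans nm.
- by move=> n p [pz hp]; split=> // k kn; apply: hp; rewrite leqW.
have [y [v [v1 pE]]] := sph_surj p.
have [pz _] := hp 0%N; move: pz; rewrite pE sproj_sph => yz.
by subst y; exists v, v1 => k; rewrite -pE; have [_] := hp k; exact.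
Qed.

Definition expanded_line z : {vspace T z} := <[projT1 (cid (expanded_direction z))]>%VS.
Local Notation F := expanded_line.

Lemma dim_expanded_line z : \dim (F z) = 1%N.
Proof.
rewrite /F; case: cid => v [v1 _] /=.
by rewrite dim_vline -hnorm_gt0 v1 ltr01.
Qed.

Lemma expanded_line_back q : in_line F q -> forall k, s * k%:R - C <= lng A' k q.
Proof.
have [z [u [u1 ->]]] := sph_surj q; rewrite in_line_sph /F; case: cid => v [v1 hv] /= uv k.
by rewrite (lng_line A' k u1 v1 uv).
Qed.

Lemma expanded_line_inv z : (cocycle_map A z @: F z)%VS = F (base A z).
Proof.
apply: invariant_lines z; first exact: dim_expanded_line.
move=> p pF.
apply: (@in_line_of_lng _ _ _ A' F s C (C + M + s) _ s0 dim_expanded_line expanded_line_back).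
case=> [|k].
  rewrite mulr0 /lng birkhoff_sum0; have : 0 <= C by rewrite mulr_ge0// addr_ge0// ltW.
  by have := s0; have := M0; lra.
rewrite -[k.+1]add1n -[smap A p]/(iter 1 (smap A) p) lng_back natrD.
have := expanded_line_back pF k; have := hM p; rewrite ler_norml => /andP[_ h].
have -> : lng A 1 p = gam A p by rewrite /lng birkhoff_sumS birkhoff_sum0 add0r.
lra.
Qed.

Lemma expanded_line_fwd q : in_line F q -> forall k, lng A k q <= C - s * k%:R.
Proof.
move=> qF k; have := @expanded_line_back (iter k (smap A) q).
rewrite in_line_iter; last exact: expanded_line_inv.
by move=> /(_ qF k); rewrite lng_inv; lra.
Qed.

(** The series of increments of [shear] is dominated by a geometric one, since
    g decays uniformly along [expanded_line]; its tail after [n] is of the order of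
    g(n, v).  Removing the limit [t] thus leaves A^n (w - t v) with norm of the
    order of the orthogonal part |det A^n| / |A^n v|. *)
Lemma contracted_direction : exists D, 0 < D /\ forall z (v : T z), v \in F z -> hnorm v = 1 ->
  exists e : T z, [/\ hnorm e = 1, area e v != 0 &
    forall n, hnorm (itc n z e) <= D * (absdet (itc n z) / hnorm (itc n z v))].
Proof.
have [P [P0 hP]] := shear_step A cptX.
pose q := expR (- s).
have q0 : 0 < q by exact: expR_gt0.
have q1 : q < 1 by rewrite -expR0 ltr_expR oppr_lt0.
pose D0 := P * expR C / (1 - q).
have D00 : 0 < D0 by rewrite divr_gt0 ?subr_gt0// mulr_gt0// expR_gt0.
exists (1 + (D0 + D0)); split; first by rewrite ltr_wpDr// ltW// addr_gt0.
move=> z v vF v1; have v0 : v != 0 by rewrite -hnorm_gt0 v1.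
have pF := (in_line_sph F v1).2 vF.
have [w [w1 wv]] := exists_orth v1.
have awv : area w v = 1 by rewrite area_orth// w1 v1 mulr1.
pose g n := expR (lng A n (sph v1)).
have gE n : absdet (itc n z) / hnorm (itc n z v) ^+ 2 = g n.
  rewrite /g lngE expRB (hnorm_iter A n v1) (absdet_iter_sph A n v1).
  by rewrite expr2 -expRD -mulr2n mulr_natl.
have step n : cmod (shear A v w n.+1 - shear A v w n) <= P * g n.
  by have := hP z v w n v0; rewrite awv mulr1 gE.
have [t ht] := complex_summable_limit step.
have tail n m : \sum_(n <= k < n + m) P * g k <= D0 * g n.
  apply: (@le_trans _ _ (\sum_(n <= k < n + m) P * expR C * g n * expR (s * n%:R) * q ^+ k)).
    rewrite big_nat [leRHS]big_nat; apply: ler_sum => k /andP[nk _].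
    rewrite /q -expRM_natl /g -!mulrA ler_pM2l// -!expRD ler_expR.
    have := lng_add A n (k - n) (sph v1); rewrite subnKC// => ->.
    have qF : in_line F (iter n (smap A) (sph v1)).
      by rewrite in_line_iter//; exact: expanded_line_inv.
    have := expanded_line_fwd qF (k - n); rewrite natrB//; lra.
  rewrite -mulr_sumr.
  apply: (@le_trans _ _ (P * expR C * g n * expR (s * n%:R) * (q ^+ n / (1 - q)))).
    by rewrite ler_wpM2l ?geometric_tail// !mulr_ge0 ?expR_ge0// ltW.
  have -> : q ^+ n = (expR (s * n%:R))^-1.
    by rewrite /q -expRM_natl -expRN; congr expR; lra.
  rewrite /D0 le_eqVlt; apply/orP; left; apply/eqP.
  have q1' : 1 - q != 0 by rewrite gt_eqF// subr_gt0.
  have es : expR (s * n%:R) != 0 by rewrite gt_eqF// expR_gt0.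
  by field; rewrite q1' es.
pose e := w - t *: v.
have aev : area e v = 1 by rewrite area_shear.
have e1 : 1 <= hnorm e by rewrite -aev; have := area_le e v; rewrite v1 mulr1.
have en0 : 0 < hnorm e by apply: lt_le_trans e1.
exists (rc (hnorm e)^-1 *: e); split.
- by rewrite hnormZc cmodR ger0_norm ?invr_ge0 ?hnorm_ge0// mulVf// gt_eqF.
- by rewrite areaZl aev mulr1 cmodR normr_eq0 invr_eq0 gt_eqF.
move=> n; rewrite linearZ/= hnormZc cmodR ger0_norm ?invr_ge0 ?hnorm_ge0//.
have a0 : 0 < hnorm (itc n z v) by rewrite hnorm_gt0 itc_eq0.
apply: (@le_trans _ _ (hnorm (itc n z e))).
  by rewrite -[leRHS]mul1r ler_wpM2r ?hnorm_ge0// invf_le1.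
apply: le_trans (shear_split A w t n v0) _; rewrite awv mulr1 mulrDl mul1r lerD2l.
apply: (@le_trans _ _ ((D0 * g n + D0 * g n) * hnorm (itc n z v))).
  by rewrite ler_wpM2r ?hnorm_ge0//; apply: ht => m; exact: tail.
rewrite -mulrDl -gE expr2 le_eqVlt; apply/orP; left; apply/eqP.
by field; rewrite gt_eqF.
Qed.

(** The line E spanned by the contracted direction satisfies
    g(n, E) >= e^(s n - K), hence is unique and invariant; the ratio of the growths
    on E and F is at most D g(n, F). *)
Theorem window_dominated : dominated_splitting A.
Proof.
have [D [D0 hD]] := contracted_direction.
have dF := dim_expanded_line.
have exE z : exists e : T z, exists v : T z, [/\ v \in F z, hnorm v = 1, hnorm e = 1,
    area e v != 0 &
    forall n, hnorm (itc n z e) <= D * (absdet (itc n z) / hnorm (itc n z v))].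
  have [v [vF v1]] := line_unit_vec (dF z); have [e [e1 ev he]] := hD z v vF v1.
  by exists e, v.
pose E z : {vspace T z} := <[projT1 (cid (exE z))]>%VS.
have dE z : \dim (E z) = 1%N.
  rewrite /E; case: cid => e [v [_ _ e1 _ _]] /=.
  by rewrite dim_vline -hnorm_gt0 e1 ltr01.
pose K := 2 * ln D + C.
have lngK q : in_line E q -> forall n : nat, s * n%:R - K <= lng A n q.
  have [z [u [u1 ->]]] := sph_surj q; rewrite in_line_sph /E.
  case: cid => e [v [vF v1 e1 ev he]] /= ue n.
  rewrite (lng_line A n u1 e1 ue).
  have := he n; rewrite (hnorm_iter A n e1) (hnorm_iter A n v1) (absdet_iter_sph A n v1).
  rewrite -expRB => h.
  have {}h : ln (expR (Sl n (sph e1))) <= ln (D * expR (Sd n (sph v1) - Sl n (sph v1))).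
    by rewrite ler_ln// ?posrE ?mulr_gt0 ?expR_gt0.
  move: h; rewrite lnM ?posrE ?expR_gt0// !expRK => h.
  have := expanded_line_fwd ((in_line_sph F v1).2 vF) n.
  rewrite !lngE (_ : Sd n (sph e1) = Sd n (sph v1)); last first.
    by apply: sum_ldet_fibre; rewrite !sproj_sph.
  by rewrite /K; lra.
have invE z : (cocycle_map A z @: E z)%VS = E (base A z).
  apply: invariant_lines z => // p pE.
  apply: (@in_line_of_lng _ _ _ A E s K (K + M) _ s0 dE lngK) => n.
  have := lngK p pE n.+1; rewrite -add1n lng_add natrD.
  have -> : lng A 1 p = gam A p by rewrite /lng birkhoff_sumS birkhoff_sum0 add0r.
  have := hM p; rewrite ler_norml => /andP[_ h]; have := s0; rewrite -[iter 1 _ _]/(smap A p); lra.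
have [l hl] := natr_unbounded ((ln D + C + ln 2) / s).
exists E, F; split.
- move=> z; rewrite /E; case: cid => e [v [vF v1 _ ev _]] /=.
  have v0 : v != 0 by rewrite -hnorm_gt0 v1.
  have -> : F z = <[v]>%VS.
    by apply/esym/eqP; rewrite eqEdim -memvE vF dim_vline v0 dF.
  exact: line_splitting_area.
- exact: invE.
- exact: expanded_line_inv.
exists l.+1; split=> // z.
have [e [v [eE vF v1 e1 he]]] : exists e v, [/\ e \in E z, v \in F z, hnorm v = 1,
    hnorm e = 1 & forall n, hnorm (itc n z e) <= D * (absdet (itc n z) / hnorm (itc n z v))].
  by rewrite /E; case: cid => e [v [vF v1 e1 ev he]] /=; exists e, v; rewrite memv_line.
rewrite (restr_norm_back _ dF expanded_line_inv vF v1).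
rewrite (restr_normE _ (dE z) eE e1) hnorm_cocycleZ_pos.
apply: (@le_lt_trans _ _ (D * expR (lng A l.+1 (sph v1)))).
  have a0 : 0 < hnorm (itc l.+1 z v) by rewrite hnorm_gt0 itc_eq0 -hnorm_gt0 v1.
  rewrite ler_pdivrMr//; apply: le_trans (he l.+1) _.
  rewrite -mulrA ler_pM2l// lngE expRB (hnorm_iter A l.+1 v1) (absdet_iter_sph A l.+1 v1).
  have es : expR (Sl l.+1 (sph v1)) != 0 by rewrite gt_eqF// expR_gt0.
  rewrite mulr_natl mulr2n expRD le_eqVlt; apply/orP; left; apply/eqP.
  by field.
have h := expanded_line_fwd ((in_line_sph F v1).2 vF) l.+1.
have h2 : ln D + C + ln 2 < s * l.+1%:R.
  have : s * l%:R <= s * l.+1%:R by rewrite ler_pM2l// ler_nat.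
  by move: hl; rewrite ltr_pdivrMr// mulrC; lra.
rewrite -(@lnK _ D) ?posrE// -expRD div1r -[X in _ < X^-1](@lnK _ 2) ?posrE//.
by rewrite -expRN ltr_expR; lra.
Qed.

End NoCriticalDominated.

(** Any beta between [b] and 1 will do as both parameters. *)
Theorem no_critical_dominated (R : realType) (X : ptopologicalType)
    (TX : hermitian_bundle R X) (A : linear_cocycle TX) (b : R) :
  compact [set: X] -> hausdorff_space X -> no_attractors A -> 0 < b -> b < 1 ->
  asymptotically_dissipative A b ->
  (forall bm bp : R, Delta bm bp -> b < bp -> Crit A bm bp = set0) ->
  dominated_splitting A.
Proof.
move=> cptX hausX noA b0 b1 diss none.
pose bt := (b + 1) / 2.
have bt0 : 0 < bt by rewrite /bt; lra.
have bt1 : bt < 1 by rewrite /bt; lra.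
have bbt : b < bt by rewrite /bt; lra.
have dbt : Delta bt bt by split.
have [N hN] := no_critical_window cptX bt0 bt1 (none _ _ dbt bbt).
have [M [M0 [hM hM']]] := lng_bounded A cptX.
have s0 : 0 < - ln bt by rewrite oppr_gt0 ln_lt0// bt0.
apply: (@window_dominated _ _ _ A cptX hausX (- ln bt) N s0 _ M M0 hM hM' noA b b0 diss).
  by move=> p /hN[n [nN hn]]; exists n; rewrite opprK.
by rewrite ltrN2 ltr_ln// posrE.
Qed.

(** * The equivalence *)

Theorem theoremA (R : realType) (X : ptopologicalType)
    (X_compact : compact [set: X]) (X_hausdorff : hausdorff_space X)
    (TX : hermitian_bundle R X) (A : linear_cocycle TX) (b : R)
    (b_gt0 : 0 < b) (b_lt1 : b < 1)
    (A_no_attractors : no_attractors A)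
    (A_dissipative : asymptotically_dissipative A b) :
  dominated_splitting A <->
  (forall beta_m beta_p : R, Delta beta_m beta_p -> b < beta_p ->
     Crit A beta_m beta_p = set0).
Proof.
split=> [[E [F [EF invE invF [l [l1 dom]]]]] bm bp|].
  exact: (dominated_no_critical X_compact EF invE invF l1 dom X_hausdorff
    A_no_attractors b_gt0 A_dissipative).
exact: no_critical_dominated.
Qed.
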